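(* Let $A$ be the stiffness matrix of the linear finite element approximation, on an arbitrary simplicial mesh $\mathcal{T}_h$ with $N$ elements of $\Omega\subset\mathbb{R}^d$ ($d\ge1$), of the boundary value problem $-\nabla\cdot(\mathbb{D}\nabla u)=f$ in $\Omega$, $u=0$ on $\partial\Omega$, and let $S=\mathrm{diag}(s_1,\dots,s_{N_{vi}})$ with $s_j=\sqrt{A_{jj}}$ (Jacobi preconditioning); see context for notation. There is a constant $C>0$, independent of the mesh, of the number of mesh elements, and of the solution of the boundary value problem, such that the following hold. (i) The condition number of $A$ satisfies, for $d=1$, $$\kappa(A)\;\le\;C\,N^2\,\frac1{d_{\min}}\max_j\sum_{K\in\omega_j}\mathbb{D}_K\frac{|\bar K|}{|K|},$$ and, for $d\ge2$, $$\kappa(A)\;\le\;C\,N^{\frac2d}\left(\frac{N^{1-\frac2d}}{d_{\min}}\max_j\sum_{K\in\omega_j}|K|\,\bigl\|(F_K')^{-1}\mathbb{D}_K(F_K')^{-T}\bigr\|_2\right)\times\begin{cases}1+\ln\dfrac{|\bar K|}{|K_{\min}|},& d=2,\\[6pt] \left(\dfrac1N\displaystyle\sum_{K\in\mathcal{T}_h}\left(\dfrac{|\bar K|}{|K|}\right)^{\frac{d-2}{2}}\right)^{\frac2d},& d\ge3.\end{cases}$$ (ii) The condition number of the Jacobi preconditioned stiffness matrix satisfies, for $d=1$, $$\kappa(S^{-1}AS^{-1})\;\le\;C\,N^2\,\frac1{N d_{\min}}\sum_{K\in\mathcal{T}_h}\mathbb{D}_K\frac{|\bar K|}{|K|},$$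 and, for $d\ge2$, $$\kappa(S^{-1}AS^{-1})\;\le\;C\,N^{\frac2d}\left(\frac1{N d_{\min}^{d/2}}\sum_{K\in\mathcal{T}_h}|K|\,\bigl\|(F_K')^{-1}\mathbb{D}_K(F_K')^{-T}\bigr\|_2^{\frac d2}\right)^{\frac2d}\times\begin{cases}1+\left|\ln\dfrac{\max_{K\in\mathcal{T}_h}\|(F_K')^{-1}\mathbb{D}_K(F_K')^{-T}\|_2}{\sum_{K\in\mathcal{T}_h}|K|\,\|(F_K')^{-1}\mathbb{D}_K(F_K')^{-T}\|_2}\right|,& d=2,\\[8pt] 1,& d\ge3.\end{cases}$$
   Context: $\Omega\subset\mathbb{R}^d$ is a simply connected polygonal or polyhedral domain. The diffusion matrix $\mathbb{D}=\mathbb{D}(\boldsymbol{x})$ is a symmetric positive definite $d\times d$ matrix (a positive scalar if $d=1$) for which there are constants $d_{\min},d_{\max}>0$ with $d_{\min}I\le\mathbb{D}(\boldsymbol{x})\le d_{\max}I$ for all $\boldsymbol{x}\in\Omega$ (in the sense that differences are positive semidefinite). $\mathcal{T}_h$ is a simplicial decomposition (triangulation) of $\overline\Omega$ into $N$ nondegenerate $d$-simplices $K$, as used for conforming linear finite elements, with at least one interior vertex; no assumption on the shape or size of the elements is made. The interior vertices (those not on $\partial\Omega$) are numbered $1,\dots,N_{vi}$, and $\phi_j$ is the continuous function that is affine on each element, equals $1$ at vertex $j$ and $0$ at all other vertices. $\omega_j$ is the element patch of the $j$th vertex, i.e. the set of elements of $\mathcal{T}_h$ having it as a vertex; $\max_j$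 is over $j=1,\dots,N_{vi}$. $|K|$ is the volume of $K$, $|K_{\min}|=\min_{K\in\mathcal{T}_h}|K|$, $|\bar K|=\frac1N|\Omega|$ is the average element size, and $\mathbb{D}_K=\frac1{|K|}\int_K\mathbb{D}(\boldsymbol{x})\,d\boldsymbol{x}$. The stiffness matrix is $$A_{ij}=\sum_{K\in\mathcal{T}_h}|K|\,\nabla\phi_i|_K\cdot\mathbb{D}_K\nabla\phi_j|_K,\qquad i,j=1,\dots,N_{vi}.$$ $\hat K$ is a fixed reference $d$-simplex with $|\hat K|=1$, $F_K:\hat K\to K$ is an affine bijection onto $K$ and $F_K'$ is its (constant) Jacobian matrix; $(F_K')^{-T}$ is the transpose of the inverse. $\|\cdot\|_2$ is the spectral matrix norm, and $\kappa(\cdot)=\lambda_{\max}(\cdot)/\lambda_{\min}(\cdot)$ is the spectral condition number of a symmetric positive definite matrix. *)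

(* Defs.v *)
From HB Require Import structures.
From mathcomp Require Import all_boot all_order all_algebra.
From mathcomp Require Import all_classical all_reals all_analysis.

Set Implicit Arguments.
Unset Strict Implicit.
Unset Printing Implicit Defensive.

Import Order.TTheory GRing.Theory Num.Theory.
Import numFieldNormedType.Exports.

Local Open Scope classical_set_scope.
Local Open Scope ring_scope.

(** * Lebesgue measure on [R^d]

   The iterated product measure, built on [d.-tuple R] with the sigma-algebra
   generated by the coordinates. *)

Section lebesgue_cons.
Variables (R : realType) (n : nat).
Variable mu : {sigma_finite_measure set (n.-tuple (measurableTypeR R)) -> \bar R}.

Definition tuple_cons (p : measurableTypeR R * n.-tuple (measurableTypeR R)) :
  n.+1.-tuple (measurableTypeR R) := [the n.+1.-tuple _ of p.1 :: p.2].

Lemma measurable_tuple_cons : measurable_fun [set: _] tuple_cons.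
Proof. exact: measurable_cons measurable_fst measurable_snd. Qed.

Definition lebesgue_cons : set (n.+1.-tuple (measurableTypeR R)) -> \bar R :=
  pushforward (@lebesgue_measure R \x mu)%E tuple_cons.

Let lebesgue_cons0 : lebesgue_cons set0 = 0%E.
Proof. by rewrite /lebesgue_cons /pushforward preimage_set0 measure0. Qed.

Let lebesgue_cons_ge0 A : (0 <= lebesgue_cons A)%E.
Proof. by rewrite /lebesgue_cons /pushforward; exact: measure_ge0. Qed.

Let lebesgue_cons_sigma_additive : semi_sigma_additive lebesgue_cons.
Proof.
move=> F mF tF mUF.
have mpre A : measurable A -> measurable (tuple_cons @^-1` A).
  by move=> mA; rewrite -[X in measurable X]setTI; exact: measurable_tuple_cons.
rewrite /lebesgue_cons /pushforward preimage_bigcup.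
apply: measure_semi_sigma_additive => [i|/=|]; first exact: mpre.
  move=> i j _ _ [x [Fix Fjx]].
  by apply: tF => //; exists (tuple_cons x).
by rewrite -preimage_bigcup; exact: mpre.
Qed.

HB.instance Definition _ := isMeasure.Build _ _ _ lebesgue_cons
  lebesgue_cons0 lebesgue_cons_ge0 lebesgue_cons_sigma_additive.

Let lebesgue_cons_sigma_finite : sigma_finite setT lebesgue_cons.
Proof.
have /sigma_finiteP[F [TF ndF Foo]] := sigma_finiteT (@lebesgue_measure R).
have /sigma_finiteP[G [TG ndG Goo]] := sigma_finiteT mu.
pose u (t : n.+1.-tuple (measurableTypeR R)) := (thead t, [tuple of behead t]).
have mu_ : measurable_fun setT u.
  apply/measurable_fun_pairP; split; first exact: measurable_tnth.
  exact: measurable_behead.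
exists (fun i => u @^-1` (F i `*` G i)).
  rewrite -preimage_bigcup (_ : \bigcup_i _ = setT) ?preimage_setT//.
  rewrite -subTset => -[x t] _.
  have [i _ Fix] : (\bigcup_i F i) x by rewrite -TF.
  have [j _ Gjt] : (\bigcup_i G i) t by rewrite -TG.
  exists (maxn i j) => //; split.
  - by move: Fix; exact/subsetPset/ndF/leq_maxl.
  - by move: Gjt; exact/subsetPset/ndG/leq_maxr.
move=> i; have [mF Fi] := Foo i; have [mG Gi] := Goo i; split.
  by rewrite -[X in measurable X]setTI; apply: mu_ => //; exact: measurableX.
rewrite /lebesgue_cons /pushforward -comp_preimage.
rewrite (_ : u \o tuple_cons = id); last first.
  by rewrite funeqE => -[x t]; congr pair; exact/val_inj.
by rewrite preimage_id product_measure1E// lte_mul_pinfty// ge0_fin_numE.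
Qed.

HB.instance Definition _ := Measure_isSigmaFinite.Build _ _ _ lebesgue_cons
  lebesgue_cons_sigma_finite.

End lebesgue_cons.

Fixpoint lebesgue_tuple (R : realType) (n : nat) :
    {sigma_finite_measure set (n.-tuple (measurableTypeR R)) -> \bar R} :=
  match n with
  | 0 => [the {sigma_finite_measure set _ -> \bar R} of dirac [tuple]]
  | n.+1 => [the {sigma_finite_measure set _ -> \bar R} of
               lebesgue_cons (lebesgue_tuple R n)]
  end.

Lemma lebesgue_tuple_box (R : realType) (n : nat)
    (A : 'I_n -> set (measurableTypeR R)) :
  (forall i, measurable (A i)) ->
  lebesgue_tuple R n [set t | forall i, A i (tnth t i)] =
  (\prod_(i < n) lebesgue_measure (A i))%E.
Proof.
elim: n A => [|n IHn] A mA.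
  rewrite big_ord0 /= diracE mem_set//= => i; by case: i.
rewrite big_ord_recl -(IHn (fun i => A (lift ord0 i))) => [|i]; last exact: mA.
pose B := [set t : n.-tuple (measurableTypeR R) |
  forall i, A (lift ord0 i) (tnth t i)].
have mB : measurable B.
  rewrite (_ : B = \bigcap_(i in [set: 'I_n])
    ((fun t : n.-tuple (measurableTypeR R) => tnth t i) @^-1`
       A (lift ord0 i))).
    apply: fin_bigcap_measurable => // i _; rewrite -[X in measurable X]setTI.
    by apply: measurable_tnth => //; exact: mA.
  by apply/seteqP; split => t /= h i; [move=> _|]; exact: (h i).
rewrite -/B -product_measure1E//= /lebesgue_cons /pushforward.
congr product_measure1; apply/seteqP; split => -[x t] /=.
  by move=> h; split => [|i]; [exact: (h ord0)|have := h (lift ord0 i); rewrite tnthS].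
by move=> [h0 h] i; case: (unliftP ord0 i) => [j ->|->//]; rewrite tnthS; exact: h.
Qed.

Definition col_of_tuple (R : realType) (d : nat)
  (t : d.-tuple (measurableTypeR R)) : 'cV[R]_d := \col_i tnth t i.

Section space.
Variables (R : realType) (d : nat).
Local Notation pt := 'cV[R]_d.
Implicit Types (A Omega : set pt) (f : pt -> R) (x g : pt).

Definition volume A : R := fine (lebesgue_tuple R d (@col_of_tuple R d @^-1` A)).

Definition space_integral A f : R :=
  \int[lebesgue_tuple R d]_(t in @col_of_tuple R d @^-1` A) f (col_of_tuple t).

(* Lebesgue measurability, as Borel measurability up to a null set. *)
Definition lebesgue_measurable_on A f :=
  exists2 h : d.-tuple (measurableTypeR R) -> R,
    measurable_fun (@col_of_tuple R d @^-1` A) h &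
    {ae lebesgue_tuple R d,
      forall t, A (col_of_tuple t) -> f (col_of_tuple t) = h t}.

Definition dotv x g : R := (x^T *m g) ord0 ord0.

Definition boundary A := closure A `\` interior A.

Definition affine_with A f g :=
  exists c : R, forall x, A x -> f x = dotv g x + c.

(* The constant gradient of a function that is affine on [A]; it is unique
   when [A] has nonempty interior. *)
Definition grad_on A f : pt := xget 0 [set g | affine_with A f g].

Definition loops_contractible A :=
  forall gamma : R -> pt,
    {within `[0, 1], continuous gamma} -> gamma @` `[0, 1] `<=` A ->
    gamma 0 = gamma 1 ->
    exists H : R * R -> pt,
      [/\ {within `[0, 1] `*` `[0, 1], continuous H},
          H @` (`[0, 1] `*` `[0, 1]) `<=` A,
          forall t, t \in `[0, 1] -> H (0, t) = gamma t,
          forall t, t \in `[0, 1] -> H (1, t) = gamma 0 &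
          forall s, s \in `[0, 1] -> H (s, 0) = gamma 0 /\ H (s, 1) = gamma 0].

Section simplex.
Variable I : finType.
Implicit Types (p : I -> pt) (K : {set I}).

Definition hull p K : set pt :=
  [set x | exists l : I -> R,
    [/\ forall i, i \in K -> 0 <= l i, \sum_(i in K) l i = 1 &
        x = \sum_(i in K) l i *: p i]].

Definition affinely_independent p K :=
  forall c : I -> R, \sum_(i in K) c i = 0 -> \sum_(i in K) c i *: p i = 0 ->
  forall i, i \in K -> c i = 0.

Definition nondegenerate_simplex p K :=
  #|K| = d.+1 /\ affinely_independent p K.

End simplex.

Definition simplex (p : 'I_d.+1 -> pt) : set pt := hull p [set: 'I_d.+1]%SET.

(* A polyhedral domain is a connected set that is the interior of a finite
   union of [d]-simplices (an interval, a polygon, a polyhedron, ...). *)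
Definition polyhedral_domain Omega :=
  [/\ Omega !=set0, connected Omega &
      exists (m : nat) (p : 'I_m -> 'I_d.+1 -> pt),
        (forall k, nondegenerate_simplex (p k) [set: 'I_d.+1]%SET) /\
        Omega = interior (\bigcup_k simplex (p k))].

Definition simply_connected Omega :=
  connected Omega /\ loops_contractible Omega.

(* Each element is given by the set of its [d.+1] vertices. *)
Record mesh := Mesh {
  nvert : nat;
  vtx : 'I_nvert -> pt;
  elts : {set {set 'I_nvert}} }.

Section mesh.
Variables (Omega : set pt) (M : mesh).
Local Notation element := {set 'I_(nvert M)}.
Implicit Types (K : element).

Definition cell K : set pt := hull (@vtx M) K.

(* The intersection clause is conformity: two elements meet exactly in the face
   spanned by their common vertices (possibly empty). *)
Definition triangulation :=
  [/\ injective (@vtx M),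
      forall K, K \in elts M -> nondegenerate_simplex (@vtx M) K,
      forall v, exists2 K, K \in elts M & v \in K,
      forall K L, K \in elts M -> L \in elts M ->
        cell K `&` cell L = cell (K :&: L)%SET &
      \bigcup_(K in [set` elts M]) cell K = closure Omega].

Definition interior_vertices : {set 'I_(nvert M)} :=
  finset (fun v => `[< ~ boundary Omega (vtx v) >]).

Definition nvi : nat := #|interior_vertices|.

Definition ivertex (j : 'I_nvi) : 'I_(nvert M) := enum_val j.

Definition nelts : nat := #|elts M|.

Definition vertex_patch (j : 'I_nvi) : {set element} :=
  finset (fun K => (K \in elts M) && (ivertex j \in K)).

Definition avg_volume : R := volume Omega / nelts%:R.

(* The nodal basis function of the [j]th interior vertex. *)
Definition hat_function (j : 'I_nvi) (phi : pt -> R) :=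
  [/\ {within closure Omega, continuous phi},
      forall K, K \in elts M -> exists g, affine_with (cell K) phi g &
      forall v, phi (vtx v) = (v == ivertex j)%:R].

Definition affine_maps (Khat : set pt) (F' : element -> 'M[R]_d)
    (b : element -> pt) :=
  forall K, K \in elts M -> set_bij Khat (cell K) (fun x => F' K *m x + b K).

Definition mean_diffusion (D : pt -> 'M[R]_d) K : 'M[R]_d :=
  \matrix_(i, j) ((volume (cell K))^-1 * space_integral (cell K) (fun x => D x i j)).

Definition stiffness (D : pt -> 'M[R]_d) (phi : 'I_nvi -> pt -> R) : 'M[R]_nvi :=
  \matrix_(i, j) \sum_(K in elts M) volume (cell K) *
    dotv (grad_on (cell K) (phi i))
         (mean_diffusion D K *m grad_on (cell K) (phi j)).

(* [(F'_K)^-1 D_K (F'_K)^-T], the mean diffusion pulled back to the reference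
   simplex. *)
Definition reference_diffusion (D : pt -> 'M[R]_d) (F' : element -> 'M[R]_d) K :
  'M[R]_d := invmx (F' K) *m mean_diffusion D K *m (invmx (F' K))^T.

End mesh.

End space.

Section matrices.
Variables (R : realType) (n : nat).
Implicit Types (A : 'M[R]_n).

Definition posdef A :=
  A^T = A /\ forall x : 'cV[R]_n, x != 0 -> 0 < dotv x (A *m x).

Definition possemidef A :=
  A^T = A /\ forall x : 'cV[R]_n, 0 <= dotv x (A *m x).

Definition norm2 (x : 'cV[R]_n) : R := Num.sqrt (dotv x x).

Definition spectral_norm A : R :=
  sup [set norm2 (A *m x) | x in [set x | norm2 x = 1]].

(* [eigenvalue] refers to row vectors, which is immaterial for symmetric [A]. *)
Definition lambda_max A : R := sup [set a | eigenvalue A a].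
Definition lambda_min A : R := inf [set a | eigenvalue A a].

Definition kappa A : R := lambda_max A / lambda_min A.

Definition jacobi A : 'M[R]_n :=
  let S := diag_mx (\row_j Num.sqrt (A j j)) in invmx S *m A *m invmx S.

End matrices.

Definition diffusion_matrix (R : realType) (d : nat) (Omega : set 'cV[R]_d)
    (D : 'cV[R]_d -> 'M[R]_d) (dmin dmax : R) :=
  [/\ 0 < dmin, 0 < dmax,
      forall i j, lebesgue_measurable_on Omega (fun x => D x i j) &
      forall x, Omega x ->
        [/\ posdef (D x), possemidef (D x - dmin%:M) &
            possemidef (dmax%:M - D x)]].

(* Only meaningful for [P] nonempty, as [sup set0 = inf set0 = 0]. *)
Definition max_over (R : realType) (I : finType) (P : {set I}) (f : I -> R) : R :=
  sup [set f i | i in [set` P]].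
Definition min_over (R : realType) (I : finType) (P : {set I}) (f : I -> R) : R :=
  inf [set f i | i in [set` P]].

(* Main.v *)
(** Let [u] be the finite element function with nodal values [a], extended by
   [0] outside [Omega], and [m t] the volume of [{|u| > t}].  By Fubini, some
   shift [h] in a cube of volume [4 * m s] moves half of [{|u| > t}] out of
   [{|u| > s}]; along each of the segments from [x] to [x + h] the function [u]
   crosses the strip [{s < |u| <= t}], and integrating Cauchy-Schwarz over
   these segments gives
     [m t * (t - s)^2 <= C * (m s)^(2/d) * E s t],
   with [E s t] the Dirichlet energy of [u] in the strip.  Iterating this over
   the levels [sqrt E * 2^k] ([d >= 3]), respectively over equidistant levels
   ([d = 2]), yields a Sobolev, respectively Trudinger, inequality; since [|u|]
   exceeds half of its maximum over [K] on a fixed fraction of [K], both hold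
   for the piecewise constant function [max_K |u|], with constants depending
   only on [d] and [|Omega|].  Hoelder's and Young's inequalities turn them into
   bounds of [sum_K w_K |K| max_K |u|^2] by the energy, for arbitrary weights
   [w].  For [d = 1] the crossing estimate alone bounds [sup |u|^2].
   Taking [w_K = 1/|K|] bounds the smallest eigenvalue of [A] from below, and
   [w_K = ||(F_K')^-1 D_K (F_K')^-T||] does so for the Jacobi preconditioned
   matrix, whose diagonal entries these weights dominate. *)

Require Import Defs.
From mathcomp Require Import all_boot all_order all_algebra.
From mathcomp Require Import all_classical all_reals all_analysis.
From mathcomp Require Import measurable_realfun.
From mathcomp Require Import ring lra.

Set Implicit Arguments.
Unset Strict Implicit.
Unset Printing Implicit Defensive.

Import Order.TTheory GRing.Theory Num.Theory.
Import numFieldNormedType.Exports.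

Local Open Scope classical_set_scope.
Local Open Scope ring_scope.

(** * Affine invariance and slicing of Lebesgue measure *)

(** Upper bounds for the largest eigenvalues need no analysis: an element carries at most [d.+1]
    nodal functions, so the form of [A] is at most [d.+1] times its diagonal part on any mesh. All
    difficulty is in the lower bounds, whose embedding constants must not see the mesh. Level sets
    achieve this because the energies of disjoint strips add up to at most the whole energy, so that
    one crossing estimate can be used at all levels simultaneously; of the domain only its volume
    (for [d = 1] a bound on its size) enters. The shifts leave the domain, which requires the
    extension by 0 to be continuous. That nodal functions vanish on the boundary is not part of
    [hat_function]; it is deduced from conformity, by showing that the elements around an interior
    vertex cover a neighbourhood of every point with a positive coordinate there. A second gap is
    that [D] is controlled on the open set [Omega] only, whereas its means are integrals over closed
    cells; faces must be shown to be null sets before the integrals can be cut down to the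
    interior. *)

Lemma scaled_pushforward d1 d2 (T1 : measurableType d1) (T2 : measurableType d2)
    (R : realType) (m : {measure set T1 -> \bar R}) (f : T1 -> T2) (c : R) :
  measurable_fun setT f -> 0 <= c ->
  exists nu : {measure set T2 -> \bar R},
    forall A, nu A = (c%:E * m (f @^-1` A))%E.
Proof.
move=> mf c0.
exists (mscale (NngNum c0)
  (measure_function_pushforward__canonical__measure_function_Measure m mf)).
by [].
Qed.

Section affine1.
Variable R : realType.

Let aff (c v : R) (x : measurableTypeR R) : measurableTypeR R := c * x + v.

Lemma measurable_affine (c v : R) : measurable_fun setT (aff c v).
Proof.
by apply: measurable_funD => //; apply: measurable_funM.
Qed.

(** Uniqueness of Lebesgue measure: [|c|] times the pushforward under the affine map gives every
    half-open interval its length. For [c < 0] the preimage of []a, b]] is closed on the left and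
    open on the right, hence the case split. *)
Lemma lebesgue_measure_affine (c v : R) (A : set (measurableTypeR R)) :
  c != 0 -> measurable A ->
  lebesgue_measure [set x : measurableTypeR R | A (c * x + v)] =
  (`|c|^-1%:E * lebesgue_measure A)%E.
Proof.
move=> c0 mA.
have [nu nuE] := scaled_pushforward (@lebesgue_measure R)
  (measurable_affine c v) (normr_ge0 c).
have -> : lebesgue_measure A = nu A.
  apply: lebesgue_measure_unique => //= X [[a b] /= _ <-].
  rewrite nuE /= (_ : _ @^-1` _ = [set x : measurableTypeR R | `]a, b]%classic (c * x + v)])//.
  have [ltab|leba] := ltP a b; last first.
    rewrite set_itv_ge ?bnd_simp ?ltNge ?leba//.
    by rewrite measure0 mule0.
  rewrite [LHS](_ : _ = (b - a)%:E); last first.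
    by rewrite lebesgue_measure_itv/= lte_fin ltab.
  have [c_gt0|c_le0] := ltP 0 c.
    rewrite (_ : [set x | _] = (`](a - v) / c, (b - v) / c]%classic : set R)).
      rewrite lebesgue_measure_itv /= lte_fin ltr_pM2r ?invr_gt0// ltrD2r ltab.
      by rewrite -EFinD -EFinM gtr0_norm//; congr EFin; field.
    by apply/seteqP; split => x /=;
      rewrite !in_itv/= ltr_pdivrMr// ler_pdivlMr// ltrBlDr lerBrDr mulrC.
  have c_lt0 : c < 0 by rewrite lt_neqAle c0.
  rewrite (_ : [set x | _] = (`[(b - v) / c, (a - v) / c[%classic : set R)).
    rewrite lebesgue_measure_itv /= lte_fin ltr_nM2r ?invr_lt0// ltrD2r ltab.
    by rewrite -EFinD -EFinM ltr0_norm//; congr EFin; field.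
  apply/seteqP; split => x /=;
    by rewrite !in_itv/= ltr_ndivlMr// ler_ndivrMr// ltrBlDr lerBrDr (mulrC x) andbC.
by rewrite nuE/= muleA -EFinM mulVf ?normr_eq0// mul1e.
Qed.

End affine1.

Section affine_tuple.
Variable R : realType.
Local Notation T := (measurableTypeR R).

Definition aff_tuple n (c : R) (v : 'I_n -> R) (t : n.-tuple T) : n.-tuple T :=
  [tuple c * tnth t i + v i | i < n].

Lemma measurable_aff_tuple n (c : R) (v : 'I_n -> R) :
  measurable_fun setT (aff_tuple c v).
Proof.
apply: (measurable_fun_tnthP _).2 => i.
rewrite (_ : _ \o _ = (fun t : n.-tuple T => c * tnth t i + v i)); last first.
  by apply/funext => t /=; rewrite tnth_mktuple.
apply: measurable_funD => //; apply: measurable_funM => //.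
exact: measurable_tnth.
Qed.

(** Induction over the coordinates: uniqueness of the product measure reduces the step to
    rectangles, where the one-dimensional formula and the induction hypothesis apply. *)
Lemma lebesgue_tuple_affine n (c : R) (v : 'I_n -> R) (A : set (n.-tuple T)) :
  0 < c -> measurable A ->
  lebesgue_tuple R n (aff_tuple c v @^-1` A) =
  ((c ^+ n)^-1%:E * lebesgue_tuple R n A)%E.
Proof.
move=> c0; elim: n v A => [|n IHn] v A mA.
  rewrite expr0 invr1 mul1e; congr (lebesgue_tuple _ _ _).
  by apply/seteqP; split => t /=; rewrite [aff_tuple c v t]tuple0 [t]tuple0.
pose v' (i : 'I_n) : R := v (lift ord0 i).
pose psi (p : T * n.-tuple T) : T * n.-tuple T := (c * p.1 + v ord0, aff_tuple c v' p.2).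
have mpsi : measurable_fun setT psi.
  apply/measurable_fun_pairP; split.
    by apply: measurable_funD => //; apply: measurable_funM.
  apply: (measurableT_comp (measurable_aff_tuple c v')) => //.
have [nu nuE] := scaled_pushforward (@lebesgue_measure R \x lebesgue_tuple R n)%E
  mpsi (ltW (exprn_gt0 n.+1 c0)).
have mA' : measurable (@tuple_cons R n @^-1` A).
  by rewrite -[X in measurable X]setTI; apply: measurable_tuple_cons.
have -> : lebesgue_tuple R n.+1 A = nu (@tuple_cons R n @^-1` A).
  rewrite /= /lebesgue_cons /pushforward; apply: product_measure_unique => // B C mB mC.
  have mB' : measurable [set x : T | B (c * x + v ord0)].
    have := @measurable_affine R c (v ord0) measurableT B mB.
    by rewrite setTI.
  have mC' : measurable (aff_tuple c v' @^-1` C).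
    have := @measurable_aff_tuple n c v' measurableT C mC.
    by rewrite setTI.
  have E : (@lebesgue_measure R \x lebesgue_tuple R n)%E (psi @^-1` (B `*` C)) =
    (lebesgue_measure [set x : T | B (c * x + v ord0)%R] *
     lebesgue_tuple R n (aff_tuple c v' @^-1` C))%E by exact: product_measure1E.
  have -> : nu (B `*` C) = ((c ^+ n.+1)%:E * (lebesgue_measure [set x : T | B (c * x + v ord0)%R] *
     lebesgue_tuple R n (aff_tuple c v' @^-1` C)))%E by rewrite -E; exact: nuE.
  rewrite IHn// lebesgue_measure_affine ?gt_eqF//.
  rewrite gtr0_norm// muleACA [LHS]muleA -!EFinM.
  suff -> : c ^+ n.+1 * (c^-1 * c ^- n) = 1 by rewrite mul1e.
  by rewrite -invfM -exprS mulfV// gt_eqF// exprn_gt0.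
rewrite nuE muleA -EFinM mulVf ?mul1e ?gt_eqF ?exprn_gt0//.
have E p : aff_tuple c v (tuple_cons p) = tuple_cons (psi p).
  apply: eq_from_tnth => i; rewrite tnth_mktuple /tuple_cons.
  by case: (unliftP ord0 i) => [j ->|->]; rewrite ?tnthS ?tnth_mktuple.
rewrite /= /lebesgue_cons /pushforward; congr product_measure1.
by apply/seteqP; split => p /=; rewrite E.
Qed.

End affine_tuple.

Section column_measure.
Variables (R : realType) (d : nat).
Local Notation pt := 'cV[R]_d.
Local Notation T := (measurableTypeR R).
Local Notation ctup := (@col_of_tuple R d).
Local Notation mu := (lebesgue_tuple R d).
Implicit Types (A B S Q : set pt) (x v h : pt).

(** Columns carry the topology and the linear algebra, tuples the measure; measurability is
    transported along [col_of_tuple]. *)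
Definition cmeasurable A := measurable (ctup @^-1` A).
Definition vol A : \bar R := mu (ctup @^-1` A).

Definition tuple_of_col (x : pt) : d.-tuple T := [tuple x i ord0 | i < d].

Lemma tuple_of_colK : cancel tuple_of_col ctup.
Proof. by move=> x; apply/colP => i; rewrite mxE tnth_mktuple. Qed.

Lemma volumeE A : volume A = fine (vol A).
Proof. by []. Qed.

Lemma vol_ge0 A : (0 <= vol A)%E. Proof. exact: measure_ge0. Qed.

Lemma le_vol A B : cmeasurable A -> cmeasurable B -> A `<=` B ->
  (vol A <= vol B)%E.
Proof. by move=> mA mB AB; apply: le_measure; rewrite ?inE// => t; exact: AB. Qed.

Lemma cmeasurableI A B : cmeasurable A -> cmeasurable B -> cmeasurable (A `&` B).
Proof. exact: measurableI. Qed.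

Lemma cmeasurableU A B : cmeasurable A -> cmeasurable B -> cmeasurable (A `|` B).
Proof. exact: measurableU. Qed.

Lemma cmeasurableD A B : cmeasurable A -> cmeasurable B -> cmeasurable (A `\` B).
Proof. exact: measurableD. Qed.

Lemma cmeasurableT : cmeasurable setT.
Proof. exact: measurableT. Qed.

Lemma cmeasurable_bigcap (I : finType) (P : set I) (F : I -> set pt) :
  (forall i, P i -> cmeasurable (F i)) -> cmeasurable (\bigcap_(i in P) F i).
Proof.
move=> mF; rewrite /cmeasurable preimage_bigcap.
by apply: fin_bigcap_measurable => //; exact: finite_finset.
Qed.

Lemma cmeasurable_bigcup (I : finType) (P : set I) (F : I -> set pt) :
  (forall i, P i -> cmeasurable (F i)) -> cmeasurable (\bigcup_(i in P) F i).
Proof.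
move=> mF; rewrite /cmeasurable preimage_bigcup.
by apply: fin_bigcup_measurable => //; exact: finite_finset.
Qed.

Lemma dotvE x v : dotv x v = \sum_i x i ord0 * v i ord0.
Proof. by rewrite /dotv mxE; apply: eq_bigr => i _; rewrite mxE. Qed.

Lemma measurable_dotv v : measurable_fun setT (fun t => dotv v (ctup t) : R).
Proof.
rewrite (_ : (fun _ => _) = (fun t : d.-tuple T => \sum_i v i ord0 * tnth t i)).
  apply: measurable_sum => i; apply: measurable_funM => //.
  exact: measurable_tnth.
by apply/funext => t; rewrite dotvE; apply: eq_bigr => i _; rewrite mxE.
Qed.

Lemma cmeasurable_affine_itv v (c : R) (i : interval R) :
  cmeasurable [set x | dotv v x + c \in i].
Proof.
have mf : measurable_fun setT (fun t => dotv v (ctup t) + c : R).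
  by apply: measurable_funD => //; exact: measurable_dotv.
have /(_ measurableT [set` i]) := mf.
by rewrite setTI; apply; exact: measurable_itv.
Qed.

Let aff_tuple_col (c : R) v t :
  ctup (aff_tuple c (fun i => v i ord0) t) = c *: ctup t + v.
Proof. by apply/colP => i; rewrite !mxE tnth_mktuple. Qed.

Lemma cmeasurable_affine (c : R) v A : cmeasurable A ->
  cmeasurable [set x | A (c *: x + v)].
Proof.
move=> mA.
have := @measurable_aff_tuple R d c (fun i => v i ord0) measurableT _ mA.
rewrite setTI /cmeasurable; congr measurable.
by apply/seteqP; split => t /=; rewrite aff_tuple_col.
Qed.

Lemma vol_affine (c : R) v A : 0 < c -> cmeasurable A ->
  vol [set x | A (c *: x + v)] = ((c ^+ d)^-1%:E * vol A)%E.
Proof.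
move=> c0 mA; rewrite /vol -(lebesgue_tuple_affine (fun i => v i ord0))//.
by congr (mu _); apply/seteqP; split => t /=; rewrite aff_tuple_col.
Qed.

Lemma vol_shift v A : cmeasurable A -> vol [set x | A (x + v)] = vol A.
Proof.
move=> mA; rewrite -[RHS]mul1e -[in RHS]invr1 -[in RHS](expr1n _ d).
rewrite -(vol_affine v)//.
by congr vol; apply/seteqP; split => x /=; rewrite scale1r.
Qed.

Lemma product_measure12 d1 d2 (T1 : measurableType d1) (T2 : measurableType d2)
    (m1 : {sigma_finite_measure set T1 -> \bar R})
    (m2 : {sigma_finite_measure set T2 -> \bar R}) (W : set (T1 * T2)) :
  measurable W ->
  (\int[m1]_x m2 (xsection W x) = \int[m2]_y m1 (ysection W y))%E.
Proof.
move=> mW.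
pose m' := [the {measure set _ -> \bar R} of (m1 \x^ m2)%E].
have /(_ m') := @product_measure_unique _ _ _ _ _ m1 m2.
apply => // A B mA mB; exact: product_measure2E.
Qed.

Lemma measurable_col_comp d1 (T1 : measurableType d1) (f : T1 -> pt) A :
  (forall i, measurable_fun setT (fun t => f t i ord0 : T)) -> cmeasurable A ->
  measurable [set t | A (f t)].
Proof.
move=> mf mA.
have m : measurable_fun setT (fun t => tuple_of_col (f t)).
  apply: (measurable_fun_tnthP _).2 => i.
  by rewrite (_ : _ \o _ = (fun t => f t i ord0 : T))//;
    apply/funext => t /=; rewrite tnth_mktuple.
have := m measurableT _ mA; rewrite setTI; congr measurable.
by apply/seteqP; split => t /=; rewrite tuple_of_colK.
Qed.

(** Averaging over [Q]: if every [h] sent more than half of [A] into [B], the set [W] of pairs would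
    have measure at least [vol A * vol Q / 2]. For a fixed point of [A], however, the shifts sending
    it into [B] have measure at most [vol B], which bounds [W] by [vol A * vol Q / 4]. *)
Lemma exists_shift A B Q :
  cmeasurable A -> cmeasurable B -> cmeasurable Q ->
  (vol A < +oo)%E -> (vol Q < +oo)%E -> (0 < vol Q)%E ->
  (4%:E * vol B <= vol Q)%E ->
  exists2 h, Q h & (2%:E * vol (A `&` [set x | B (x + h)%R]) <= vol A)%E.
Proof.
move=> mA mB mQ Aoo Qoo Q0 BQ.
apply: contrapT => noh.
have {}noh h : Q h -> (vol A < 2%:E * vol (A `&` [set x | B (x + h)%R]))%E.
  by move=> Qh; rewrite ltNge; apply/negP => le2; apply: noh; exists h.
pose W : set (d.-tuple T * d.-tuple T) :=
  [set p | [/\ Q (ctup p.1), A (ctup p.2) & B (ctup p.2 + ctup p.1)]].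
have mi1 i : measurable_fun setT (fun p : d.-tuple T * d.-tuple T => ctup p.1 i ord0 : T).
  rewrite (_ : (fun _ => _) = (fun t : d.-tuple T => tnth t i) \o fst); last first.
    by apply/funext => p /=; rewrite mxE.
  by apply: measurableT_comp; [exact: measurable_tnth|exact: measurable_fst].
have mi2 i : measurable_fun setT (fun p : d.-tuple T * d.-tuple T => ctup p.2 i ord0 : T).
  rewrite (_ : (fun _ => _) = (fun t : d.-tuple T => tnth t i) \o snd); last first.
    by apply/funext => p /=; rewrite mxE.
  by apply: measurableT_comp; [exact: measurable_tnth|exact: measurable_snd].
have mW : measurable W.
  rewrite (_ : W = [set p | Q (ctup p.1)] `&` [set p | A (ctup p.2)] `&`
    [set p | B (ctup p.2 + ctup p.1)]); last first.
    by apply/seteqP; split => p /=; [case|case=> -[]].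
  apply: measurableI; first apply: measurableI; apply: measurable_col_comp => //.
  move=> i; rewrite (_ : (fun _ => _) = (fun p => (ctup p.2 i ord0 : R) + ctup p.1 i ord0)).
    exact: (@measurable_funD _ _ R setT _ _ (mi2 i) (mi1 i)).
  by apply/funext => p; rewrite mxE.
have E := product_measure12 mu mu mW.
have le1 : ((2^-1)%:E * vol A * vol Q <= \int[mu]_x mu (xsection W x))%E.
  have mQ' : measurable (ctup @^-1` Q) by [].
  rewrite -[X in (X <= _)%E](integral_cst mu mQ').
  apply: (@le_trans _ _ (\int[mu]_(x in ctup @^-1` Q) mu (xsection W x))%E).
    apply: ge0_le_integral => //.
    - by move=> t _ /=; rewrite mule_ge0 ?lee_fin ?vol_ge0.
    - by apply: measurable_funTS; exact: measurable_fun_xsection.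
    move=> t /= Qt; have /ltW le2 := noh _ Qt.
    rewrite -(@lee_pmul2l _ 2%:E)// muleA -EFinM mulfV// mul1e.
    apply: (le_trans le2); rewrite lee_pmul2l//.
    apply: le_measure; rewrite ?inE.
    - apply: measurableI mA _; rewrite -[X in measurable X]/(_ @^-1` [set x | _]).
      have := cmeasurable_affine 1 (ctup t) mB; rewrite /cmeasurable.
      by congr measurable; apply/seteqP; split => s /=; rewrite scale1r.
    - exact: measurable_xsection.
    - by move=> s /= [As Bs]; rewrite /xsection /= inE.
  apply: ge0_subset_integral => //.
  by apply: measurable_fun_xsection.
have le2 : (\int[mu]_y mu (ysection W y) <= vol B * vol A)%E.
  have mA' : measurable (ctup @^-1` A) by [].
  rewrite -[X in (_ <= X)%E](integral_cst mu mA') [X in (_ <= X)%E]integral_mkcond.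
  apply: ge0_le_integral => //.
  - exact: measurable_fun_ysection.
  - by apply: (measurable_restrictT (cst (vol B)) mA').1; exact: measurable_cst.
  move=> t _; rewrite patchE /=; case: ifPn => At; last first.
    rewrite (_ : ysection W t = set0) ?measure0//.
    apply/seteqP; split => // s; rewrite /ysection /= inE => -[_ /= As _].
    by move/negP: At; apply; rewrite inE.
  rewrite -(vol_shift (ctup t) mB); apply: le_measure; rewrite ?inE.
  - exact: measurable_ysection.
  - have := cmeasurable_affine 1 (ctup t) mB; rewrite /cmeasurable.
    by congr measurable; apply/seteqP; split => s /=; rewrite scale1r.
  by move=> s; rewrite /ysection /= inE => -[_ _] /=; rewrite addrC.
have Afin : vol A \is a fin_num by rewrite ge0_fin_numE// vol_ge0.
have Qfin : vol Q \is a fin_num by rewrite ge0_fin_numE// vol_ge0.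
have Boo : (vol B < +oo)%E.
  by rewrite ltNge; apply/negP; rewrite leye_eq => /eqP Boo; move: BQ; rewrite Boo gt0_muley// leNgt Qoo.
have Bfin : vol B \is a fin_num by rewrite ge0_fin_numE// vol_ge0.
have le3 : ((2^-1)%:E * vol A * vol Q <= vol B * vol A)%E.
  by apply: (le_trans le1); rewrite E.
have [h Qh] : exists h, Q h.
  apply/set0P/eqP => Qe; move: Q0.
  by rewrite Qe /vol preimage_set0 measure0 ltxx.
(* If [vol A] were 0, the strict inequality [noh] would fail for any [h] in [Q]; so [vol A] can be
   cancelled below. *)
have A0 : (0 < vol A)%E.
  rewrite lt_neqAle vol_ge0 andbT; apply/negP => /eqP A0.
  have := noh _ Qh; rewrite -A0 (_ : vol _ = 0%E) ?mule0 ?ltxx//.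
  apply/eqP; rewrite eq_le vol_ge0 andbT A0; apply: le_vol => //.
  apply: cmeasurableI => //; have := cmeasurable_affine 1 h mB.
  by congr cmeasurable; apply/seteqP; split => s /=; rewrite scale1r.
move: A0 Q0 BQ le3; rewrite -(fineK Afin) -(fineK Bfin) -(fineK Qfin) -!EFinM !lte_fin !lee_fin.
move: (fine _) (fine _) (fine _) => a b q; nra.
Qed.

(** For each fixed [r] the slice of the set of pairs is a translate of [S], hence of the same
    volume; integrating over [r] in [[0, 1]] gives the last clause. *)
Lemma line_tonelli S h : cmeasurable S ->
  let seg t := [set r : T | r \in `[0%R, 1%R] /\ S (ctup t + r *: h)] in
  [/\ forall t, measurable (seg t),
      measurable_fun setT (fun t => lebesgue_measure (seg t)) &
      (\int[mu]_t lebesgue_measure (seg t) = vol S)%E].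
Proof.
move=> mS seg.
pose W : set (d.-tuple T * T) :=
  [set p | p.2 \in `[0%R, 1%R] /\ S (ctup p.1 + (p.2 : R) *: h)].
have mW : measurable W.
  rewrite (_ : W = (setT `*` [set` `[0%R, 1%R]]) `&`
    [set p | S (ctup p.1 + (p.2 : R) *: h)]); last first.
    by apply/seteqP; split => p /=; [case|case=> -[]].
  apply: measurableI; first by apply: measurableX => //; exact: measurable_itv.
  apply: measurable_col_comp => // i.
  rewrite (_ : (fun _ => _) = (fun p : d.-tuple T * T => (tnth p.1 i : R) + p.2 * h i ord0)).
    apply: measurable_funD.
      apply: (@measurableT_comp _ _ _ _ _ _ (fun t : d.-tuple T => tnth t i)).
        exact: measurable_tnth.
      exact: measurable_fst.
    by apply: measurable_funM => //; exact: measurable_snd.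
  by apply/funext => p; rewrite !mxE.
have segE t : seg t = xsection W t.
  by apply/seteqP; split => r; rewrite /xsection /= inE.
split.
- by move=> t; rewrite segE; exact: measurable_xsection.
- rewrite (_ : (fun _ => _) = @lebesgue_measure R \o xsection W).
    exact: measurable_fun_xsection.
  by apply/funext => t /=; rewrite segE.
under eq_integral do rewrite segE.
rewrite product_measure12//.
have mI : measurable ([set` `[0%R, 1%R]] : set T) by exact: measurable_itv.
have -> : vol S = (vol S * @lebesgue_measure R [set` `[0%R, 1%R]])%E.
  by rewrite lebesgue_measure_itv/= lte_fin ltr01 oppr0 adde0 mule1.
rewrite -(integral_cst _ mI) [RHS]integral_mkcond.
apply: eq_integral => r _; rewrite patchE; case: ifPn => rI; last first.
  rewrite (_ : ysection W r = set0) ?measure0//.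
  apply/seteqP; split => // s; rewrite /ysection /= inE => -[rI' _].
  by move/negP: rI; apply; rewrite inE.
rewrite /= -(vol_shift (r *: h) mS) /vol; congr (mu _).
apply/seteqP; split => s; rewrite /ysection /= inE /W /=; first by case.
by split => //; move: rI; rewrite inE.
Qed.

End column_measure.

Section finite_measure_sums.
Context d (T : measurableType d) (R : realType).
Variable mu : {measure set T -> \bar R}.
Variables (I : finType).
Implicit Types (A : set T) (F : I -> set T).

Let fsumT (f : I -> \bar R) : (\sum_(i \in [set: I]) f i = \sum_i f i)%E.
Proof.
rewrite -[RHS]big_enum [RHS]fsbig_seq ?enum_uniq//.
rewrite (_ : [set` _] = setT)//; apply/seteqP; split => i //= _.
by rewrite mem_enum.
Qed.

Lemma measure_le_sum A F : measurable A -> (forall i, measurable (F i)) ->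
  A `<=` \bigcup_i F i -> (mu A <= \sum_i mu (F i))%E.
Proof.
move=> mA mF AF; rewrite -fsumT; apply: content_sub_fsum => //.
exact: finite_finset.
Qed.

Lemma measure_bigcup_fin F : (forall i, measurable (F i)) ->
  trivIset setT F -> mu (\bigcup_i F i) = (\sum_i mu (F i))%E.
Proof.
move=> mF tF; rewrite -fsumT; apply: measure_fin_bigcup => //.
exact: finite_finset.
Qed.

End finite_measure_sums.

(** * Decay of the level sets of a continuous piecewise affine function *)

(** Cauchy-Schwarz for weights of total mass at most 1: the weighted second moment about [a] is
    nonnegative, and [a] is taken to be the weighted sum itself. *)
Lemma sqr_wsum_le (R : realFieldType) (I : finType) (x l : I -> R) :
  (forall i, 0 <= l i) -> \sum_i l i <= 1 ->
  (\sum_i x i * l i) ^+ 2 <= \sum_i x i ^+ 2 * l i.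
Proof.
move=> l0 l1.
have var a : 0 <= \sum_i x i ^+ 2 * l i - 2 * a * (\sum_i x i * l i) +
    a ^+ 2 * \sum_i l i.
  rewrite !mulr_sumr -sumrB -big_split; apply: sumr_ge0 => i _ /=.
  have := mulr_ge0 (sqr_ge0 (x i - a)) (l0 i); congr (0 <= _); ring.
have := var (\sum_i x i * l i); have := sqr_ge0 (\sum_i x i * l i).
nra.
Qed.

Section line_crossing.
Variables (R : realType) (I : finType).
Local Notation T := (measurableTypeR R).
Local Notation lam := (@lebesgue_measure R).

(** By the intermediate value theorem [gamma] takes every value in []s, t]], so the images of the
    [J i] cover this interval; a map of slope [c i] multiplies lengths by [|c i|]. *)
Lemma crossing_cover (gamma : R -> R) (J : I -> set T) (c b : I -> R) (s t : R) :
  continuous gamma -> s < t -> t <= gamma 0 -> gamma 1 <= s ->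
  (forall i, measurable (J i)) ->
  (forall i r, J i r -> gamma r = c i * r + b i) ->
  (forall r, r \in `[0, 1] -> s < gamma r <= t -> exists i, J i r) ->
  ((t - s)%:E <= \sum_i `|c i|%:E * lam (J i))%E.
Proof.
move=> cg st g0 g1 mJ gJ cJ.
(* The image of [J i], written as a preimage under the inverse affine map; for slope 0 the single
   value [b i] takes its place, a null set as required. *)
pose F i : set T := if c i == 0 then [set b i] else
  [set y | J i ((c i)^-1 * y + - ((c i)^-1 * b i))].
have mF i : measurable (F i).
  rewrite /F; case: ifPn => _; first exact: measurable_set1.
  have := @measurable_affine R (c i)^-1 (- ((c i)^-1 * b i)) measurableT _ (mJ i).
  by rewrite setTI.
have lamF i : lam (F i) = (`|c i|%:E * lam (J i))%E.
  rewrite /F; have [->|ci0] := eqVneq (c i) 0.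
    by rewrite lebesgue_measure_set1 normr0 mul0e.
  by rewrite lebesgue_measure_affine ?invr_eq0// normfV invrK.
have -> : (t - s)%:E = lam (`]s, t]%classic : set T).
  by rewrite lebesgue_measure_itv /= lte_fin st EFinB.
under eq_bigr do rewrite -lamF.
apply: measure_le_sum => // y /=; rewrite in_itv/= => /andP[sy yt].
have [r r01 gr] : exists2 r, r \in `[0, 1] & gamma r = y.
  apply: IVT => //; first by apply: continuous_subspaceT.
  by rewrite ge_min le_max (le_trans g1 (ltW sy)) (le_trans yt g0) orbT.
have [|i Jir] := cJ r r01; first by rewrite gr sy yt.
exists i => //; rewrite /F; have [ci0|ci0] := eqVneq (c i) 0.
  by rewrite /= -gr (gJ i r Jir) ci0 mul0r add0r.
rewrite /= -gr (gJ i r Jir) mulrDr addrK mulrA mulVf// mul1r.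
exact: Jir.
Qed.

(** The [J i] are disjoint in [[0, 1]], so their lengths are weights of sum at most 1 and
    [sqr_wsum_le] squares the estimate of [crossing_cover]. *)
Lemma line_crossing (gamma : R -> R) (J : I -> set T) (c b : I -> R) (s t : R) :
  continuous gamma -> s < t -> t <= gamma 0 -> gamma 1 <= s ->
  (forall i, measurable (J i)) -> trivIset setT J ->
  (forall i, J i `<=` `[0, 1]%classic) ->
  (forall i r, J i r -> gamma r = c i * r + b i) ->
  (forall r, r \in `[0, 1] -> s < gamma r <= t -> exists i, J i r) ->
  (((t - s) ^+ 2)%:E <= \sum_i (c i ^+ 2)%:E * lam (J i))%E.
Proof.
move=> cg st g0 g1 mJ tJ J01 gJ cJ.
have lam01 : lam (`[0, 1]%classic : set T) = 1%:E.
  by rewrite lebesgue_measure_itv /= lte_fin ltr01 oppr0 adde0.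
have le1 := crossing_cover cg st g0 g1 mJ gJ cJ.
have leJ i : (lam (J i) <= 1)%E.
  by rewrite -lam01; apply: le_measure; rewrite ?inE//; exact: J01.
have finJ i : lam (J i) = (fine (lam (J i)))%:E.
  rewrite fineK// ge0_fin_numE//; exact: le_lt_trans (leJ i) (ltry _).
have : (\sum_i lam (J i) <= 1)%E.
  rewrite -measure_bigcup_fin// -lam01; apply: le_measure; rewrite ?inE.
  - by apply: fin_bigcup_measurable => //; exact: finite_finset.
  - exact: measurable_itv.
  - by move=> r [i _]; exact: J01.
move: le1.
under eq_bigr do rewrite finJ.
under [X in (X <= 1)%E -> _]eq_bigr do rewrite finJ.
under [X in _ -> _ -> (_ <= X)%E]eq_bigr do rewrite finJ.
rewrite !sumEFin !lee_fin.
set l := fun i => fine (lam (J i)) => le1 lel1.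
have l0 i : 0 <= l i by apply: fine_ge0; exact: measure_ge0.
have a0 : 0 <= \sum_i `|c i| * l i by apply: sumr_ge0 => i _; rewrite mulr_ge0.
apply: (@le_trans _ _ ((\sum_i `|c i| * l i) ^+ 2)).
  by rewrite ler_sqr ?nnegrE ?subr_ge0// ltW.
apply: (le_trans (sqr_wsum_le (fun i => `|c i|) l0 lel1)).
by apply: ler_sum => i _; rewrite real_normK ?num_real.
Qed.

End line_crossing.

Section dotv_theory.
Variables (R : realType) (d : nat).
Implicit Types (x y z : 'cV[R]_d).

Lemma dotvDr x y z : dotv x (y + z) = dotv x y + dotv x z.
Proof. by rewrite /dotv mulmxDr mxE. Qed.

Lemma dotvZr (c : R) x y : dotv x (c *: y) = c * dotv x y.
Proof. by rewrite /dotv -scalemxAr mxE. Qed.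

Lemma dotvC x y : dotv x y = dotv y x.
Proof. by rewrite !dotvE; apply: eq_bigr => i _; rewrite mulrC. Qed.

Lemma dotvDl x y z : dotv (x + y) z = dotv x z + dotv y z.
Proof. by rewrite dotvC dotvDr !(dotvC z). Qed.

Lemma dotvZl (c : R) x y : dotv (c *: x) y = c * dotv x y.
Proof. by rewrite dotvC dotvZr dotvC. Qed.

Lemma dotvv_ge0 x : 0 <= dotv x x.
Proof. by rewrite dotvE sumr_ge0// => i _; rewrite -expr2 sqr_ge0. Qed.

Lemma dotvv_eq0 x : dotv x x = 0 -> x = 0.
Proof.
rewrite dotvE => /eqP; rewrite psumr_eq0; last by move=> i _; rewrite -expr2 sqr_ge0.
move=> /allP h; apply/colP => i; rewrite mxE.
by have := h i (mem_index_enum i); rewrite /= mulf_eq0 orbb => /eqP.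
Qed.

Lemma dotv_cs x y : dotv x y ^+ 2 <= dotv x x * dotv y y.
Proof.
have [y0|yN0] := eqVneq (dotv y y) 0.
  have -> : y = 0 by exact: dotvv_eq0.
  by rewrite /dotv !mulmx0 mxE expr0n/= mulr0.
have y_gt0 : 0 < dotv y y by rewrite lt_neqAle eq_sym yN0 dotvv_ge0.
have := dotvv_ge0 (dotv y y *: x + (- dotv x y) *: y).
rewrite !(dotvDl, dotvDr, dotvZl, dotvZr) (dotvC y x) => h.
rewrite -(ler_pM2l y_gt0) -subr_ge0.
by apply: le_trans h _; rewrite le_eqVlt; apply/orP; left; apply/eqP; ring.
Qed.

End dotv_theory.

Lemma box_cmeasurable (R : realType) d (J : 'I_d -> interval R) :
  cmeasurable [set x : 'cV[R]_d | forall i, x i ord0 \in J i].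
Proof.
rewrite (_ : [set x | _] = \bigcap_(i in setT) [set x : 'cV[R]_d | x i ord0 \in J i]); last first.
  by apply/seteqP; split => x /= h => [i _|i]; apply: h.
apply: cmeasurable_bigcap => i _.
rewrite (_ : [set x | _] =
    [set x : 'cV[R]_d | dotv (delta_mx i ord0) x + 0 \in J i]); last first.
  apply/seteqP; split => x /=; rewrite addr0 dotvE (bigD1 i)//= big1 ?addr0;
    by [move=> j ji; rewrite mxE (negPf ji) mul0r|rewrite mxE !eqxx mul1r].
exact: cmeasurable_affine_itv.
Qed.

Lemma vol_box (R : realType) d (a b : 'I_d -> R) : (forall i, a i <= b i) ->
  vol [set x : 'cV[R]_d | forall i, x i ord0 \in `[a i, b i]] =
  (\prod_i (b i - a i))%:E.
Proof.
move=> ab; pose A i : set (measurableTypeR R) := `[a i, b i]%classic.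
have -> : vol [set x : 'cV[R]_d | forall i, x i ord0 \in `[a i, b i]] =
    lebesgue_tuple R d [set t | forall i, A i (tnth t i)].
  by congr (lebesgue_tuple R d _); apply/seteqP;
    split => t /= h i; have := h i; rewrite /A /= mxE.
rewrite lebesgue_tuple_box => [|i]; last exact: measurable_itv.
rewrite -prodEFin; apply: eq_bigr => i _.
rewrite lebesgue_measure_itv /= lte_fin EFinB; case: ltP => // ba.
by rewrite -EFinB (@le_anti _ _ (a i) (b i)) ?ab ?ba// subrr.
Qed.

Section level_sets.
Variables (R : realType) (d : nat) (I : finType).
Local Notation pt := 'cV[R]_d.
Variables (u : pt -> R) (S : I -> set pt) (g : I -> pt) (b : I -> R).
Hypothesis u_cont : continuous u.
Hypothesis mS : forall i, cmeasurable (S i).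
Hypothesis tS : trivIset setT S.
Hypothesis uS : forall i x, S i x -> u x = dotv (g i) x + b i.
Hypothesis uN0 : forall x, u x != 0 -> exists i, S i x.
Hypothesis Soo : forall i, (vol (S i) < +oo)%E.

Definition level (t : R) : set pt := [set x | t < `|u x|].
(** The condition is put on the affine function of piece [i] instead of [u], with which it agrees on
    [S i]; measurability is then that of slabs. *)
Definition strip i (s t : R) : set pt :=
  S i `&` [set x | s < `|dotv (g i) x + b i| <= t].
Definition strip_energy (s t : R) : R :=
  \sum_i dotv (g i) (g i) * volume (strip i s t).

Lemma cmeasurable_absgt v (c s : R) : cmeasurable [set x : pt | s < `|dotv v x + c|].
Proof.
have [s0|s0] := ltP s 0.
  rewrite (_ : [set x | _] = setT); first exact: cmeasurableT.
  by apply/seteqP; split => x //= _; rewrite (lt_le_trans s0).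
rewrite (_ : [set x | _] = [set x | dotv v x + c \in `]s, +oo[] `|`
    [set x | dotv v x + c \in `]-oo, -s[]).
  by apply: cmeasurableU; exact: cmeasurable_affine_itv.
apply/seteqP; split => x /=; rewrite !in_itv/= andbT lter_normr ltrNr.
  by move=> /orP[]; [left|right].
by move=> [->//|->]; rewrite orbT.
Qed.

Lemma strip_cmeasurable i s t : cmeasurable (strip i s t).
Proof.
apply: cmeasurableI => //.
rewrite (_ : [set x | _] = [set x | s < `|dotv (g i) x + b i|] `\`
    [set x | t < `|dotv (g i) x + b i|]).
  by apply: cmeasurableD; exact: cmeasurable_absgt.
apply/seteqP; split => x /=.
  by move=> /andP[-> ?]; split => //; apply/negP; rewrite -leNgt.
by move=> [-> /negP]; rewrite -leNgt.
Qed.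

Lemma level_cmeasurable t : 0 <= t -> cmeasurable (level t).
Proof.
move=> t0; rewrite (_ : level t = \bigcup_(i in setT)
    (S i `&` [set x | t < `|dotv (g i) x + b i|])).
  apply: cmeasurable_bigcup => i _; apply: cmeasurableI => //.
  exact: cmeasurable_absgt.
apply/seteqP; split => x; rewrite /level /=.
  move=> tx; have [|i Six] := uN0 (x := x).
    by rewrite -normr_gt0 (le_lt_trans t0).
  by exists i => //; split => //=; rewrite -uS.
by move=> [i _ [Six /=]]; rewrite -uS.
Qed.

Lemma level_fin t : 0 <= t -> (vol (level t) < +oo)%E.
Proof.
move=> t0; apply: (@le_lt_trans _ _ (\sum_i vol (S i))%E); last first.
  apply: lte_sum_pinfty => i _; exact: Soo.
apply: measure_le_sum => [|i|]; [exact: level_cmeasurable|exact: mS|].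
move=> s; rewrite /level /= => ts.
by have [|i Si] := uN0 (x := col_of_tuple s);
  [rewrite -normr_gt0 (le_lt_trans t0)|exists i].
Qed.

(** Multiplication by the sign of [u x] turns the descent of [|u|] into that of a signed function
    [gamma], to which the intermediate value theorem applies. Since [0 <= s], the function [gamma]
    equals [|u|] wherever its value lies in the strip. *)
Lemma crossing_segment (x h : pt) (s t : R) : 0 <= s -> s < t ->
  t < `|u x| -> `|u (x + h)| <= s ->
  (((t - s) ^+ 2)%:E <= \sum_i ((dotv (g i) h) ^+ 2)%:E *
     lebesgue_measure [set r : measurableTypeR R |
        r \in `[0%R, 1%R] /\ strip i s t (x + r *: h)%R])%E.
Proof.
move=> s0 st tx hs.
pose sg : R := Num.sg (u x).
have ux0 : u x != 0 by rewrite -normr_gt0 (le_lt_trans s0)// (lt_trans st).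
have sg1 : `|sg| = 1 by rewrite normr_sg ux0.
pose gamma (r : R) := sg * u (x + r *: h).
have c_seg : continuous (fun r : R => x + r *: h).
  move=> r; apply: cvgD; first exact: cvg_cst.
  by apply: cvgZl; exact: cvg_id.
have c_gamma : continuous gamma.
  move=> r; apply: cvgM; first exact: cvg_cst.
  by apply: (@continuous_comp _ _ _ (fun r : R => x + r *: h) u r);
    [exact: c_seg|exact: u_cont].
have segE i : [set r : measurableTypeR R |
        r \in `[0%R, 1%R] /\ strip i s t (x + r *: h)%R] =
    [set r : measurableTypeR R | r \in `[0%R, 1%R] /\
       strip i s t (@col_of_tuple R d (tuple_of_col x) + r *: h)%R].
  by rewrite tuple_of_colK.
under eq_bigr => i _.
  rewrite (_ : dotv (g i) h ^+ 2 = (sg * dotv (g i) h) ^+ 2); last first.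
    by rewrite exprMn -(real_normK (num_real sg)) sg1 expr1n mul1r.
  over.
apply: (line_crossing c_gamma (b := fun i => sg * (dotv (g i) x + b i))) => //.
- by rewrite /gamma scale0r addr0 -normrEsg ltW.
- rewrite /gamma scale1r; apply: le_trans hs.
  by apply: le_trans (ler_norm _) _; rewrite normrM sg1 mul1r.
- move=> i; rewrite segE.
  by have [+ _ _] := line_tonelli h (strip_cmeasurable i s t); exact.
- move=> i j _ _ [r [/= [_ [Si _]] [_ [Sj _]]]].
  by apply: tS => //; exists (x + r *: h).
- by move=> i r [].
- move=> i r [/= _ [/uS ur _]].
  by rewrite /gamma ur dotvDr dotvZr; ring.
move=> r r01 /andP[sr rt].
have ur : `|u (x + r *: h)| = gamma r.
  by rewrite -[LHS]mul1r -sg1 -normrM -/(gamma r) gtr0_norm// (le_lt_trans s0).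
have [|i Si] := uN0 (x := x + r *: h).
  by rewrite -normr_gt0 ur (le_lt_trans s0).
by exists i; split => //; split => //=; rewrite -uS// ur sr rt.
Qed.

Lemma level_decay (s t : R) : (0 < d)%N -> 0 <= s -> s < t ->
  volume (level t) * (t - s) ^+ 2 <=
  2 * d%:R * (4 * volume (level s)) `^ (2 / d%:R) * strip_energy s t.
Proof.
move=> d0 s0 st; have t0 : 0 <= t by rewrite (le_trans s0)// ltW.
have ms := level_cmeasurable s0; have mt := level_cmeasurable t0.
have sfin : vol (level s) \is a fin_num.
  by rewrite ge0_fin_numE ?vol_ge0 ?level_fin.
have tfin : vol (level t) \is a fin_num.
  by rewrite ge0_fin_numE ?vol_ge0 ?level_fin.
have ts : volume (level t) <= volume (level s).
  rewrite !volumeE fine_le//; apply: le_vol => // x; rewrite /level /=.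
  by apply: lt_trans.
have t_ge0 : 0 <= volume (level t) by rewrite volumeE fine_ge0// vol_ge0.
have stripfin i : vol (strip i s t) \is a fin_num.
  rewrite ge0_fin_numE ?vol_ge0//; apply: le_lt_trans (Soo i).
  by apply: le_vol => //; [exact: strip_cmeasurable|move=> x []].
have E0 : 0 <= strip_energy s t.
  apply: sumr_ge0 => i _; rewrite mulr_ge0 ?dotvv_ge0//.
  by rewrite volumeE fine_ge0// vol_ge0.
have [v0|v_gt0] := leP (volume (level s)) 0.
  have -> : volume (level t) = 0.
    by apply/le_anti; rewrite t_ge0 (le_trans ts v0).
  by rewrite mul0r !mulr_ge0// powR_ge0.
(* The edge of the cube of shifts: [l ^+ d = 4 * volume (level s)] is what [exists_shift] asks for,
   and every shift [h] in the cube has square norm at most [d * l ^+ 2]. *)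
pose l := (4 * volume (level s)) `^ (d%:R^-1).
have l0 : 0 < l by rewrite powR_gt0// mulr_gt0.
have ld : l ^+ d = 4 * volume (level s).
  rewrite -powR_mulrn ?ltW// /l -powRrM mulVf ?pnatr_eq0 -?lt0n//.
  by rewrite powRr1// mulr_ge0 ?ltW.
have l2 : l ^+ 2 = (4 * volume (level s)) `^ (2 / d%:R).
  by rewrite -powR_mulrn ?ltW// /l -powRrM (mulrC 2).
pose Q : set pt := [set x | forall i, x i ord0 \in `[0, l]].
have volQ : vol Q = (l ^+ d)%:E.
  rewrite /Q (vol_box (a := fun=> 0) (b := fun=> l)) => [|i]; last exact: ltW.
  by rewrite subr0 prodr_const card_ord.
have [h Qh leh] : exists2 h, Q h &
   (2%:E * vol (level t `&` [set x | level s (x + h)%R]) <= vol (level t))%E.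
  apply: exists_shift => //.
  - exact: box_cmeasurable.
  - exact: level_fin.
  - by rewrite volQ ltry.
  - by rewrite volQ lte_fin exprn_gt0.
  - by rewrite volQ ld EFinM volumeE fineK.
pose A := level t `\` [set x | level s (x + h)].
have msh : cmeasurable [set x | level s (x + h)].
  have := cmeasurable_affine 1 h ms.
  by congr cmeasurable; apply/seteqP; split => x /=; rewrite scale1r.
have mA : cmeasurable A by apply: cmeasurableD.
have Afin : vol A \is a fin_num.
  rewrite ge0_fin_numE ?vol_ge0//; apply: le_lt_trans (level_fin t0).
  by apply: le_vol => // x [].
have volA : volume (level t) <= 2 * volume A.
  have mI : cmeasurable (level t `&` [set x | level s (x + h)]).
    exact: cmeasurableI.
  have Ifin : vol (level t `&` [set x | level s (x + h)]) \is a fin_num.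
    rewrite ge0_fin_numE ?vol_ge0//; apply: le_lt_trans (level_fin t0).
    by apply: le_vol => // x [].
  have : vol (level t) = (vol A + vol (level t `&` [set x | level s (x + h)%R]))%E.
    have := measureDI (lebesgue_tuple R d) mt msh; exact.
  move: leh; rewrite -(fineK tfin) -(fineK Ifin) -(fineK Afin) -EFinM -EFinD lee_fin.
  move=> leh [E]; rewrite !volumeE E; move: leh; rewrite E; lra.
(* Integrate [crossing_segment] over the starting points in [A]. After enlarging the domain of
   integration to the whole space, [line_tonelli] turns the time spent in a strip into the volume of
   the strip. *)
have : (((t - s) ^+ 2)%:E * vol A <=
    \sum_i ((dotv (g i) h) ^+ 2)%:E * vol (strip i s t))%E.
  have mA' : measurable (@col_of_tuple R d @^-1` A) by [].
  rewrite /vol -(integral_cst (lebesgue_tuple R d) mA').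
  have tonelli i := line_tonelli h (strip_cmeasurable i s t).
  pose seg i (x : d.-tuple (measurableTypeR R)) :=
    [set r : measurableTypeR R |
        r \in `[0%R, 1%R] /\ strip i s t (col_of_tuple x + r *: h)%R].
  have mseg i : measurable_fun setT
      (fun x => ((dotv (g i) h ^+ 2)%:E * lebesgue_measure (seg i x))%E).
    by apply: emeasurable_funM => //; have [_ + _] := tonelli i.
  pose F (x : d.-tuple (measurableTypeR R)) :=
    (\sum_i (dotv (g i) h ^+ 2)%:E * lebesgue_measure (seg i x))%E.
  have F0 x : (0 <= F x)%E.
    by apply: sume_ge0 => i _; rewrite mule_ge0// lee_fin sqr_ge0.
  have mF : measurable_fun setT F by apply: emeasurable_sum => i; exact: mseg.
  have le1 : (\int[lebesgue_tuple R d]_(x in @col_of_tuple R d @^-1` A)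
      cst ((t - s) ^+ 2)%:E x <=
      \int[lebesgue_tuple R d]_(x in @col_of_tuple R d @^-1` A) F x)%E.
    apply: ge0_le_integral => //.
    - by move=> x _; rewrite lee_fin sqr_ge0.
    - exact: measurable_funTS.
    move=> x [/= tx /negP sx]; apply: crossing_segment => //.
    by rewrite leNgt.
  apply: (le_trans le1).
  have le2 : (\int[lebesgue_tuple R d]_(x in @col_of_tuple R d @^-1` A) F x <=
      \int[lebesgue_tuple R d]_x F x)%E by exact: ge0_subset_integral.
  apply: (le_trans le2); rewrite /F.
  rewrite ge0_integral_sum//; last first.
    by move=> i x _; rewrite mule_ge0// lee_fin sqr_ge0.
  apply: lee_sum => i _; rewrite ge0_integralZl//; last 2 first.
    by have [_ + _] := tonelli i.
    by rewrite lee_fin sqr_ge0.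
  by have [_ _ ->] := tonelli i.
rewrite -(fineK Afin).
under eq_bigr => i _ do rewrite -(fineK (stripfin i)).
rewrite -EFinM -!volumeE.
under eq_bigr => i _ do rewrite -EFinM.
rewrite sumEFin lee_fin => leE.
have h2 : dotv h h <= d%:R * l ^+ 2.
  rewrite dotvE -[X in X%:R](card_ord d) -sum1_card natr_sum mulr_suml.
  apply: ler_sum => i _; rewrite mul1r -expr2.
  have := Qh i; rewrite in_itv/= => /andP[h0 hl].
  by rewrite ler_sqr ?nnegrE// ltW.
have {}leE : (t - s) ^+ 2 * volume A <= d%:R * l ^+ 2 * strip_energy s t.
  apply: (le_trans leE); rewrite /strip_energy mulr_sumr; apply: ler_sum => i _.
  rewrite mulrA; apply: ler_wpM2r; first by rewrite fine_ge0// vol_ge0.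
  apply: le_trans (dotv_cs _ _) _; rewrite mulrC.
  by apply: ler_wpM2r => //; exact: dotvv_ge0.
rewrite -l2.
apply: (@le_trans _ _ (2 * ((t - s) ^+ 2 * volume A))).
  have := sqr_ge0 (t - s); nra.
by rewrite -!(mulrA 2) ler_pM2l.

Qed.

(** Strips are half-open in the value, so those between successive levels are disjoint inside each
    [S i]. *)
Lemma sum_strip_energy (t : nat -> R) (n : nat) :
  (forall k, t k < t k.+1) ->
  \sum_(k < n) strip_energy (t k) (t k.+1) <=
  \sum_i dotv (g i) (g i) * volume (S i).
Proof.
move=> ti; rewrite /strip_energy exchange_big /=; apply: ler_sum => i _.
rewrite -mulr_sumr ler_wpM2l ?dotvv_ge0//.
have mono : {homo t : j k / (j <= k)%N >-> j <= k}.
  by apply: homo_leq => // [|k]; [exact: le_trans|exact: ltW].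
pose F (k : 'I_n) := @col_of_tuple R d @^-1` strip i (t k) (t k.+1).
have disj (j k : 'I_n) x : (j < k)%N -> strip i (t j) (t j.+1) x ->
    strip i (t k) (t k.+1) x -> False.
  move=> jk [_ /= /andP[_ h1]] [_ /= /andP[h2 _]].
  have := mono _ _ jk; lra.
have tF : trivIset setT F.
  move=> j k _ _ [x [/= xj xk]]; apply: val_inj.
  by case: (ltngtP j k) => // [jk|kj];
    [have := disj _ _ _ jk xj xk|have := disj _ _ _ kj xk xj].
have mF k : measurable (F k) by exact: strip_cmeasurable.
have le_sum : (\sum_(k < n) vol (strip i (t k) (t k.+1)) <= vol (S i))%E.
  rewrite -(measure_bigcup_fin _ mF tF); apply: le_measure; rewrite ?inE//.
  - by apply: fin_bigcup_measurable => //; exact: finite_finset.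
  - exact: mS.
  - by move=> x [k _ []].
have fin k : vol (strip i (t k) (t k.+1)) \is a fin_num.
  rewrite ge0_fin_numE ?vol_ge0//; apply: le_lt_trans (Soo i).
  by apply: le_vol => //; [exact: strip_cmeasurable|move=> x []].
have Sfin : vol (S i) \is a fin_num by rewrite ge0_fin_numE ?vol_ge0.
move: le_sum; rewrite -(fineK Sfin).
under eq_bigr do rewrite -(fineK (fin _)).
by rewrite sumEFin lee_fin.
Qed.

End level_sets.

(** * Iteration of the level set inequality *)

(** A single term dominates, that of the largest [k] with [2 * 2 ^+ k < x], for which
    [x <= 4 * 2 ^+ k]. The factor 2 in the indicator anticipates that element maxima are controlled
    by level sets of half the height. *)
Lemma dyadic_powR_le (R : realType) (p x : R) (N : nat) : 0 <= p -> 0 <= x ->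
  x <= 2 ^+ N.+1 ->
  x `^ p <= 2 `^ p + 4 `^ p * \sum_(k < N) ((2 * 2 ^+ k < x)%R%:R * (2 ^+ k) `^ p).
Proof.
move=> p0 x0; elim: N => [|N IHN] xN.
  rewrite big_ord0 mulr0 addr0; apply: ge0_ler_powR; rewrite ?nnegrE//.
have [xle|xgt] := leP x (2 ^+ N.+1).
  apply: (le_trans (IHN xle)); rewrite lerD2l ler_wpM2l ?powR_ge0//.
  by rewrite big_ord_recr /= lerDl mulr_ge0 ?powR_ge0// ler0n.
rewrite big_ord_recr /= -exprS xgt mul1r mulrDr.
apply: (@le_trans _ _ (4 `^ p * (2 ^+ N) `^ p)).
  rewrite -powRM ?exprn_ge0//; apply: ge0_ler_powR; rewrite ?nnegrE ?mulr_ge0 ?exprn_ge0//.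
  by apply: (le_trans xN); rewrite !exprS; lra.
rewrite addrA lerDr addr_ge0 ?powR_ge0// mulr_ge0 ?powR_ge0//.
by apply: sumr_ge0 => i _; rewrite mulr_ge0 ?powR_ge0// ler0n.
Qed.

(** The last integer [k] below [y] satisfies [y <= k + 1], so its term alone suffices; the summand 1
    covers [y = 0]. *)
Lemma exp2_step_le (R : realType) (y : R) (N : nat) : 0 <= y -> y <= N%:R ->
  2 `^ y <= 1 + \sum_(k < N) ((k%:R < y)%R%:R * 2 ^+ k.+1).
Proof.
move=> y0; elim: N => [|N IHN] yN.
  have -> : y = 0 by apply/le_anti; rewrite y0 yN.
  by rewrite powRr0 big_ord0 addr0.
have [yle|ygt] := leP y N%:R.
  apply: (le_trans (IHN yle)); rewrite lerD2l big_ord_recr /= lerDl.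
  by rewrite mulr_ge0 ?ler0n// exprn_ge0.
rewrite big_ord_recr /= ygt mul1r.
apply: (@le_trans _ _ (2 ^+ N.+1)).
  rewrite -powR_mulrn//; apply: ler_powR => //; lra.
rewrite addrA lerDr addr_ge0//.
by apply: sumr_ge0 => i _; rewrite mulr_ge0 ?ler0n// exprn_ge0.
Qed.

Section iteration.
Variables (R : realType) (m : R -> R) (e : R -> R -> R) (V E : R).
Hypothesis m_ge0 : forall t, 0 <= t -> 0 <= m t.
Hypothesis mV : forall t, 0 <= t -> m t <= V.
Hypothesis e_ge0 : forall s t, 0 <= e s t.
Hypothesis eE : forall (t : nat -> R) n, 0 <= t 0%N ->
  (forall k, t k < t k.+1) -> \sum_(k < n) e (t k) (t k.+1) <= E.
Hypothesis E_gt0 : 0 < E.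
Variables (I : finType) (v f : I -> R) (C : R).
Hypothesis C_ge0 : 0 <= C.
Hypothesis v_ge0 : forall i, 0 <= v i.
Hypothesis f_ge0 : forall i, 0 <= f i.
Hypothesis vV : \sum_i v i <= V.
Hypothesis vf : forall t, 0 <= t -> \sum_(i | 2 * t < f i) v i <= C * m t.

Let E_ge0 : 0 <= E. Proof. exact: ltW. Qed.
Let V_ge0 : 0 <= V. Proof. exact: le_trans (m_ge0 (lexx 0)) (mV (lexx 0)). Qed.

Section subcritical.
Variables (c th p : R).
Hypothesis c_ge0 : 0 <= c.
Hypothesis th_ge0 : 0 <= th.
Hypothesis th_lt1 : th < 1.
Hypothesis pth : p = 2 / (1 - th).
Hypothesis decay : forall s t, 0 <= s -> s < t ->
  m t * (t - s) ^+ 2 <= c * m s `^ th * e s t.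

Let tau := Num.sqrt E.
Let t_ k : R := tau * 2 ^+ k.
(** The terms of the dyadic sum for the [p]-th moment of [|u| / sqrt E]. In the recursion [a_step]
    the powers of 2 cancel precisely for [p = 2 / (1 - th)]; with [th = 2 / d] this is the Sobolev
    exponent [2 d / (d - 2)]. *)
Let a_ k := (2 ^+ k) `^ p * m (t_ k).
Let c' := 2 `^ p * c.
(** At least the starting value [V] and at least the fixed point of the map sending [x] to [c']
    times the [th]-th power of [x]; the recursion therefore preserves the bound [M]. *)
Let M := Num.max V (c' `^ (1 - th)^-1).

Let tau_gt0 : 0 < tau. Proof. by rewrite sqrtr_gt0. Qed.
Let tau_ge0 : 0 <= tau. Proof. exact: ltW. Qed.
Let t_ge0 k : 0 <= t_ k. Proof. by rewrite mulr_ge0 ?exprn_ge0. Qed.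
Let p_ge0 : 0 <= p. Proof. by rewrite pth divr_ge0// subr_ge0 ltW. Qed.
Let t_incr k : t_ k < t_ k.+1.
Proof. by rewrite /t_ ltr_pM2l// exprS ltr_pMl ?exprn_gt0// ltr1n. Qed.
Let a_ge0 k : 0 <= a_ k. Proof. by rewrite mulr_ge0 ?powR_ge0 ?m_ge0. Qed.
Let c'_ge0 : 0 <= c'. Proof. by rewrite mulr_ge0 ?powR_ge0. Qed.
Let M_ge0 : 0 <= M. Proof. by rewrite le_max V_ge0. Qed.

Let a_step k : a_ k.+1 <= c' * a_ k `^ th * (e (t_ k) (t_ k.+1) / E).
Proof.
have := decay (t_ge0 k) (t_incr k).
rewrite (_ : t_ k.+1 - t_ k = t_ k); last by rewrite /t_ exprS; ring.
rewrite exprMn sqr_sqrtr// => h.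
have q0 : 0 < (2 ^+ k : R) by rewrite exprn_gt0.
have qge0 := ltW q0.
have ak : a_ k `^ th = (2 ^+ k) `^ p / (2 ^+ k) ^+ 2 * m (t_ k) `^ th.
  rewrite /a_ powRM ?powR_ge0 ?m_ge0// -powRrM; congr (_ * _).
  rewrite -[(2 ^+ k) ^+ 2]powR_mulrn// -powRB; last by rewrite (gt_eqF q0) implybT.
  by congr powR; rewrite pth; field; rewrite subr_eq0 gt_eqF.
rewrite ak /a_ exprS powRM// /c'.
have -> : 2 `^ p * c * ((2 ^+ k) `^ p / (2 ^+ k) ^+ 2 * m (t_ k) `^ th) *
    (e (t_ k) (t_ k.+1) / E) =
    2 `^ p * (2 ^+ k) `^ p *
    ((c * m (t_ k) `^ th * e (t_ k) (t_ k.+1)) / (E * (2 ^+ k) ^+ 2)).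
  by field; rewrite !gt_eqF.
rewrite ler_pM2l ?mulr_gt0 ?powR_gt0//.
by rewrite ler_pdivlMr// mulr_gt0// exprn_gt0.
Qed.

Let cM : c' * M `^ th <= M.
Proof.
have [M0|M_neq0] := eqVneq M 0.
  have : c' `^ (1 - th)^-1 <= 0 by rewrite -M0 le_max lexx orbT.
  rewrite le_eqVlt ltNge powR_ge0 orbF powR_eq0 => /andP[/eqP -> _].
  by rewrite mul0r.
have M_gt0 : 0 < M by rewrite lt_neqAle eq_sym M_neq0.
have c'M : c' <= M `^ (1 - th).
  have th0 : 0 < 1 - th by rewrite subr_gt0.
  have -> : c' = (c' `^ (1 - th)^-1) `^ (1 - th).
    by rewrite -powRrM mulVf ?powRr1// lt0r_neq0.
  apply: ge0_ler_powR; rewrite ?nnegrE ?powR_ge0//; first exact: ltW.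
  by rewrite /M le_max lexx orbT.
apply: le_trans (ler_wpM2r (powR_ge0 _ _) c'M) _.
by rewrite -powRD ?subrK ?powRr1// ?oner_eq0//; rewrite ltW.
Qed.

Let aM k : a_ k <= M.
Proof.
elim: k => [|k IHk].
  by rewrite /a_ expr0 powR1 mul1r le_max mV.
apply: le_trans (a_step k) _; apply: le_trans _ cM.
have eE1 : e (t_ k) (t_ k.+1) / E <= 1.
  rewrite ler_pdivrMr// mul1r; have := @eE (fun j => t_ (k + j)%N) 1%N.
  rewrite big_ord1 addn0 addn1; apply => // j; rewrite addnS; exact: t_incr.
rewrite -[leRHS]mulr1; apply: ler_pM => //.
- by rewrite mulr_ge0 ?powR_ge0.
- by rewrite divr_ge0.
by apply: ler_wpM2l => //; apply: ge0_ler_powR; rewrite ?nnegrE.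
Qed.

(** Boundedness of [a_] alone would not make the sum converge. Inserted once more into the recursion
    it leaves the factor [e (t_ k) (t_ k.+1) / E], and these factors sum to at most 1. *)
Let suma n : \sum_(k < n) a_ k <= V + M.
Proof.
case: n => [|n]; first by rewrite big_ord0 addr_ge0.
rewrite big_ord_recl /= lerD//; first by rewrite /a_ expr0 powR1 mul1r mV.
apply: (@le_trans _ _ (\sum_(k < n) M * (e (t_ k) (t_ k.+1) / E))).
  apply: ler_sum => k _; apply: le_trans (a_step k) _.
  apply: ler_wpM2r; first by rewrite divr_ge0.
  apply: le_trans _ cM; apply: ler_wpM2l => //.
  by apply: ge0_ler_powR; rewrite ?nnegrE.
rewrite -mulr_sumr -mulr_suml -[leRHS]mulr1 ler_wpM2l// ler_pdivrMr// mul1r.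
exact: eE.
Qed.

(** Dyadic layer-cake formula: by [vf] the layer above [2 * t_ k] contributes at most [C * a_ k],
    and [suma] adds the layers up. *)
Lemma subcritical_moment :
  \sum_i v i * (f i ^+ 2 / E) `^ (1 - th)^-1 <=
  2 `^ p * V + 4 `^ p * (C * (V + Num.max V ((2 `^ p * c) `^ (1 - th)^-1))).
Proof.
have [N fN] : exists N, forall i, f i / tau <= 2 ^+ N.+1.
  exists (Num.trunc (\sum_i f i / tau)) => i.
  apply: (@le_trans _ _ (\sum_i f i / tau)).
    by rewrite (bigD1 i)//= lerDl sumr_ge0// => j _; rewrite divr_ge0.
  apply: (@le_trans _ _ (Num.trunc (\sum_i f i / tau)).+1%:R).
    exact/ltW/truncnS_gt.
  by rewrite -natrX ler_nat ltnW// ltn_expl.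
have -> : \sum_i v i * (f i ^+ 2 / E) `^ (1 - th)^-1 =
    \sum_i v i * (f i / tau) `^ p.
  apply: eq_bigr => i _; congr (_ * _).
  rewrite pth powRrM; congr powR.
  by rewrite powR_mulrn ?divr_ge0// expr_div_n sqr_sqrtr.
have le_i i : v i * (f i / tau) `^ p <= 2 `^ p * v i + 4 `^ p *
    \sum_(k < N) (2 ^+ k) `^ p * (v i *+ (2 * t_ k < f i)%R).
  have := dyadic_powR_le p_ge0 (divr_ge0 (f_ge0 i) tau_ge0) (fN i).
  move=> /(ler_wpM2l (v_ge0 i)) /le_trans; apply.
  rewrite mulrDr mulrC lerD2l mulrCA; apply: ler_wpM2l; first exact: powR_ge0.
  rewrite mulr_sumr; apply: ler_sum => k _.
  rewrite ltr_pdivlMr// (_ : _ * tau = 2 * t_ k); last by rewrite /t_; ring.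
  by case: (_ < _); rewrite ?mulr1n ?mulr0n; lra.
apply: le_trans (ler_sum _ (fun i _ => le_i i)) _.
rewrite big_split /= -!mulr_sumr lerD// ?ler_wpM2l ?powR_ge0//.
rewrite exchange_big /=.
apply: (@le_trans _ _ (C * \sum_(k < N) a_ k)); last first.
  by rewrite ler_wpM2l//; exact: suma.
rewrite mulr_sumr; apply: ler_sum => k _.
rewrite /a_ -mulr_sumr [leRHS]mulrCA ler_wpM2l ?powR_ge0//.
apply: le_trans (vf (t_ge0 k)); rewrite [leRHS]big_mkcond /=.
by apply: ler_sum => i _; case: (_ < _).
Qed.

End subcritical.

Section critical.
Variable c : R.
Hypothesis c_gt0 : 0 < c.
Hypothesis decay : forall s t, 0 <= s -> s < t ->
  m t * (t - s) ^+ 2 <= c * m s * e s t.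

(* [n] equidistant steps from [0] to [T]; AM-GM bounds the product of the
   strip energies by the [n]-th power of their mean. *)
Lemma critical_decay (T : R) (n : nat) : 0 <= T -> 4 * c * E * n%:R <= T ^+ 2 ->
  m T <= V * (4 ^+ n)^-1.
Proof.
case: n => [|n] T0 nT; first by rewrite expr0 invr1 mulr1 mV.
have n0 : 0 < (n.+1%:R : R) by rewrite ltr0n.
have T_gt0 : 0 < T.
  rewrite lt_neqAle T0 andbT; apply: contraTneq nT => <-.
  by rewrite expr0n /= -ltNge !mulr_gt0.
pose eta := T / n.+1%:R; have eta0 : 0 < eta by rewrite divr_gt0.
pose t_ k : R := k%:R * eta.
have t0 k : 0 <= t_ k by rewrite mulr_ge0// ltW.
have ti k : t_ k < t_ k.+1 by rewrite /t_ ltr_pM2r// ltr_nat.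
pose x k := c * e (t_ k) (t_ k.+1) / eta ^+ 2.
have x0 k : 0 <= x k by rewrite divr_ge0 ?sqr_ge0// mulr_ge0// ltW.
have mx k : m (t_ k) <= V * \prod_(j < k) x j.
  elim: k => [|k IHk]; first by rewrite big_ord0 mulr1 mV.
  rewrite big_ord_recr /= mulrA.
  apply: (@le_trans _ _ (m (t_ k) * x k)); last exact: ler_wpM2r.
  have := decay (t0 k) (ti k).
  rewrite (_ : t_ k.+1 - t_ k = eta); last by rewrite /t_ -natr1; ring.
  rewrite -ler_pdivlMr ?exprn_gt0//; congr (_ <= _); rewrite /x; ring.
have -> : T = t_ n.+1 by rewrite /t_ mulrC divfK// gt_eqF.
apply: (le_trans (mx n.+1)); apply: ler_wpM2l => //.
have [+ _] := @leif_AGM _ _ (@predT 'I_n.+1) x (fun i _ => x0 i).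
rewrite card_ord; move=> /le_trans; apply; rewrite -exprVn.
apply: lerXn2r; rewrite ?nnegrE ?invr_ge0//.
  by rewrite divr_ge0 ?sumr_ge0// ltW.
(* With [n.+1] steps of length [T / n.+1] the mean of the [x j] is at most [c * E * n.+1 / T ^+ 2],
   hence at most 1/4 by hypothesis. *)
rewrite /x -mulr_suml -mulr_sumr.
have eEn := eE n.+1 (t0 0%N) ti.
rewrite ler_pdivrMr// ler_pdivrMr ?exprn_gt0//.
apply: (@le_trans _ _ (c * E)); first by rewrite ler_wpM2l// ltW.
rewrite /eta expr_div_n.
have -> : 4^-1 * n.+1%:R * (T ^+ 2 / n.+1%:R ^+ 2) = 4^-1 * (T ^+ 2 / n.+1%:R).
  by field; rewrite gt_eqF.
rewrite ler_pdivlMl// ler_pdivlMr//; apply: le_trans nT.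
by rewrite le_eqVlt; apply/orP; left; apply/eqP; ring.
Qed.

(** Where the exponent exceeds [k], [f i] exceeds twice the level [T_ k], at which [critical_decay]
    gives [m <= V / 4 ^+ k]; this explains [16 = 4 * 2 ^ 2]. The weight [2 ^+ k.+1] of the layer
    leaves a geometric series of ratio 1/2. *)
Lemma critical_moment :
  \sum_i v i * 2 `^ (f i ^+ 2 / (16 * c * E)) <= V * (1 + 4 * C).
Proof.
have cE0 : 0 < 16 * c * E by rewrite !mulr_gt0.
have y0 i : 0 <= f i ^+ 2 / (16 * c * E) by rewrite divr_ge0 ?sqr_ge0// ltW.
have [N fN] : exists N : nat, forall i, f i ^+ 2 / (16 * c * E) <= N%:R.
  exists (Num.trunc (\sum_i f i ^+ 2 / (16 * c * E))).+1 => i.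
  apply: (@le_trans _ _ (\sum_i f i ^+ 2 / (16 * c * E))).
    by rewrite (bigD1 i)//= lerDl sumr_ge0.
  exact/ltW/truncnS_gt.
pose T_ (k : nat) : R := Num.sqrt (4 * c * E * k%:R).
have T2 k : T_ k ^+ 2 = 4 * c * E * k%:R.
  by rewrite sqr_sqrtr// !mulr_ge0// ltW.
have T0 k : 0 <= T_ k by exact: sqrtr_ge0.
have le_i i : v i * 2 `^ (f i ^+ 2 / (16 * c * E)) <=
    v i + \sum_(k < N) 2 ^+ k.+1 * (v i *+ (2 * T_ k < f i)%R).
  have /(ler_wpM2l (v_ge0 i)) /le_trans := exp2_step_le (y0 i) (fN i); apply.
  rewrite mulrDr mulr1 lerD2l mulr_sumr; apply: ler_sum => k _.
  rewrite ltr_pdivlMr//.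
  have -> : (k%:R * (16 * c * E) < f i ^+ 2) = (2 * T_ k < f i).
    rewrite -[RHS]ltr_sqr ?nnegrE ?mulr_ge0// exprMn T2.
    by congr (_ < _); ring.
  by case: (_ < _); rewrite ?mulr1n ?mulr0n; lra.
apply: le_trans (ler_sum _ (fun i _ => le_i i)) _.
rewrite big_split /= mulrDr mulr1 lerD// exchange_big /=.
apply: (@le_trans _ _ (\sum_(k < N) C * V * 2 * 2^-1 ^+ k)).
  apply: ler_sum => k _; rewrite -mulr_sumr.
  apply: (@le_trans _ _ (2 ^+ k.+1 * (C * (V * (4 ^+ k)^-1)))).
    rewrite ler_wpM2l ?exprn_ge0//.
    apply: (@le_trans _ _ (C * m (T_ k))).
      apply: le_trans (vf (T0 k)); rewrite [leRHS]big_mkcond /=.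
      by apply: ler_sum => i _; case: (_ < _).
    by rewrite ler_wpM2l//; apply: critical_decay => //; rewrite T2.
  rewrite le_eqVlt; apply/orP; left; apply/eqP.
  rewrite (_ : (4 : R) = 2 * 2) ?exprMn; last by ring.
  by rewrite exprS exprVn; field; rewrite expf_neq0.
rewrite -mulr_sumr.
have geo : \sum_(k < N) (2^-1 : R) ^+ k <= 2.
  have := subrX1 (2^-1 : R) N; have : 0 <= (2^-1 : R) ^+ N by rewrite exprn_ge0.
  lra.
apply: (@le_trans _ _ (C * V * 2 * 2)); first by rewrite ler_wpM2l// !mulr_ge0.
by rewrite le_eqVlt; apply/orP; left; apply/eqP; ring.
Qed.

(** Young's inequality in exponential form, from [1 + z <= expR z] with [z = y * ln 2 - L]. The
    choice of [L] makes [expR (- L) = S / (B * V)], so after [w i <= B] the exponential terms sum to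
    a multiple of [S] by [critical_moment]. *)
Lemma critical_weighted (w : I -> R) (B : R) : (forall i, 0 <= w i <= B) ->
  0 < \sum_i w i * v i ->
  \sum_i w i * v i * f i ^+ 2 <= 16 * c * E / ln 2 * (\sum_i w i * v i) *
    (ln (B * V / \sum_i w i * v i) + (1 + 4 * C)).
Proof.
move=> wB S0; set S := \sum_i w i * v i in S0 *.
have SBV : S <= B * V.
  apply: (@le_trans _ _ (\sum_i B * v i)).
    by apply: ler_sum => i _; rewrite ler_wpM2r//; case/andP: (wB i).
  rewrite -mulr_sumr ler_wpM2l//; have [i _ | noi] := pickP (@predT I).
    by case/andP: (wB i) => /le_trans + h; apply.
  by move: S0; rewrite /S big_pred0 ?ltxx// => i; have := noi i.
have BV0 : 0 < B * V by exact: lt_le_trans SBV.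
have ln20 : 0 < ln (2 : R) by rewrite ln_gt0// ltr1n.
have cE0 : 0 < 16 * c * E by rewrite !mulr_gt0.
have k0 : 0 <= 16 * c * E / ln 2 by rewrite divr_ge0// ltW.
have q0 : 0 <= S / (B * V) by rewrite divr_ge0// ltW.
set L := ln (B * V / S).
have expL : expR (- L) = S / (B * V).
  by rewrite expRN /L lnK ?posrE ?divr_gt0// invf_div.
have le_i i : w i * v i * f i ^+ 2 <= 16 * c * E / ln 2 *
   (w i * v i * L + S / (B * V) * (B * (v i * 2 `^ (f i ^+ 2 / (16 * c * E))))).
  have := expR_ge1Dx (f i ^+ 2 / (16 * c * E) * ln 2 - L).
  rewrite expRD expL (_ : expR _ = 2 `^ (f i ^+ 2 / (16 * c * E))); last first.
    by rewrite /powR (negPf (lt0r_neq0 _)).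
  set y := f i ^+ 2 / (16 * c * E); set P := 2 `^ y => h.
  have P0 : 0 <= P by exact: powR_ge0.
  have -> : f i ^+ 2 = 16 * c * E / ln 2 * (y * ln 2).
    by rewrite /y; field; rewrite !gt_eqF.
  rewrite mulrCA ler_wpM2l//.
  have /andP[w0 wiB] := wB i; have wv0 := mulr_ge0 w0 (v_ge0 i).
  apply: (@le_trans _ _ (w i * v i * (L + P * (S / (B * V))))).
    rewrite ler_wpM2l//; lra.
  rewrite mulrDr lerD2l.
  rewrite (_ : w i * v i * _ = S / (B * V) * (w i * (v i * P))); last by ring.
  by rewrite ler_wpM2l// ler_wpM2r// mulr_ge0.
apply: le_trans (ler_sum _ (fun i _ => le_i i)) _.
rewrite -mulr_sumr big_split /= -mulr_suml -/S -!mulr_sumr -[leRHS]mulrA.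
rewrite ler_wpM2l// mulrDr lerD2l.
apply: (@le_trans _ _ (S / (B * V) * (B * (V * (1 + 4 * C))))).
  rewrite ler_wpM2l//.
  apply: ler_wpM2l; last exact: critical_moment.
  have [i _ | noi] := pickP (@predT I).
    by case/andP: (wB i) => /le_trans + h; apply.
  by move: S0; rewrite /S big_pred0 ?ltxx// => i; have := noi i.
by rewrite (mulrA B) mulrA divfK// gt_eqF.
Qed.

End critical.
End iteration.

(** Young's inequality with exponents [1 / th] and [1 / (1 - th)], applied after dividing [w i] by
    the [th]-th power of [W]: the first terms then sum to 1 and no moment of [y] needs normalising.
    If [W] is 0, every product [w i * v i] vanishes. *)
Lemma sum_hoelder_young (R : realType) (I : finType) (v w y : I -> R) (th X : R) :
  0 < th -> th < 1 -> (forall i, 0 <= v i) -> (forall i, 0 <= w i) ->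
  (forall i, 0 <= y i) -> \sum_i v i * y i `^ (1 - th)^-1 <= X ->
  \sum_i w i * v i * y i <= (\sum_i v i * w i `^ th^-1) `^ th * (1 + X).
Proof.
move=> th0 th1 v0 w0 y0 yX; set W := \sum_i v i * w i `^ th^-1.
have thV0 : 0 < th^-1 by rewrite invr_gt0.
have th1' : 0 < 1 - th by rewrite subr_gt0.
have W_ge0 : 0 <= W by apply: sumr_ge0 => i _; rewrite mulr_ge0 ?powR_ge0.
have X_ge0 : 0 <= X.
  by apply: le_trans yX; apply: sumr_ge0 => i _; rewrite mulr_ge0 ?powR_ge0.
have [W0|W_neq0] := eqVneq W 0.
  rewrite [leLHS]big1 ?mulr_ge0 ?powR_ge0 ?addr_ge0// => i _.
  have /eqP := W0; rewrite psumr_eq0 => [|j _]; last by rewrite mulr_ge0 ?powR_ge0.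
  move=> /allP /(_ i (mem_index_enum i)) /=.
  rewrite mulf_eq0 powR_eq0 => /orP[/eqP ->|/andP[/eqP -> _]];
    by rewrite ?mulr0 !mul0r.
have W_gt0 : 0 < W by rewrite lt_neqAle eq_sym W_neq0.
have B_gt0 : 0 < W `^ th by rewrite powR_gt0.
have le_i i : w i * v i * y i <=
    W `^ th * (v i * w i `^ th^-1 / W + v i * y i `^ (1 - th)^-1).
  have := @conjugate_powR R (w i / W `^ th) (y i) th^-1 (1 - th)^-1.
  rewrite !invrK !invr_gt0 divr_ge0 ?powR_ge0//.
  move=> /(_ isT (y0 i) th0 th1' (subrKC _ _)).
  rewrite powRM ?invr_ge0 ?powR_ge0// -[in (_^-1) `^ _]powRN -!powRrM.
  rewrite mulNr mulfV ?gt_eqF// powRN powRr1// => h.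
  have -> : w i * v i * y i = W `^ th * (v i * (w i / W `^ th * y i)).
    by field; rewrite gt_eqF.
  rewrite ler_wpM2l ?powR_ge0// -(mulrA (v i)) -mulrDr ler_wpM2l//.
  apply: (le_trans h); apply: lerD; rewrite ler_piMr ?mulr_ge0 ?powR_ge0 ?invr_ge0//.
    exact: ltW.
  by rewrite gerBl ltW.
apply: le_trans (ler_sum _ (fun i _ => le_i i)) _.
rewrite -mulr_sumr ler_wpM2l ?powR_ge0// big_split /= -mulr_suml lerD//.
by rewrite divff.
Qed.

(** * Simplices and meshes *)

Section column_topology.
Variables (R : realType) (d : nat).
Local Notation pt := 'cV[R]_d.
Implicit Types (A : set pt) (x y g : pt).

Lemma continuous_affine g (b : R) : continuous (fun x : pt => dotv g x + b).
Proof.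
have c_coord (c : R) (i : 'I_d) : continuous (fun x : pt => c * x i ord0).
  by move=> x; apply: continuousM; [exact: cst_continuous|exact: coord_continuous].
move=> x; apply: (@continuousD _ _ _ (dotv g) (fun=> b)); last exact: cst_continuous.
rewrite (_ : dotv g = fun y : pt => \sum_(i <- index_enum 'I_d) g i ord0 * y i ord0).
  by apply: continuous_big; [exact: add_continuous|move=> i _; exact: c_coord].
by apply/funext => y; rewrite dotvE.
Qed.

Lemma nbhs_boxP x A : nbhs x A ->
  exists2 e : R, 0 < e & forall y, (forall i, `|y i ord0 - x i ord0| < e) -> A y.
Proof.
move=> /nbhs_ballP[e /= e0 xA]; exists e => // y yx; apply: xA.
split => // i j; rewrite (ord1 j) /ball /= distrC; exact: yx.
Qed.

(** An open set is the union of the countably many boxes with rational centre and edge [2 / n.+1]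
    that it contains; [pickle] enumerates them. *)
Lemma open_cmeasurable A : open A -> cmeasurable A.
Proof.
move=> oA.
pose box (q : {ffun 'I_d -> rat} * nat) : set pt :=
  [set x | forall i, x i ord0 \in
     `[(ratr (q.1 i) : R) - q.2.+1%:R^-1, ratr (q.1 i) + q.2.+1%:R^-1]].
pose B (k : nat) : set pt :=
  if unpickle k is Some q then
    if `[< box q `<=` A >] then box q else set0 else set0.
have mB k : cmeasurable (B k).
  rewrite /B; case: unpickle => [q|]; last exact: measurable0.
  case: ifP => _; last exact: measurable0.
  exact: box_cmeasurable.
have -> : A = \bigcup_k B k.
  apply/seteqP; split => x; last first.
    move=> [k _]; rewrite /B; case: unpickle => // q.
    by case: asboolP => // + xq; exact.
  move=> Ax; have [e e0 xA] := nbhs_boxP (open_nbhs_nbhs (conj oA Ax)).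
  (* The centre will be within [1 / n.+1] of [x] and the points of the box within [1 / n.+1] of the
     centre, so the box stays within [e] of [x]. *)
  have [n n_lt] : exists n : nat, n.+1%:R^-1 < e / 2.
    exists (Num.trunc (e / 2)^-1).
    by rewrite invf_plt ?posrE ?divr_gt0// truncnS_gt.
  have n0 : (0 : R) < n.+1%:R^-1 by rewrite invr_gt0 ltr0n.
  have qex i : {q : rat | ratr q \in `](x i ord0 - n.+1%:R^-1), (x i ord0 + n.+1%:R^-1)[}.
    by apply/cid; apply: rat_in_itvoo; rewrite ltrBlDr -addrA ltrDl addr_gt0.
  pose q : {ffun 'I_d -> rat} := [ffun i => projT1 (qex i)].
  have qx i : `|ratr (q i) - x i ord0| < n.+1%:R^-1.
    rewrite ffunE; case: (qex i) => r /=.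
    by rewrite in_itv/= ltr_distl.
  exists (pickle (q, n)) => //; rewrite /B pickleK.
  case: asboolP => [_|[]].
    move=> i /=; have := qx i; rewrite in_itv/= ltr_distl.
    move: (ratr _) (n.+1%:R^-1) => a c /andP[h1 h2].
    by apply/andP; split; lra.
  move=> y yq; apply: xA => i; have := yq i; have := qx i; rewrite /= in_itv/=.
  rewrite !ltr_distl; move: (ratr _) (n.+1%:R^-1) n_lt => a c n_lt.
  by move=> /andP[h1 h2] /andP[h3 h4]; apply/andP; split; lra.
by rewrite /cmeasurable preimage_bigcup; exact: (bigcupT_measurable (fun k => @col_of_tuple R d @^-1` B k) mB).
Qed.

Lemma closed_cmeasurable A : closed A -> cmeasurable A.
Proof.
move=> cA; rewrite -[A]setCK /cmeasurable preimage_setC.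
by apply: measurableC; apply: (@open_cmeasurable (~` A)); exact: closed_openC.
Qed.

Lemma vol_bounded A (r : R) : cmeasurable A ->
  (forall x, A x -> forall i, `|x i ord0| <= r) -> (vol A < +oo)%E.
Proof.
move=> mA Ar; have [->|/set0P[x Ax]] := eqVneq A set0.
  by rewrite /vol preimage_set0 measure0.
have Nrr (i : 'I_d) : - r <= r.
  by have := Ar x Ax i; rewrite ler_norml => /andP[]; exact: le_trans.
apply: (@le_lt_trans _ _ (vol [set x : pt | forall i, x i ord0 \in `[-r, r]])).
  apply: le_vol => //; first exact: box_cmeasurable.
  by move=> y Ay i; rewrite in_itv/= -ler_norml Ar.
by rewrite (vol_box (a := fun=> -r) (b := fun=> r))// ltry.
Qed.

Lemma vol_open_gt0 A : open A -> A !=set0 -> (0 < vol A)%E.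
Proof.
move=> oA [x Ax]; have [e e0 xA] := nbhs_boxP (open_nbhs_nbhs (conj oA Ax)).
apply: (@lt_le_trans _ _ (vol [set y : pt |
    forall i, y i ord0 \in `[x i ord0 - e / 2, x i ord0 + e / 2]])).
  rewrite (vol_box (a := fun i => x i ord0 - e / 2) (b := fun i => x i ord0 + e / 2)).
    by rewrite lte_fin prodr_gt0// => i _; lra.
  by move=> i; lra.
apply: le_vol; [exact: box_cmeasurable|exact: open_cmeasurable|].
move=> y yx; apply: xA => i; have := yx i; rewrite in_itv/= ltr_distl.
move=> /andP[h1 h2]; apply/andP; split; lra.
Qed.

End column_topology.

Lemma enum_reindex (I : finType) (K : {set I}) (n : nat) : #|K| = n ->
  exists e : 'I_n -> I, [/\ injective e, forall k, e k \in K,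
    forall i, i \in K -> exists k, e k = i &
    forall (V : nmodType) (F : I -> V), \sum_(i in K) F i = \sum_k F (e k)].
Proof.
move=> HK; case: n / HK; exists enum_val; split => //.
- exact: enum_val_inj.
- by move=> k; exact: enum_valP.
- by move=> i iK; exists (enum_rank_in iK i); rewrite enum_rankK_in.
- by move=> V F; rewrite big_enum_val.
Qed.

Section barycentric.
Variables (R : realType) (d : nat) (I : finType).
Local Notation pt := 'cV[R]_d.
Variables (p : I -> pt) (K : {set I}).

(** The coordinates are affine functions on the whole space and not only on the hull, so that their
    signs can describe the hull and its interior. *)
Definition barycentric (G : I -> pt) (c : I -> R) :=
  [/\ forall x, \sum_(i in K) (dotv (G i) x + c i) = 1,
      forall x, \sum_(i in K) (dotv (G i) x + c i) *: p i = x &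
      forall l : I -> R, \sum_(i in K) l i = 1 ->
        forall i, i \in K -> dotv (G i) (\sum_(j in K) l j *: p j) + c i = l i].

(** Affine independence says that the square matrix [P] with rows [(1, p_k)] is invertible; the
    coordinates of [x] form the row that [P] maps to [(1, x)]. *)
Lemma barycentric_exists : nondegenerate_simplex p K ->
  exists G c, barycentric G c.
Proof.
move=> [HK aff]; have [e [einj eK Ke esum]] := enum_reindex HK.
pose P : 'M[R]_(1 + d) := \matrix_k row_mx (const_mx 1) (p (e k))^T.
have rowPE (l : 'rV[R]_(1 + d)) : l *m P =
    row_mx (const_mx (\sum_k l ord0 k)) (\sum_k l ord0 k *: p (e k))^T.
  rewrite mulmx_sum_row; apply/rowP => j; rewrite summxE.
  under eq_bigr do rewrite !mxE.
  case: (split_ordP j) => j' ->; rewrite ?row_mxEl ?row_mxEr.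
    by rewrite [RHS]mxE; apply: eq_bigr => k _; rewrite mxE mulr1.
  by rewrite [RHS]mxE summxE; apply: eq_bigr => k _; rewrite !mxE.
have unitP : P \in unitmx.
  rewrite -row_free_unit -kermx_eq0; apply/rowV0P => l /sub_kermxP.
  rewrite rowPE => lP0.
  have /eq_row_mx[/matrixP/(_ ord0 ord0)] := etrans lP0 (esym (row_mx0 _ 1 1 d)).
  rewrite !mxE => l0 /(congr1 trmx); rewrite trmxK trmx0 => lp0.
  apply/rowP => k; rewrite mxE.
  (* [aff] takes coefficients indexed by [I], so [l] is transported along the injection [e]. *)
  pose l' i := \sum_(k' | e k' == i) l ord0 k'.
  have l'e k' : l' (e k') = l ord0 k'.
    rewrite /l' (big_pred1 k')// => k''; exact: inj_eq.
  rewrite -l'e; apply: (aff l') => //; rewrite esum.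
    by under eq_bigr do rewrite l'e.
  by under eq_bigr do rewrite l'e.
pose Q := invmx P.
pose lam (x : pt) : 'rV[R]_(1 + d) := row_mx (const_mx 1) x^T *m Q.
pose G' k : pt := \col_j Q (rshift 1 j) k.
pose c' k : R := Q (lshift d ord0) k.
have lamE x k : lam x ord0 k = dotv (G' k) x + c' k.
  rewrite /lam mxE big_split_ord /= big_ord1 row_mxEl !mxE mul1r addrC.
  congr (_ + _); rewrite dotvE; apply: eq_bigr => j _.
  by rewrite row_mxEr !mxE mulrC.
pose G i : pt := \sum_(k | e k == i) G' k.
pose c i : R := \sum_(k | e k == i) c' k.
have Ge k : G (e k) = G' k.
  by rewrite /G (big_pred1 k)// => k'; exact: inj_eq.
have ce k : c (e k) = c' k.
  by rewrite /c (big_pred1 k)// => k'; exact: inj_eq.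
have lamP x : lam x *m P = row_mx (const_mx 1) x^T.
  by rewrite /lam -mulmxA mulVmx// mulmx1.
have lams x : \sum_k lam x ord0 k = 1 /\ \sum_k lam x ord0 k *: p (e k) = x.
  have := lamP x; rewrite rowPE => /eq_row_mx[/matrixP/(_ ord0 ord0)].
  by rewrite !mxE => -> /(congr1 trmx); rewrite !trmxK.
have s1 x : \sum_(i in K) (dotv (G i) x + c i) = 1.
  rewrite esum -[RHS](lams x).1; apply: eq_bigr => k _.
  by rewrite Ge ce lamE.
have s2 x : \sum_(i in K) (dotv (G i) x + c i) *: p i = x.
  rewrite esum -[RHS](lams x).2; apply: eq_bigr => k _.
  by rewrite Ge ce lamE.
exists G, c; split => // l l1 i iK; set x := \sum_(j in K) _.
apply/eqP; rewrite -subr_eq0; apply/eqP.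
apply: (aff (fun i => dotv (G i) x + c i - l i)) => //.
  by rewrite sumrB s1 l1 subrr.
under eq_bigr do rewrite scalerBl.
by rewrite sumrB s2 subrr.
Qed.

Lemma dotv0 (v : pt) : dotv v 0 = 0.
Proof. by rewrite /dotv mulmx0 mxE. Qed.

Lemma dotvNl (v w : pt) : dotv (- v) w = - dotv v w.
Proof. by rewrite -scaleN1r dotvZl mulN1r. Qed.

Lemma dotv_sumr (J : finType) (P : pred J) (v : pt) (F : J -> pt) :
  dotv v (\sum_(j | P j) F j) = \sum_(j | P j) dotv v (F j).
Proof.
by elim/big_rec2: _ => [|j a b _ <-]; [rewrite dotv0|rewrite dotvDr].
Qed.

Lemma affine_with_sum (f : pt -> R) (g : pt) (b : R) (l : I -> R) :
  \sum_(i in K) l i = 1 ->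
  dotv g (\sum_(i in K) l i *: p i) + b =
  \sum_(i in K) l i * (dotv g (p i) + b).
Proof.
move=> l1; rewrite dotv_sumr; under [RHS]eq_bigr do rewrite mulrDr.
rewrite big_split /= -mulr_suml l1 mul1r; congr (_ + _).
by apply: eq_bigr => i _; rewrite dotvZr.
Qed.

Hypothesis Knd : nondegenerate_simplex p K.

Lemma hull_vertex i : i \in K -> hull p K (p i).
Proof.
move=> iK; exists (fun j => (j == i)%:R); split => //.
- by rewrite (bigD1 i)//= eqxx big1 ?addr0// => j /andP[_ /negPf ->].
- rewrite (bigD1 i)//= eqxx scale1r big1 ?addr0// => j /andP[_ /negPf ->].
  by rewrite scale0r.
Qed.

(** Two affine functions that agree at the vertices agree everywhere, by barycentric coordinates;
    evaluation at [g - g'] then yields a vanishing square norm. *)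
Lemma affine_with_inj (f : pt -> R) (g g' : pt) :
  affine_with (hull p K) f g -> affine_with (hull p K) f g' -> g = g'.
Proof.
have [G [c [G1 Gx _]]] := barycentric_exists Knd.
move=> [b fb] [b' fb'].
have E x : dotv g x + b = dotv g' x + b'.
  rewrite -(Gx x) !affine_with_sum//; apply: eq_bigr => i iK; congr (_ * _).
  by rewrite -fb -?fb'//; exact: hull_vertex.
have bb : b = b' by have := E 0; rewrite !dotv0 !add0r.
apply/eqP; rewrite -subr_eq0; apply/eqP; apply: dotvv_eq0.
have := E (g - g'); rewrite bb => /addIr Eg.
by rewrite dotvDl dotvNl Eg subrr.
Qed.

Lemma grad_on_unique (f : pt -> R) (g : pt) :
  affine_with (hull p K) f g -> grad_on (hull p K) f = g.
Proof.
move=> fg; apply: (@affine_with_inj f) => //.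
by rewrite /grad_on; exact: (xgetPex 0 (ex_intro _ g fg)).
Qed.

Lemma hullE G c : barycentric G c ->
  hull p K = [set x | forall i, i \in K -> 0 <= dotv (G i) x + c i].
Proof.
move=> [G1 Gx Gu]; apply/seteqP; split => x /=.
  by move=> [l [l0 l1 ->]] i iK; rewrite Gu// l0.
by move=> x0; exists (fun i => dotv (G i) x + c i); split.
Qed.

Lemma barycentric_affine G c : barycentric G c ->
  forall (a : R) (b : I -> R) x, \sum_(i in K) b i = 1 - a ->
  forall i, i \in K ->
  dotv (G i) (a *: x + \sum_(j in K) b j *: p j) + c i =
  a * (dotv (G i) x + c i) + b i.
Proof.
move=> [G1 Gx Gu] a b x ba i iK.
rewrite -[RHS](Gu (fun i => a * (dotv (G i) x + c i) + b i))//.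
  congr (dotv _ _ + _); rewrite -{1}(Gx x) scaler_sumr -big_split /=.
  by apply: eq_bigr => j _; rewrite scalerA scalerDl.
by rewrite big_split /= -mulr_sumr G1 ba mulr1 subrKC.
Qed.

End barycentric.

Lemma bernoulli_ineq (R : realFieldType) (n : nat) (x : R) :
  0 <= x -> x <= 1 -> 1 - n%:R * x <= (1 - x) ^+ n.
Proof.
move=> x0 x1; elim: n => [|n IHn]; first by rewrite mul0r subr0 expr0.
rewrite exprS; apply: (@le_trans _ _ ((1 - x) * (1 - n%:R * x))).
  by rewrite -natr1; have := ler0n R n; nra.
by rewrite ler_wpM2l// subr_ge0.
Qed.

Section simplices.
Variables (R : realType) (d : nat) (I : finType).
Local Notation pt := 'cV[R]_d.
Variables (p : I -> pt) (K : {set I}).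

Definition open_hull : set pt :=
  [set x | exists l : I -> R,
    [/\ forall i, i \in K -> 0 < l i, \sum_(i in K) l i = 1 &
        x = \sum_(i in K) l i *: p i]].

Lemma open_hull_sub : open_hull `<=` hull p K.
Proof. by move=> x [l [l0 l1 xl]]; exists l; split => // i /l0/ltW. Qed.

Lemma hull_bounded x i : hull p K x -> `|x i ord0| <= \sum_j \sum_k `|p j k ord0|.
Proof.
move=> [l [l0 l1 ->]]; rewrite summxE; apply: le_trans (ler_norm_sum _ _ _) _.
apply: (@le_trans _ _ (\sum_(j in K) \sum_k `|p j k ord0|)); last first.
  rewrite [leRHS](bigID (mem K)) /= lerDl.
  by apply: sumr_ge0 => j _; apply: sumr_ge0.
apply: ler_sum => j jK; rewrite mxE normrM (ger0_norm (l0 _ jK)).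
apply: (@le_trans _ _ `|p j i ord0|).
  rewrite ler_piMl// -l1 (bigD1 j)//= lerDl; apply: sumr_ge0 => k /andP[kK _].
  exact: l0.
by rewrite (bigD1 i)//= lerDl sumr_ge0.
Qed.

Hypothesis Knd : nondegenerate_simplex p K.

Lemma open_hullE G c : barycentric p K G c ->
  open_hull = [set x | forall i, i \in K -> 0 < dotv (G i) x + c i].
Proof.
move=> [G1 Gx Gu]; apply/seteqP; split => x /=.
  by move=> [l [l0 l1 ->]] i iK; rewrite Gu// l0.
by move=> x0; exists (fun i => dotv (G i) x + c i); split.
Qed.

Lemma open_open_hull : open open_hull.
Proof.
have [G [c GcP]] := barycentric_exists Knd.
rewrite (open_hullE GcP) openE => x x0.
apply: (filter_forall (F := nbhs x)) => i /=.
have [iK|iNK] := boolP (i \in K); last exact: nearW.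
have := @continuous_affine R d (G i) (c i) x.
move=> /(_ [set r | 0 < r]) /=.
have : nbhs (dotv (G i) x + c i) [set r : R | 0 < r].
  by apply: open_nbhs_nbhs; split; [exact: open_gt|exact: x0].
by move=> n0 /(_ n0) near0; near=> y => _; near: y.
Unshelve. all: by end_near. Qed.

Lemma closed_hull : closed (hull p K).
Proof.
have [G [c GcP]] := barycentric_exists Knd.
rewrite (hullE GcP).
rewrite (_ : [set x | _] = \bigcap_(i in [set` K])
    [set x : pt | 0 <= dotv (G i) x + c i]); last first.
  by apply/seteqP; split => x /= h i; apply: h.
apply: closed_bigI => i _.
apply: (@preimage_closed _ _ (fun x => dotv (G i) x + c i) [set r | 0 <= r]) => //.
by move=> x _; exact: continuous_affine.
Qed.

Lemma hull_cmeasurable : cmeasurable (hull p K).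
Proof. exact: closed_cmeasurable closed_hull. Qed.

Lemma open_hull_cmeasurable : cmeasurable open_hull.
Proof. exact: open_cmeasurable open_open_hull. Qed.

Lemma vol_hull_fin : (vol (hull p K) < +oo)%E.
Proof.
exact: vol_bounded hull_cmeasurable (fun x xK i => hull_bounded i xK).
Qed.

Lemma card_simplex_gt0 : 0 < (#|K|%:R : R).
Proof. by have [-> _] := Knd; rewrite ltr0n. Qed.

Lemma open_hull_neq0 : open_hull !=set0.
Proof.
exists (\sum_(i in K) (#|K|%:R^-1) *: p i), (fun=> #|K|%:R^-1); split => //.
- by move=> i _; rewrite invr_gt0 card_simplex_gt0.
- by rewrite sumr_const -[LHS]mulr_natl mulfV// gt_eqF// card_simplex_gt0.
Qed.

Lemma vol_open_hull_gt0 : (0 < vol open_hull)%E.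
Proof. exact: vol_open_gt0 open_open_hull open_hull_neq0. Qed.

(** [P] is the image of the simplex under [x -> a *: x + v], written as a preimage. The map acts on
    coordinates by [l -> a * l + b i], so they become at least [b i]. *)
Lemma hull_shrink (a : R) (b : I -> R) : 0 < a -> \sum_(i in K) b i = 1 - a ->
  exists P : set pt, [/\ cmeasurable P, vol P = ((a ^+ d)%:E * vol (hull p K))%E &
    forall y, P y -> exists l : I -> R,
      [/\ forall i, i \in K -> b i <= l i, \sum_(i in K) l i = 1 &
          y = \sum_(i in K) l i *: p i]].
Proof.
move=> a0 ba; have [G [c GcP]] := barycentric_exists Knd.
pose v := \sum_(i in K) b i *: p i.
exists [set y | hull p K (a^-1 *: y + - (a^-1 *: v))]; split.
- exact: cmeasurable_affine hull_cmeasurable.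
- rewrite vol_affine ?invr_gt0//; last exact: hull_cmeasurable.
  by rewrite exprVn invrK.
move=> y /= yK; set x := a^-1 *: y + _ in yK.
have yE : y = a *: x + v.
  by rewrite scalerDr scalerN !scalerA mulfV ?gt_eqF// !scale1r subrK.
have [G1 Gx Gu] := GcP.
exists (fun i => dotv (G i) y + c i); split => // i iK.
rewrite yE (barycentric_affine GcP)// lerDr; apply: mulr_ge0; first exact: ltW.
by move: yK; rewrite (hullE GcP) => /(_ i iK).
Qed.

(** The faces are null: a copy contracted towards the barycentre by a factor [a < 1] lies in the
    open hull and has [a ^+ d] times the volume. Bernoulli's inequality replaces the limit of [a] to
    1. *)
Lemma vol_open_hull : vol open_hull = vol (hull p K).
Proof.
apply/eqP; rewrite eq_le; apply/andP; split.
  by apply: le_vol open_hull_sub; [exact: open_hull_cmeasurable|exact: hull_cmeasurable].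
have Kfin : vol (hull p K) \is a fin_num by rewrite ge0_fin_numE ?vol_ge0 ?vol_hull_fin.
have Ofin : vol open_hull \is a fin_num.
  rewrite ge0_fin_numE ?vol_ge0//; apply: le_lt_trans vol_hull_fin.
  by apply: le_vol open_hull_sub; [exact: open_hull_cmeasurable|exact: hull_cmeasurable].
have shrink (a : R) : 0 < a -> a < 1 -> ((a ^+ d)%:E * vol (hull p K) <= vol open_hull)%E.
  move=> a0 a1; have [|P [mP <- Pl]] := @hull_shrink a (fun=> (1 - a) / #|K|%:R) a0.
    by rewrite sumr_const -[LHS]mulr_natr divfK// gt_eqF// card_simplex_gt0.
  apply: le_vol => //; first exact: open_hull_cmeasurable.
  move=> y /Pl[l [bl l1 yl]]; exists l; split => // i /bl; apply: lt_le_trans.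
  by rewrite divr_gt0 ?subr_gt0 ?card_simplex_gt0.
move: shrink; rewrite -(fineK Kfin) -(fineK Ofin) lee_fin.
set k := fine _; set o := fine _ => shrink.
have k0 : 0 <= k by rewrite fine_ge0 ?vol_ge0.
rewrite leNgt; apply/negP => ok.
have o0 : 0 <= o by rewrite fine_ge0 ?vol_ge0.
have k_gt0 : 0 < k by exact: le_lt_trans ok.
have d0 : (0 : R) <= d%:R by rewrite ler0n.
(* Chosen such that [d * eps * k < k - o], which contradicts the Bernoulli bound at
   [a = 1 - eps]. *)
pose eps := (k - o) / (k * (d%:R + 2)).
have den0 : 0 < k * (d%:R + 2) by rewrite mulr_gt0//; lra.
have epsE : eps * (k * (d%:R + 2)) = k - o by rewrite divfK// gt_eqF.
have eps0 : 0 < eps by rewrite divr_gt0// subr_gt0.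
have eps1 : eps < 1 by rewrite ltr_pdivrMr// mul1r; nra.
have := shrink (1 - eps); rewrite -EFinM lee_fin => /(_ _ _)/wrap[]; try lra.
have /(ler_wpM2r k0) := bernoulli_ineq d (ltW eps0) (ltW eps1).
move=> /le_trans h /h; nra.
Qed.

(** Of the mass [1 - 16^-1] left by the contraction, 7/8 goes to the vertex [j] and the remaining
    1/16 is spread evenly over all vertices, which keeps the copy off the faces. *)
Lemma hull_near_vertex j : j \in K ->
  exists P : set pt, [/\ cmeasurable P,
    vol P = ((16^-1 ^+ d)%:E * vol (hull p K))%E, P `<=` open_hull &
    forall y, P y -> exists l : I -> R,
      [/\ forall i, i \in K -> 0 <= l i, \sum_(i in K) l i = 1,
          y = \sum_(i in K) l i *: p i & 7 / 8 <= l j]].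
Proof.
move=> jK; pose b i : R := (7 / 8) * (i == j)%:R + 16^-1 / #|K|%:R.
have b0 i : 0 < b i.
  by rewrite ltr_wpDl ?mulr_ge0 ?ler0n// divr_gt0// card_simplex_gt0.
have [||P [mP volP Pl]] := @hull_shrink 16^-1 b; first by [].
  rewrite big_split /= sumr_const -mulr_sumr -[X in _ + X]mulr_natr divfK; last first.
    by rewrite gt_eqF// card_simplex_gt0.
  rewrite (bigD1 j)//= eqxx big1 => [|i /andP[_ /negPf ->]//]; rewrite /=; lra.
exists P; split => // y /Pl[l [bl l1 yl]]; exists l; split => //.
- by move=> i /bl; exact: lt_le_trans.
- by move=> i /bl; apply: le_trans; exact: ltW.
- apply: le_trans (bl j jK); rewrite /b eqxx mulr1 lerDl divr_ge0//.
Qed.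

End simplices.

(** * Polyhedral domains *)

Section polyhedral.
Variables (R : realType) (d : nat) (Omega : set 'cV[R]_d).
Hypothesis poly : polyhedral_domain Omega.

Lemma polyhedral_open : open Omega.
Proof. by have [_ _ [m [p [_ ->]]]] := poly; exact: open_interior. Qed.

(** A finite union of simplices is closed, so the closure of [Omega] stays in the union of which
    [Omega] is the interior. Slits are thereby excluded, and a point with a neighbourhood covered by
    elements belongs to [Omega]. *)
Lemma polyhedral_interior_closure : interior (closure Omega) `<=` Omega.
Proof.
have [_ _ [m [p [pnd OmE]]]] := poly; rewrite {2}OmE; apply: interiorS.
rewrite closureE => x; apply; split.
  apply: closed_bigcup => [|k _]; first exact: finite_finset.
  exact: closed_hull.
by rewrite OmE; exact: interior_subset.
Qed.

Lemma polyhedral_bounded : exists r : R, forall x, Omega x ->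
  forall i, `|x i ord0| <= r.
Proof.
have [_ _ [m [p [pnd OmE]]]] := poly.
exists (\sum_k \sum_j \sum_i `|p k j i ord0|) => x; rewrite OmE.
move=> /interior_subset[k _ xk] i.
apply: (le_trans (hull_bounded i xk)); rewrite [leRHS](bigD1 k)//= lerDl.
by apply: sumr_ge0 => k' _; apply: sumr_ge0 => j _; apply: sumr_ge0.
Qed.

Lemma polyhedral_vol_fin : vol Omega \is a fin_num.
Proof.
rewrite ge0_fin_numE ?vol_ge0//; have [r Or] := polyhedral_bounded.
exact: vol_bounded (open_cmeasurable polyhedral_open) Or.
Qed.

Lemma polyhedral_volume_gt0 : 0 < volume Omega.
Proof.
rewrite volumeE fine_gt0// -ge0_fin_numE ?vol_ge0// polyhedral_vol_fin andbT.
by apply: vol_open_gt0; [exact: polyhedral_open|have [] := poly].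
Qed.

End polyhedral.

(** * Consequences of conformity *)

Section mesh_geometry.
Variables (R : realType) (d : nat) (Omega : set 'cV[R]_d) (M : mesh R d).
Local Notation pt := 'cV[R]_d.
Hypothesis poly : polyhedral_domain Omega.
Hypothesis tri : triangulation Omega M.
Local Notation p := (@vtx R d M).

Lemma elt_nondegenerate K : K \in elts M -> nondegenerate_simplex p K.
Proof. by have [_ + _ _ _] := tri; apply. Qed.

Lemma cell_closure K : K \in elts M -> cell K `<=` closure Omega.
Proof. by have [_ _ _ _ <-] := tri => KM x xK; exists K. Qed.

Lemma closure_cell x : closure Omega x -> exists2 K, K \in elts M & cell K x.
Proof. by have [_ _ _ _ <-] := tri => -[K KM xK]; exists K. Qed.

Lemma open_cell_sub K : K \in elts M -> open_hull p K `<=` Omega.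
Proof.
move=> KM; apply: subset_trans (polyhedral_interior_closure poly).
rewrite -open_subsetE; last exact/open_open_hull/elt_nondegenerate.
exact: subset_trans (@open_hull_sub _ _ _ _ _) (cell_closure KM).
Qed.

(** By conformity a common point is a combination of common vertices; uniqueness of barycentric
    coordinates makes the others vanish. *)
Lemma cellI_coord K L G c x : K \in elts M -> L \in elts M ->
  barycentric p K G c -> cell K x -> cell L x ->
  forall i, i \in K -> i \notin L -> dotv (G i) x + c i = 0.
Proof.
move=> KM LM [G1 Gx Gu] xK xL i iK iNL; have [_ _ _ conf _] := tri.
have : (cell K `&` cell L) x by [].
rewrite conf// => -[l [l0 l1 xl]].
pose l' j := if j \in L then l j else 0.
have s (V : lmodType R) (F : _ -> V) :
    \sum_(j in K) l' j *: F j = \sum_(j in K :&: L) l j *: F j.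
  rewrite [RHS](eq_bigl (fun j => (j \in K) && (j \in L))); last first.
    by move=> j; rewrite inE.
  rewrite [RHS]big_mkcondr /=; apply: eq_bigr => j _; rewrite /l'.
  by case: ifP => // _; rewrite scale0r.
rewrite xl -(s pt) Gu ?/l' ?(negPf iNL)//.
rewrite -l1; have := s R^o (fun=> 1).
by under eq_bigr do rewrite [_ *: _]mulr1; under [RHS]eq_bigr do rewrite [_ *: _]mulr1.
Qed.

(** A point of [L] with all coordinates in [K] positive forces every vertex of [K] to be one of [L],
    by [cellI_coord]; the argument is symmetric. *)
Lemma open_cell_disjoint K L x : K \in elts M -> L \in elts M ->
  open_hull p K x -> open_hull p L x -> K = L.
Proof.
have sub K' L' : K' \in elts M -> L' \in elts M ->
    open_hull p K' x -> open_hull p L' x -> K' \subset L'.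
  move=> KM LM xK xL; apply/fintype.subsetP => i iK; apply/negP => /negP iNL.
  have [G [c GcP]] := barycentric_exists (elt_nondegenerate KM).
  have := cellI_coord KM LM GcP (open_hull_sub xK) (open_hull_sub xL) iK iNL.
  by move: xK; rewrite (open_hullE GcP) => /(_ i iK) + E; rewrite E ltxx.
move=> KM LM xK xL; apply/eqP; rewrite finset.eqEsubset.
by rewrite !sub.
Qed.

(* Homotheties of small ratio centred at the interior vertex [v] map [x] into
   [Omega] and the elements with vertex [v] into themselves; hence the elements
   cover a neighbourhood of [x]. *)
Lemma star_interior (v : 'I_(nvert M)) K G c x : Omega (p v) ->
  K \in elts M -> v \in K -> barycentric p K G c ->
  cell K x -> 0 < dotv (G v) x + c v -> Omega x.
Proof.
move=> Ov KM vK GcP xK xv.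
have [e e0 ve] := nbhs_boxP (open_nbhs_nbhs (conj (polyhedral_open poly) Ov)).
pose s := \sum_i `|x i ord0 - p v i ord0|.
have s0 : 0 <= s by apply: sumr_ge0.
(* Small enough that [eps * s < e], which puts the image of [x] inside the box around the vertex. *)
pose eps := e / (s + 1 + e).
have den0 : 0 < s + 1 + e by lra.
have eps0 : 0 < eps by rewrite divr_gt0.
have epsE : eps * (s + 1 + e) = e by rewrite divfK// gt_eqF.
have eps1 : eps < 1 by rewrite ltr_pdivrMr// mul1r; lra.
pose z (y : pt) := eps *: y + (1 - eps) *: p v.
have Oz : Omega (z x).
  apply: ve => i; rewrite !mxE.
  rewrite (_ : _ - _ = eps * (x i ord0 - p v i ord0)); last by ring.
  rewrite normrM gtr0_norm//.
  have : `|x i ord0 - p v i ord0| <= s by rewrite /s (bigD1 i)//= lerDl sumr_ge0.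
  have := normr_ge0 (x i ord0 - p v i ord0); nra.
have cz : continuous z.
  move=> y; apply: (@continuousD _ _ _ (fun y => eps *: y) (fun=> (1 - eps) *: p v));
    last exact: cst_continuous.
  exact: scaler_continuous.
have lamz K' G' c' y : barycentric p K' G' c' -> v \in K' -> forall i, i \in K' ->
    dotv (G' i) (z y) + c' i = eps * (dotv (G' i) y + c' i) + (1 - eps) * (i == v)%:R.
  move=> Gc' vK' i iK'.
  rewrite -(barycentric_affine Gc' (b := fun j => (1 - eps) * (j == v)%:R))//.
    congr (dotv _ (_ + _) + _); rewrite (bigD1 v)//= eqxx mulr1 big1 ?addr0//.
    by move=> j /andP[_ /negPf ->]; rewrite mulr0 scale0r.
  rewrite (bigD1 v)//= eqxx mulr1 big1 ?addr0//.
  by move=> j /andP[_ /negPf ->]; rewrite mulr0.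
have zxK : cell K (z x).
  rewrite /cell (hullE GcP) => i iK; rewrite (lamz K G c)//.
  rewrite addr_ge0// mulr_ge0 ?ler0n ?subr_ge0 ?(ltW eps0) ?(ltW eps1)//.
  by move: xK; rewrite /cell (hullE GcP) => /(_ i iK).
(* If [z x] is outside the closed cell [L], then so is [z y] for [y] near [x]. Otherwise [v] is a
   vertex of [L] and [x] has there the same positive coordinate as in [K]; it stays positive near
   [x], and the other coordinates are merely scaled by [eps]. *)
have near_cell : \forall y \near x, forall L, L \in elts M -> cell L (z y) -> cell L y.
  apply: (@filter_forall _ _ (fun (L : {set 'I_(nvert M)}) y => L \in elts M -> cell L (z y) -> cell L y) (nbhs x)) => L.
  have [LM|LNM] := boolP (L \in elts M); last exact: nearW.
  have Lnd := elt_nondegenerate LM.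
  have [zxL|zxNL] := pselect (cell L (z x)); last first.
    have oL : open (~` cell L) by apply: closed_openC; exact: closed_hull.
    have : nbhs (z x) (~` cell L) by exact: open_nbhs_nbhs.
    by move=> /(cz x); apply: (@filterS _ (nbhs x)) => y /= yL _ /yL.
  have [GL [cL GLP]] := barycentric_exists Lnd.
  have Gz i : i \in K -> i \notin L -> dotv (G i) x + c i = 0 /\ i != v.
    move=> iK iNL; have := cellI_coord KM LM GcP zxK zxL iK iNL.
    rewrite (lamz K G c)//.
    have xi : 0 <= dotv (G i) x + c i by move: xK; rewrite /cell (hullE GcP) => /(_ i iK).
    have [->|_] := eqVneq i v; rewrite ?mulr1 ?mulr0 => E; split => //.
    - nra.
    - exfalso; nra.
    - nra.
  have vL : v \in L by apply: contraT => /(Gz v vK)[_ /eqP].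
  have lamLK : dotv (GL v) x + cL v = dotv (G v) x + c v.
    have [_ Gx _] := GcP; have [_ _ GLu] := GLP.
    pose l j := if j \in K then dotv (G j) x + c j else 0.
    have s' (V : lmodType R) (F : _ -> V) :
        \sum_(j in L) l j *: F j = \sum_(j in K) (dotv (G j) x + c j) *: F j.
      rewrite big_mkcond [RHS]big_mkcond; apply: eq_bigr => j _; rewrite /l.
      case: ifPn => jL; case: ifPn => jK//; rewrite ?scale0r//.
      by rewrite (Gz j jK jL).1 scale0r.
    have := GLu l; rewrite s' Gx => -> //; first by rewrite /l vK.
    have [G1 _ _] := GcP; rewrite -(G1 x); have := s' R^o (fun=> 1).
    by under eq_bigr do rewrite [_ *: _]mulr1; under [RHS]eq_bigr do rewrite [_ *: _]mulr1.
  have : nbhs (dotv (GL v) x + cL v) [set r : R | 0 < r].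
    by apply: open_nbhs_nbhs; split; [exact: open_gt|rewrite /= lamLK].
  move=> /(@continuous_affine R d (GL v) (cL v) x).
  apply: (@filterS _ (nbhs x)) => y /= yv _; rewrite /cell !(hullE GLP) => zy i iL.
  have := zy i iL; rewrite (lamz L GL cL)//.
  have [->|_] := eqVneq i v; first by move=> _; exact: ltW.
  by rewrite mulr0 addr0 pmulr_rge0.
apply: (polyhedral_interior_closure poly); rewrite /interior /=.
have near_O : \forall y \near x, Omega (z y).
  apply: (cz x); apply: open_nbhs_nbhs; split => //; exact: polyhedral_open.
near=> y.
have zy : Omega (z y) by near: y; exact: near_O.
have zy_cell L : L \in elts M -> cell L (z y) -> cell L y.
  by move: L; near: y; exact: near_cell.
have [L LM zyL] := closure_cell (subset_closure zy).
exact/(cell_closure LM)/zy_cell.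
Unshelve. all: by end_near. Qed.

End mesh_geometry.

(** * Finite element functions *)

Section hat_functions.
Variables (R : realType) (d : nat) (Omega : set 'cV[R]_d) (M : mesh R d).
Local Notation pt := 'cV[R]_d.
Local Notation element := {set 'I_(nvert M)}.
Local Notation p := (@vtx R d M).
Hypothesis poly : polyhedral_domain Omega.
Hypothesis tri : triangulation Omega M.
Variable phi : 'I_(nvi Omega M) -> pt -> R.
Hypothesis phi_hat : forall j, hat_function j (phi j).

Lemma hat_grad K j : K \in elts M ->
  affine_with (cell K) (phi j) (grad_on (cell K) (phi j)).
Proof.
move=> KM; have [_ /(_ K KM)[g phig] _] := phi_hat j.
rewrite /cell (grad_on_unique (elt_nondegenerate tri KM) phig); exact: phig.
Qed.

Lemma hat_coord K j (l : 'I_(nvert M) -> R) : K \in elts M ->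
  (forall i, i \in K -> 0 <= l i) -> \sum_(i in K) l i = 1 ->
  phi j (\sum_(i in K) l i *: p i) = \sum_(i in K) l i * (i == ivertex j)%:R.
Proof.
move=> KM l0 l1; have [b phib] := hat_grad j KM.
rewrite phib; last by exists l.
rewrite affine_with_sum//; apply: eq_bigr => i iK.
rewrite -phib; last exact: hull_vertex.
by have [_ _ ->] := phi_hat j.
Qed.

Lemma hat_range K j x : K \in elts M -> cell K x -> 0 <= phi j x <= 1.
Proof.
move=> KM [l [l0 l1 ->]]; rewrite hat_coord//; apply/andP; split.
  by apply: sumr_ge0 => i iK; rewrite mulr_ge0 ?l0 ?ler0n.
rewrite -[leRHS]l1; apply: ler_sum => i iK; rewrite ler_piMr ?l0 ?lern1 ?leq_b1//.
Qed.

Lemma hat_notin K j : K \in elts M -> ivertex j \notin K ->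
  grad_on (cell K) (phi j) = 0.
Proof.
move=> KM jK; apply: (grad_on_unique (elt_nondegenerate tri KM)).
exists 0 => x [l [l0 l1 ->]]; rewrite hat_coord// addr0 dotvC dotv0 big1// => i iK.
by case: eqP => [ij|_]; [rewrite -ij iK in jK|rewrite mulr0].
Qed.

Lemma ivertex_interior (j : 'I_(nvi Omega M)) : Omega (p (ivertex j)).
Proof.
have : ivertex j \in interior_vertices Omega M by exact: enum_valP.
rewrite inE => /asboolP nb; apply: contrapT => nO; apply: nb; split.
  have [_ _ /(_ (ivertex j))[K KM jK] _ _] := tri.
  by apply: (cell_closure tri KM); exact: hull_vertex.
by move=> /interior_subset.
Qed.

(** A positive coordinate at the interior vertex [ivertex j] would put the point into [Omega] by
    [star_interior]; the other vertices do not contribute to [phi j]. *)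
Lemma hat_boundary j x : closure Omega x -> ~ Omega x -> phi j x = 0.
Proof.
move=> /(closure_cell tri)[K KM xK] nOx.
have [G [c GcP]] := barycentric_exists (elt_nondegenerate tri KM).
have := xK; rewrite /cell (hullE GcP) /= => lx0.
have [G1 Gx _] := GcP.
rewrite -(Gx x) hat_coord// big1// => i iK.
case: eqP => [ij|_]; last by rewrite mulr0.
have := lx0 i iK; rewrite le_eqVlt => /orP[/eqP <-|xi]; first by rewrite mul0r.
exfalso; apply: nOx; apply: (star_interior poly tri _ KM iK GcP xK xi).
by rewrite ij; exact: ivertex_interior.
Qed.

(** [hat_function] prescribes [phi j] on the closure of [Omega] only, so its values elsewhere are
    discarded. *)
Definition hat_ext j (x : pt) : R := if `[< closure Omega x >] then phi j x else 0.

(** The critical points are those of the boundary: continuity within the closure and the limit 0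
    given by [hat_boundary] match the value 0 outside. *)
Lemma hat_ext_continuous j : continuous (hat_ext j).
Proof.
have [phic _ _] := phi_hat j.
move=> x; have [Ox|nOx] := pselect (Omega x).
  have cO : {in Omega, continuous (phi j)}.
    rewrite -continuous_open_subspace; last exact: polyhedral_open.
    exact: continuous_subspaceW (@subset_closure _ _) phic.
  have E y : Omega y -> hat_ext j y = phi j y.
    by move=> Oy; rewrite /hat_ext; case: asboolP => // -[]; exact: subset_closure.
  move=> V; rewrite E// => /(cO x (mem_set Ox)).
  have nO : nbhs x Omega.
    by apply: open_nbhs_nbhs; split => //; exact: polyhedral_open.
  apply: (@filterS2 _ (nbhs x) _ _ _ _ _ nO) => y Oy /=.
  by rewrite E.
have ext0 : hat_ext j x = 0.
  by rewrite /hat_ext; case: asboolP => // cx; exact: hat_boundary.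
have [cx|ncx] := pselect (closure Omega x); last first.
  move=> V; rewrite ext0 => V0.
  have nC : nbhs x (~` closure Omega).
    apply: open_nbhs_nbhs; split => //.
    by apply: closed_openC; exact: closed_closure.
  apply: (@filterS _ (nbhs x) _ _ _ _ nC) => y ncy /=.
  by rewrite /hat_ext; case: asboolP => // _; exact: nbhs_singleton V0.
move=> V; rewrite ext0 => V0.
have phix := hat_boundary j cx nOx.
have phi0 : phi j y @[y --> within (closure Omega) (nbhs x)] --> (0 : R).
  by rewrite -phix; move/subspace_continuousP : phic => /(_ x cx).
have := phi0 V V0.
rewrite /= /within /=.
apply: (@filterS _ (nbhs x)) => y /= h.
rewrite /hat_ext; case: asboolP => [/h//|_]; exact: nbhs_singleton V0.
Qed.

Section fe_function.
Variable a : 'I_(nvi Omega M) -> R.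

Definition fe (x : pt) : R := \sum_j a j * hat_ext j x.

(** Nodal values on all vertices, 0 at those on the boundary, so that sums over the vertices of an
    element need no case distinction. *)
Definition nodal (i : 'I_(nvert M)) : R := \sum_j a j * (i == ivertex j)%:R.

Definition fe_grad (K : element) : pt := \sum_j a j *: grad_on (cell K) (phi j).

(** For an element this is the maximum of [|u|] over its cell, since an affine function attains it
    at a vertex. *)
Definition fe_max (K : element) : R := \big[Num.max/0]_(i in K) `|nodal i|.

Lemma nodal_ivertex j : nodal (ivertex j) = a j.
Proof.
rewrite /nodal (bigD1 j)//= eqxx mulr1 big1 ?addr0// => k kj.
case: eqP => [/enum_val_inj jk|_]; last by rewrite mulr0.
by rewrite jk eqxx in kj.
Qed.

Lemma fe_continuous : continuous fe.
Proof.
apply: (@continuous_big R _ +%R 0 xpredT add_continuous) => j _ x.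
by apply: continuousM; [exact: cst_continuous|exact: hat_ext_continuous].
Qed.

Lemma fe_support x : fe x != 0 -> Omega x.
Proof.
apply: contraNP => nOx; apply/eqP; rewrite /fe big1// => j _; rewrite /hat_ext.
by case: asboolP => [cx|_]; rewrite ?hat_boundary// mulr0.
Qed.

Lemma fe_coord K (l : 'I_(nvert M) -> R) : K \in elts M ->
  (forall i, i \in K -> 0 <= l i) -> \sum_(i in K) l i = 1 ->
  fe (\sum_(i in K) l i *: p i) = \sum_(i in K) l i * nodal i.
Proof.
move=> KM l0 l1.
have xC : closure Omega (\sum_(i in K) l i *: p i).
  by apply: (cell_closure tri KM); exists l.
rewrite /fe /hat_ext; under eq_bigr do rewrite asboolT// hat_coord// mulr_sumr.
rewrite exchange_big /=; apply: eq_bigr => i iK; rewrite /nodal mulr_sumr.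
by apply: eq_bigr => j _; rewrite mulrCA.
Qed.

Lemma dotv_suml (J : finType) (F : J -> pt) x :
  dotv (\sum_j F j) x = \sum_j dotv (F j) x.
Proof. by rewrite dotvC dotv_sumr; apply: eq_bigr => j _; rewrite dotvC. Qed.

Lemma fe_affine K : K \in elts M -> affine_with (cell K) fe (fe_grad K).
Proof.
move=> KM; have [c phic] := choice (fun j => hat_grad j KM).
exists (\sum_j a j * c j) => x xK; rewrite /fe /fe_grad dotv_suml -big_split /=.
apply: eq_bigr => j _; rewrite /hat_ext asboolT; last exact: cell_closure tri _ KM _ xK.
by rewrite (phic j x xK) mulrDr dotvZl.
Qed.

Lemma fe_max_ge0 (K : element) : 0 <= fe_max K.
Proof. by rewrite /fe_max; elim/big_ind: _ => // x y x0 y0; rewrite le_max x0. Qed.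

Lemma nodal_le_max (K : element) i : i \in K -> `|nodal i| <= fe_max K.
Proof. by move=> iK; rewrite /fe_max; apply: (le_bigmax_cond 0 (fun i => `|nodal i|)). Qed.

Lemma fe_max_attained (K : element) : 0 < fe_max K -> exists2 i, i \in K & fe_max K = `|nodal i|.
Proof.
rewrite /fe_max; elim/big_rec: _ => [|i x iK IH]; first by rewrite ltxx.
by case: (leP `|nodal i| x) => [_ x0|_ _]; [exact: IH|exists i].
Qed.

End fe_function.
End hat_functions.

(** * Weighted Sobolev and Trudinger inequalities *)

Lemma le_mul_limit (R : realFieldType) (x k y : R) :
  (forall z, y < z -> x <= k * z) -> x <= k * y.
Proof.
move=> h; rewrite leNgt; apply/negP => kx.
have k0 := normr_ge0 k; have kk := ler_norm k.
pose eps := (x - k * y) / (2 * (`|k| + 1)).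
have den : 0 < 2 * (`|k| + 1) by lra.
have epsE : eps * (2 * (`|k| + 1)) = x - k * y by rewrite divfK// gt_eqF.
have eps0 : 0 < eps by rewrite divr_gt0// subr_gt0.
have := h (y + eps); rewrite ltrDl => /(_ eps0).
have : k * eps <= `|k| * eps by rewrite ler_wpM2r// ltW.
nra.
Qed.

(** The bound of [subcritical_moment] with [C = 16 ^ d] from [near_vertex_volume] and [c = 2 d 4^th]
    from [level_decay], plus the 1 added by [sum_hoelder_young]. *)
Definition subcritical_const (R : realType) (V : R) (d : nat) : R :=
  let th := 2 / d%:R in
  let p := 2 / (1 - th) in
  1 + (2 `^ p * V + 4 `^ p * (16 ^+ d *
    (V + Num.max V ((2 `^ p * (2 * d%:R * 4 `^ th)) `^ (1 - th)^-1)))).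

Lemma subcritical_const_gt0 (R : realType) (V : R) (d : nat) :
  0 <= V -> 0 < subcritical_const V d.
Proof.
move=> V0; rewrite ltr_pwDl// addr_ge0// !mulr_ge0 ?powR_ge0 ?exprn_ge0//.
by rewrite addr_ge0// le_max V0.
Qed.

Section sobolev.
Variables (R : realType) (d : nat) (Omega : set 'cV[R]_d) (M : mesh R d).
Local Notation pt := 'cV[R]_d.
Local Notation element := {set 'I_(nvert M)}.
Local Notation p := (@vtx R d M).
Hypothesis poly : polyhedral_domain Omega.
Hypothesis tri : triangulation Omega M.

(** Extension by 0 to all vertex sets, so that the sums of the iteration run over a whole finite
    type. *)
Definition cell_vol (K : element) : R := if K \in elts M then volume (cell K) else 0.

Lemma cell_fin K : K \in elts M -> vol (cell K) \is a fin_num.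
Proof.
move=> KM; rewrite ge0_fin_numE ?vol_ge0//.
exact: vol_hull_fin (elt_nondegenerate tri KM).
Qed.

Lemma cell_volume_gt0 K : K \in elts M -> 0 < volume (cell K).
Proof.
move=> KM; rewrite volumeE fine_gt0// -ge0_fin_numE ?vol_ge0// cell_fin// andbT.
have Knd := elt_nondegenerate tri KM.
by rewrite /cell -(vol_open_hull Knd); exact: vol_open_hull_gt0.
Qed.

Lemma cell_vol_ge0 K : 0 <= cell_vol K.
Proof. by rewrite /cell_vol; case: ifP => // KM; exact/ltW/cell_volume_gt0. Qed.

Lemma sum_disjoint_volume (P : element -> set pt) (A : set pt) :
  (forall K, cmeasurable (P K)) -> cmeasurable A -> vol A \is a fin_num ->
  (forall K, P K `<=` A) ->
  (forall K x, P K x -> K \in elts M /\ open_hull p K x) ->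
  \sum_K volume (P K) <= volume A.
Proof.
move=> mP mA Afin PA PO.
have tP : trivIset setT (fun K => @col_of_tuple R d @^-1` P K).
  move=> K L _ _ [x [/= /PO[KM xK] /PO[LM xL]]].
  exact: (open_cell_disjoint tri KM LM xK xL).
have le_sum : (\sum_K vol (P K) <= vol A)%E.
  rewrite -(measure_bigcup_fin _ mP tP); apply: le_measure; rewrite ?inE//.
  - by apply: fin_bigcup_measurable => [|K _]; [exact: finite_finset|exact: mP].
  - by move=> x [K _]; exact: PA.
have Pfin K : vol (P K) \is a fin_num.
  rewrite ge0_fin_numE ?vol_ge0//; apply: (@le_lt_trans _ _ (vol A)).
    exact: le_vol.
  by rewrite -ge0_fin_numE ?vol_ge0.
move: le_sum; rewrite -(fineK Afin).
under eq_bigr do rewrite -(fineK (Pfin _)).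
by rewrite sumEFin lee_fin.
Qed.

(** The open hulls are disjoint, lie in [Omega] and have the volumes of the closed cells. *)
Lemma sum_cell_vol : \sum_K cell_vol K <= volume Omega.
Proof.
pose P K := if K \in elts M then open_hull p K else set0.
apply: (@le_trans _ _ (\sum_K volume (P K))).
  apply: ler_sum => K _; rewrite /cell_vol /P; case: ifP => KM.
    by rewrite !volumeE (vol_open_hull (elt_nondegenerate tri KM)).
  by rewrite volumeE /vol preimage_set0 measure0.
apply: sum_disjoint_volume.
- move=> K; rewrite /P; case: ifP => KM; last exact: measurable0.
  exact: open_hull_cmeasurable (elt_nondegenerate tri KM).
- exact: open_cmeasurable (polyhedral_open poly).
- exact: polyhedral_vol_fin.
- move=> K; rewrite /P; case: ifP => [KM|_ x []]; exact: (open_cell_sub poly tri KM).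
- by move=> K x; rewrite /P; case: ifP.
Qed.

(* Elements overlap on faces; each point is given to the first element that
   contains it. *)
Definition cell_part (K : element) : set pt :=
  if K \in elts M then
    cell K `\` \bigcup_(L in [set L | L \in elts M /\ (enum_rank L < enum_rank K)%N]) cell L
  else set0.

Lemma cell_part_sub K : cell_part K `<=` cell K.
Proof. by rewrite /cell_part; case: ifP => // KM x []. Qed.

Lemma cell_part_elt K x : cell_part K x -> K \in elts M.
Proof. by rewrite /cell_part; case: ifP. Qed.

Lemma cell_part_cmeasurable K : cmeasurable (cell_part K).
Proof.
rewrite /cell_part; case: ifP => KM; last exact: measurable0.
apply: cmeasurableD; first exact: hull_cmeasurable (elt_nondegenerate tri KM).
apply: cmeasurable_bigcup => L [LM _].
exact: hull_cmeasurable (elt_nondegenerate tri LM).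
Qed.

Lemma cell_part_trivIset : trivIset setT cell_part.
Proof.
have part K L x : (enum_rank K < enum_rank L)%N -> cell_part K x -> cell_part L x -> False.
  move=> KL xK; have KM := cell_part_elt xK.
  rewrite /cell_part; case: ifP => // LM [_]; apply.
  by exists K => //; exact: cell_part_sub.
move=> K L _ _ [x [xK xL]]; apply: enum_rank_inj; apply: val_inj => /=.
case: (ltngtP (enum_rank K) (enum_rank L)) => // rKL.
  by have := part K L x rKL xK xL.
by have := part L K x rKL xL xK.
Qed.

Lemma cell_part_cover x : Omega x -> exists K, cell_part K x.
Proof.
move=> /(@subset_closure _ Omega x)/(closure_cell tri)[K0 K0M xK0].
have P0 : (K0 \in elts M) && `[< cell K0 x >] by rewrite K0M; apply/asboolP.
have [K /andP[KM /asboolP xK] Kmin] := arg_minnP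
  (P := fun K => (K \in elts M) && `[< cell K x >]) (fun K => enum_rank K : nat) P0.
exists K; rewrite /cell_part KM; split => // -[L [LM rL] xL].
have := Kmin L; rewrite LM asboolT//= => /(_ isT).
by rewrite leqNgt rL.
Qed.

Lemma volume_cell_part K : volume (cell_part K) <= cell_vol K.
Proof.
rewrite /cell_vol; case: ifP => KM; last first.
  by rewrite /cell_part KM volumeE /vol preimage_set0 measure0.
have le_part : (vol (cell_part K) <= vol (cell K))%E.
  apply: le_vol; [exact: cell_part_cmeasurable| |exact: cell_part_sub].
  exact: hull_cmeasurable (elt_nondegenerate tri KM).
rewrite !volumeE fine_le ?cell_fin// ge0_fin_numE ?vol_ge0//.
by apply: (le_lt_trans le_part); rewrite -ge0_fin_numE ?vol_ge0// cell_fin.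
Qed.

Lemma cell_part_fin K : (vol (cell_part K) < +oo)%E.
Proof.
have [KM|/negbTE KM] := boolP (K \in elts M); last first.
  by rewrite /cell_part KM /vol preimage_set0 measure0.
apply: (@le_lt_trans _ _ (vol (cell K))); last first.
  by rewrite -ge0_fin_numE ?vol_ge0// cell_fin.
apply: le_vol; [exact: cell_part_cmeasurable| |exact: cell_part_sub].
exact: hull_cmeasurable (elt_nondegenerate tri KM).
Qed.

Variable phi : 'I_(nvi Omega M) -> pt -> R.
Hypothesis phi_hat : forall j, hat_function j (phi j).
Variable a : 'I_(nvi Omega M) -> R.
Local Notation u := (fe phi a).
Local Notation fmax := (fe_max a).

Definition fe_energy : R :=
  \sum_(K in elts M) volume (cell K) * dotv (fe_grad phi a K) (fe_grad phi a K).

Lemma fe_energy_ge0 : 0 <= fe_energy.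
Proof.
by apply: sumr_ge0 => K KM; rewrite mulr_ge0 ?dotvv_ge0// ltW// cell_volume_gt0.
Qed.

Lemma level_sub (t : R) : 0 <= t -> level u t `<=` Omega.
Proof.
move=> t0 x tx; apply: (fe_support poly tri phi_hat (a := a)).
by rewrite -normr_gt0 (le_lt_trans t0).
Qed.

Lemma fe_offset : exists b : element -> R, forall K x, K \in elts M -> cell K x ->
  u x = dotv (fe_grad phi a K) x + b K.
Proof.
suff /choice[b bP] : forall K : element, exists b, K \in elts M ->
  forall x, cell K x -> u x = dotv (fe_grad phi a K) x + b.
  by exists b => K x KM; exact: bP.
move=> K; have [KM|KM] := boolP (K \in elts M); last by exists 0.
by have [b bP] := fe_affine tri phi_hat a KM; exists b.
Qed.

(** In the copy of ratio 1/16 at a vertex where [|u|] is maximal, [|u|] is at least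
    [(7/8 - 1/8) * fmax K], hence above [t]. Copies in different elements are disjoint, so together
    they fit into the level set. *)
Lemma near_vertex_volume (t : R) : 0 <= t -> cmeasurable (level u t) ->
  \sum_(K | 2 * t < fmax K) cell_vol K <= 16 ^+ d * volume (level u t).
Proof.
move=> t0 mt.
have tfin : vol (level u t) \is a fin_num.
  rewrite ge0_fin_numE ?vol_ge0//; apply: (@le_lt_trans _ _ (vol Omega)).
    by apply: le_vol (level_sub t0) => //; exact: open_cmeasurable (polyhedral_open poly).
  by rewrite -ge0_fin_numE ?vol_ge0//; exact: polyhedral_vol_fin.
pose good K := (K \in elts M) && (2 * t < fmax K).
have Pex (K : element) : exists P : set pt, [/\ cmeasurable P,
    volume P = if good K then 16^-1 ^+ d * volume (cell K) else 0,
    forall x, P x -> K \in elts M /\ open_hull p K x & P `<=` level u t].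
  case: ifPn => [/andP[KM tK]|_]; last first.
    exists set0; split => //; first exact: measurable0.
    by rewrite volumeE /vol preimage_set0 measure0.
  have f0 : 0 < fmax K by lra.
  have [v vK fE] := fe_max_attained f0.
  have [P [mP volP PO Pl]] := hull_near_vertex (elt_nondegenerate tri KM) vK.
  exists P; split => //; first by rewrite !volumeE volP fineM ?cell_fin.
    by move=> x /PO.
  move=> x /Pl[l [l0 l1 -> lv]]; rewrite /level /= (fe_coord tri phi_hat)//.
  rewrite (bigD1 v)//=.
  have rest : `|\sum_(i in K | i != v) l i * nodal a i| <= (1 - l v) * fmax K.
    apply: le_trans (ler_norm_sum _ _ _) _.
    have -> : 1 - l v = \sum_(i in K | i != v) l i.
      by rewrite -l1 (bigD1 v)//= addrAC subrr add0r.
    rewrite mulr_suml.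
    apply: ler_sum => i /andP[iK _]; rewrite normrM ger0_norm ?l0//.
    by rewrite ler_wpM2l ?l0// nodal_le_max.
  have main : `|l v * nodal a v| = l v * fmax K by rewrite normrM ger0_norm ?l0// fE.
  have := lerB_normD (l v * nodal a v) (\sum_(i in K | i != v) l i * nodal a i).
  rewrite main; nra.
have [P PP] := choice Pex.
have : \sum_K volume (P K) <= volume (level u t).
  apply: sum_disjoint_volume => //; by move=> K; have [] := PP K.
have d16 : 0 < (16 ^+ d : R) by rewrite exprn_gt0.
rewrite -(ler_pM2l d16); apply: le_trans; rewrite mulr_sumr big_mkcond /=.
apply: ler_sum => K _; have [_ -> _ _] := PP K.
rewrite /good /cell_vol; case: (K \in elts M) => /=; last by rewrite mulr0 if_same.
by case: ifP => _; rewrite ?mulr0// mulrA -exprMn mulfV// expr1n mul1r.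
Qed.

(** The hypotheses of the abstract iteration, indexed by the elements; the existential [e] hides the
    offsets of the affine pieces. *)
Lemma fe_iteration (d_gt0 : (0 < d)%N) : exists e : R -> R -> R,
  let m t := volume (level u t) in
  [/\ forall t, 0 <= t -> 0 <= m t <= volume Omega,
      forall s t, 0 <= e s t,
      forall (t : nat -> R) n, 0 <= t 0%N -> (forall k, t k < t k.+1) ->
        \sum_(k < n) e (t k) (t k.+1) <= fe_energy,
      forall s t, 0 <= s -> s < t -> m t * (t - s) ^+ 2 <=
        2 * d%:R * (4 * m s) `^ (2 / d%:R) * e s t &
      forall t, 0 <= t -> \sum_(K | 2 * t < fmax K) cell_vol K <= 16 ^+ d * m t].
Proof.
have [b bP] := fe_offset.
have uc : continuous u := fe_continuous poly tri phi_hat (a := a).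
have uS K x : cell_part K x -> u x = dotv (fe_grad phi a K) x + b K.
  by move=> xK; apply: bP; [exact: cell_part_elt xK|exact: cell_part_sub].
have uN0 x : u x != 0 -> exists K, cell_part K x.
  by move=> /(fe_support poly tri phi_hat)/cell_part_cover.
have mlev t : 0 <= t -> cmeasurable (level u t).
  exact: level_cmeasurable cell_part_cmeasurable uS uN0 t.
exists (strip_energy cell_part (fe_grad phi a) b); split.
- move=> t t0; rewrite volumeE fine_ge0 ?vol_ge0//=.
  have le_lev : (vol (level u t) <= vol Omega)%E.
    apply: le_vol (level_sub t0); first exact: mlev.
    exact: open_cmeasurable (polyhedral_open poly).
  rewrite volumeE fine_le//; last exact: polyhedral_vol_fin.
  rewrite ge0_fin_numE ?vol_ge0//; apply: (le_lt_trans le_lev).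
  by rewrite -ge0_fin_numE ?vol_ge0//; exact: polyhedral_vol_fin.
- move=> s t; apply: sumr_ge0 => K _; rewrite mulr_ge0 ?dotvv_ge0//.
  by rewrite volumeE fine_ge0 ?vol_ge0.
- move=> t n t0 ti.
  apply: le_trans (sum_strip_energy (fe_grad phi a) b cell_part_cmeasurable
    cell_part_fin n ti) _.
  rewrite /fe_energy [leRHS]big_mkcond /=; apply: ler_sum => K _.
  have := volume_cell_part K; rewrite /cell_vol; case: ifP => KM le_part.
    by rewrite mulrC ler_wpM2r// dotvv_ge0.
  by rewrite mulr_ge0_le0// dotvv_ge0.
- move=> s t s0 st.
  exact: (level_decay uc cell_part_cmeasurable cell_part_trivIset uS uN0 cell_part_fin).
- by move=> t t0; apply: near_vertex_volume => //; exact: mlev.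
Qed.

Lemma sum_elts_cell_vol (w y : element -> R) :
  \sum_K (if K \in elts M then w K else 0) * cell_vol K * y K =
  \sum_(K in elts M) w K * volume (cell K) * y K.
Proof.
rewrite [RHS]big_mkcond /=; apply: eq_bigr => K _; rewrite /cell_vol.
by case: ifP => // _; rewrite mul0r mul0r.
Qed.

(** For [d = 2] the decay constant is [2 * 2 * 4 = 16], so [16 * c = 256]; and [C = 16 ^ 2] gives
    [1 + 4 * C = 1025]. *)
Lemma fe_weighted_critical (w : element -> R) (B : R) : d = 2%N ->
  (forall K, K \in elts M -> 0 <= w K <= B) ->
  0 < \sum_(K in elts M) w K * volume (cell K) ->
  \sum_(K in elts M) w K * volume (cell K) * fmax K ^+ 2 <=
  256 / ln 2 * (\sum_(K in elts M) w K * volume (cell K)) *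
  (ln (B * volume Omega / \sum_(K in elts M) w K * volume (cell K)) + 1025) *
  fe_energy.
Proof.
move=> d2 wB S0; have d_gt0 : (0 < d)%N by rewrite d2.
have [e [mV e0 eE decay vf]] := fe_iteration d_gt0.
(* The energy may vanish, whereas the iteration divides by it. *)
apply: le_mul_limit => E' EE'.
have E'0 : 0 < E' by exact: le_lt_trans fe_energy_ge0 EE'.
pose w' K := if K \in elts M then w K else 0.
have B0 : 0 <= B.
  have [K KM|noK] := pickP (mem (elts M)).
    by case/andP: (wB K KM); exact: le_trans.
  by move: S0; rewrite big_pred0 ?ltxx.
have w'B K : 0 <= w' K <= B.
  by rewrite /w'; case: ifP => [/wB//|_]; rewrite lexx.
have S1 (y : element -> R) := sum_elts_cell_vol w y.
have S2 : \sum_K w' K * cell_vol K = \sum_(K in elts M) w K * volume (cell K).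
  have := S1 (fun=> 1); under eq_bigr do rewrite mulr1; move=> ->.
  by under eq_bigr do rewrite mulr1.
have dR : d%:R = 2 :> R by rewrite d2.
have d16 : 16 ^+ d = 256 :> R by rewrite d2; ring.
have decay16 s t : 0 <= s -> s < t -> volume (level u t) * (t - s) ^+ 2 <=
    16 * volume (level u s) * e s t.
  move=> s0 st; apply: le_trans (decay s t s0 st) _.
  have m0 : 0 <= volume (level u s) by case/andP: (mV s s0).
  rewrite dR divff// powRr1 ?mulr_ge0//.
  by rewrite le_eqVlt; apply/orP; left; apply/eqP; ring.
have S0' : 0 < \sum_K w' K * cell_vol K by rewrite S2.
have c16 : 0 < (16 : R) by [].
have m0 t (t0 : 0 <= t) := (andP (mV t t0)).1.
have mO t (t0 : 0 <= t) := (andP (mV t t0)).2.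
have eE' (t : nat -> R) n (t0 : 0 <= t 0%N) (ti : forall k, t k < t k.+1) :=
  le_trans (eE t n t0 ti) (ltW EE').
have := critical_weighted m0 mO e0 eE' E'0 (exprn_ge0 _ (ler0n _ _)) cell_vol_ge0
  (fe_max_ge0 a) sum_cell_vol vf c16 decay16 w'B S0'.
rewrite S2 S1 => /le_trans; apply.
rewrite d16 (_ : 1 + 4 * 256 = 1025 :> R); last by ring.
by rewrite le_eqVlt; apply/orP; left; apply/eqP; ring.
Qed.

(** Here [th = 2 / d] is below 1 because [d > 2]; the conjugate exponents are [d / 2] for the weight
    and [d / (d - 2)] for the squared maxima. *)
Lemma fe_weighted_subcritical : (2 < d)%N -> forall w : element -> R,
  (forall K, K \in elts M -> 0 <= w K) ->
  \sum_(K in elts M) w K * volume (cell K) * fmax K ^+ 2 <=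
  subcritical_const (volume Omega) d *
  (\sum_(K in elts M) volume (cell K) * w K `^ (d%:R / 2)) `^ (2 / d%:R) *
  fe_energy.
Proof.
move=> d_gt2 w w0; have d_gt0 : (0 < d)%N by exact: ltn_trans d_gt2.
have [e [mV e0 eE decay vf]] := fe_iteration d_gt0.
apply: le_mul_limit => E' EE'.
have E'0 : 0 < E' by exact: le_lt_trans fe_energy_ge0 EE'.
pose w' K := if K \in elts M then w K else 0.
have w'0 K : 0 <= w' K by rewrite /w'; case: ifP => // /w0.
have d0 : 0 < (d%:R : R) by rewrite ltr0n.
pose th : R := 2 / d%:R.
have th0 : 0 < th by rewrite divr_gt0.
have th1 : th < 1 by rewrite ltr_pdivrMr// mul1r (ltr_nat R 2).
have m0 t (t0 : 0 <= t) := (andP (mV t t0)).1.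
have mO t (t0 : 0 <= t) := (andP (mV t t0)).2.
have eE' (t : nat -> R) n (t0 : 0 <= t 0%N) (ti : forall k, t k < t k.+1) :=
  le_trans (eE t n t0 ti) (ltW EE').
have decay' s t : 0 <= s -> s < t -> volume (level u t) * (t - s) ^+ 2 <=
    2 * d%:R * 4 `^ th * volume (level u s) `^ th * e s t.
  move=> s0 st; apply: le_trans (decay s t s0 st) _.
  by rewrite powRM ?m0// !mulrA.
have c0 : 0 <= 2 * d%:R * 4 `^ th :> R by rewrite !mulr_ge0 ?powR_ge0.
have mom := subcritical_moment m0 mO e0 eE' E'0 (exprn_ge0 _ (ler0n _ _)) cell_vol_ge0
  (fe_max_ge0 a) sum_cell_vol vf c0 (ltW th0) th1 erefl decay'.
have y0 K : 0 <= fmax K ^+ 2 / E' by rewrite divr_ge0 ?sqr_ge0// ltW.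
have hoel := sum_hoelder_young th0 th1 cell_vol_ge0 w'0 y0 mom.
have W : \sum_K cell_vol K * w' K `^ th^-1 =
    \sum_(K in elts M) volume (cell K) * w K `^ (d%:R / 2).
  rewrite [RHS]big_mkcond; apply: eq_bigr => K _; rewrite /cell_vol /w' invf_div.
  by case: ifP => // _; rewrite mul0r.
have X : \sum_(K in elts M) w K * volume (cell K) * fmax K ^+ 2 =
    (\sum_K w' K * cell_vol K * (fmax K ^+ 2 / E')) * E'.
  rewrite (sum_elts_cell_vol w (fun K => fmax K ^+ 2 / E')) mulr_suml.
  by apply: eq_bigr => K _; rewrite -!mulrA mulVf ?gt_eqF// mulr1.
rewrite X ler_pM2r//; move: hoel; rewrite W => /le_trans; apply.
by rewrite le_eqVlt; apply/orP; left; apply/eqP; rewrite /subcritical_const mulrC.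
Qed.

End sobolev.

(** * One space dimension: supremum and slope bounds *)

Section dimension_one.
Variables (R : realType).
Local Notation pt := 'cV[R]_1.
Local Notation T := (measurableTypeR R).

(** The measure on 1-tuples is the product of Lebesgue measure with the Dirac mass on the empty
    tuple. *)
Lemma vol_dim1 (A : set pt) : cmeasurable A ->
  measurable [set y : T | A (const_mx y)] /\
  vol A = lebesgue_measure [set y : T | A (const_mx y)].
Proof.
move=> mA.
have colE (y : R) (t : 0.-tuple T) : @col_of_tuple R 1 (tuple_cons (y, t)) = const_mx y.
  by apply/colP => i; rewrite !mxE (ord1 i).
have mA1 : measurable [set y : T | A (const_mx y)].
  apply: (@measurable_col_comp _ _ _ T (fun y : T => const_mx y)) => // i.
  by rewrite (_ : (fun _ => _) = id)//; apply/funext => y; rewrite mxE.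
split => //; rewrite /vol /= /lebesgue_cons /pushforward /product_measure1 /=.
rewrite -[X in lebesgue_measure X]setIT -integral_indic//; apply: eq_integral => y _ /=.
rewrite diracE /indic; congr (_%:R%:E); congr nat_of_bool.
apply/idP/idP; rewrite !inE /xsection /=; rewrite ?inE /= ?colE//.
Qed.

Variables (Omega : set pt) (M : mesh R 1).
Hypothesis poly : polyhedral_domain Omega.
Hypothesis tri : triangulation Omega M.
Variable phi : 'I_(nvi Omega M) -> pt -> R.
Hypothesis phi_hat : forall j, hat_function j (phi j).

Lemma dotv1 (x y : pt) : dotv x y = x ord0 ord0 * y ord0 ord0.
Proof. by rewrite dotvE big_ord1. Qed.

Lemma fe_vertex (a : 'I_(nvi Omega M) -> R) i : fe phi a (vtx i) = nodal a i.
Proof.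
have [_ _ /(_ i)[K KM iK] _ _] := tri.
have iE : vtx i = \sum_(k in K) (k == i)%:R *: vtx (m := M) k.
  rewrite (bigD1 i)//= eqxx scale1r big1 ?addr0// => j /andP[_ /negPf ->].
  by rewrite scale0r.
rewrite iE (fe_coord tri phi_hat)//; last first.
  by rewrite (bigD1 i)//= eqxx big1 ?addr0// => j /andP[_ /negPf ->].
by rewrite (bigD1 i)//= eqxx mul1r big1 ?addr0// => j /andP[_ /negPf ->]; rewrite mul0r.
Qed.

Lemma fe_sup (r : R) (a : 'I_(nvi Omega M) -> R) i :
  (forall x, Omega x -> forall k, `|x k ord0| <= r) ->
  nodal a i ^+ 2 <= (2 * r + 1) * fe_energy phi a.
Proof.
move=> Or; rewrite -fe_vertex; set u := fe phi a; set x := vtx i.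
have r0 : 0 <= r.
  by have [[y Oy] _ _] := poly; exact: le_trans (Or y Oy ord0).
have rE0 : 0 <= (2 * r + 1) * fe_energy phi a.
  by rewrite mulr_ge0 ?(fe_energy_ge0 tri)//; lra.
have [->|ux0] := eqVneq (u x) 0; first by rewrite expr0n.
have Ox : Omega x by exact: (fe_support poly tri phi_hat ux0).
have xr := Or x Ox ord0.
pose h : pt := const_mx (2 * r + 1).
have h0 : 0 < 2 * r + 1 by lra.
have uh : u (x + h) = 0.
  apply/eqP; apply: contraPT (Or (x + h)) => /(fe_support poly tri phi_hat) Oh.
  move=> /(_ Oh ord0); rewrite !mxE leNgt; apply/negP/negPn.
  move: xr; rewrite ler_norml => /andP[xr _].
  by rewrite ger0_norm; lra.
have [b bP] := fe_offset tri phi_hat a.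
have uc : continuous u := fe_continuous poly tri phi_hat (a := a).
have uS K y : cell_part K y -> u y = dotv (fe_grad phi a K) y + b K.
  by move=> yK; apply: bP; [exact: cell_part_elt yK|exact: cell_part_sub].
have uN0 y : u y != 0 -> exists K : {set 'I_(nvert M)}, cell_part K y.
  by move=> /(fe_support poly tri phi_hat)/(cell_part_cover tri).
have mpart := cell_part_cmeasurable tri.
have cross t : 0 < t -> t < `|u x| -> t ^+ 2 <= (2 * r + 1) * fe_energy phi a.
  move=> t0 tx.
  have := crossing_segment uc mpart (@cell_part_trivIset R 1 M) uS uN0 (lexx 0) t0 tx.
  move=> /(_ h); rewrite uh normr0 => /(_ (lexx 0)); rewrite subr0 => le1.
  rewrite -lee_fin; apply: (le_trans le1).
  apply: (@le_trans _ _ (\sum_K (dotv (fe_grad phi a K) h ^+ 2 *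
      ((2 * r + 1)^-1 * cell_vol K))%:E)%E).
    apply: lee_sum => K _; rewrite [in leRHS]EFinM; apply: lee_wpmul2l.
      by rewrite lee_fin sqr_ge0.
    rewrite /cell_vol; case: ifP => KM; last first.
      rewrite mulr0 (_ : [set _ | _] = set0) ?measure0//.
      by apply/seteqP; split => // y [_ [/cell_part_elt]]; rewrite KM.
    have mK := hull_cmeasurable (elt_nondegenerate tri KM).
    have [mK1 volK] := vol_dim1 mK.
    have := lebesgue_measure_affine (x ord0 ord0) (lt0r_neq0 h0) mK1.
    rewrite -volK -(fineK (cell_fin tri KM)) gtr0_norm// -EFinM => <-.
    apply: le_measure; rewrite ?inE.
    - have [+ _ _] := line_tonelli h (strip_cmeasurable (fe_grad phi a) b mpart K 0 t).
      by move=> /(_ (tuple_of_col x)); rewrite tuple_of_colK.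
    - have := measurable_affine (2 * r + 1) (x ord0 ord0) measurableT mK1.
      by rewrite setTI.
    - move=> y /= [_ [/cell_part_sub yK _]]; move: yK.
      by congr (cell K _); apply/colP => k; rewrite !mxE (ord1 k); ring.
  rewrite sumEFin lee_fin le_eqVlt; apply/orP; left; apply/eqP.
  rewrite /fe_energy [in RHS]big_mkcond mulr_sumr; apply: eq_bigr => K _.
  rewrite /cell_vol; case: ifP => KM; last by rewrite !mulr0.
  rewrite !dotv1 mxE; field; lra.
rewrite leNgt; apply/negP => lt_u.
have ux1 : 0 < `|u x| by rewrite normr_gt0.
rewrite -[u x ^+ 2]real_normK ?num_real// in lt_u.
set E := (2 * r + 1) * _ in rE0 cross lt_u.
have sq : Num.sqrt E < `|u x|.
  by rewrite -(@ltr_pXn2r _ 2)// ?nnegrE// ?sqrtr_ge0// sqr_sqrtr.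
have sqE := sqr_sqrtr rE0; have sq0 := sqrtr_ge0 E.
(* The crossing estimate needs [t] strictly below [|u x|]; the midpoint between [sqrt E] and [|u x|]
   already gives a contradiction. *)
have := cross ((Num.sqrt E + `|u x|) / 2).
have -> : 0 < (Num.sqrt E + `|u x|) / 2 by lra.
have -> : (Num.sqrt E + `|u x|) / 2 < `|u x| by lra.
move=> /(_ isT isT); nra.
Qed.

(** On [K] the values of [phi j] lie in [[0, 1]], and an affine function of slope [g] takes such
    values only on a set of length [1 / |g|]. *)
Lemma cell_slope_le K j : K \in elts M ->
  volume (cell K) * `|grad_on (cell K) (phi j) ord0 ord0| <= 1.
Proof.
move=> KM; set g := grad_on _ _; set g0 := g ord0 ord0.
have [->|gN0] := eqVneq g0 0; first by rewrite normr0 mulr0.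
have [b phib] := hat_grad tri phi_hat j KM.
have mK := hull_cmeasurable (elt_nondegenerate tri KM).
have [mK1 volK] := vol_dim1 mK.
have g_gt0 : 0 < `|g0| by rewrite normr_gt0.
have mI : measurable ([set` `[0%R, 1%R]] : set T) by exact: measurable_itv.
have := lebesgue_measure_affine b gN0 mI.
rewrite [lebesgue_measure [set` _]]lebesgue_measure_itv /= lte_fin ltr01 oppr0 adde0 mule1.
move=> lam1; rewrite -ler_pdivlMr// div1r -lee_fin.
rewrite volumeE fineK ?(cell_fin tri)// [vol _]volK -lam1.
apply: le_measure; rewrite ?inE//.
  by have := measurable_affine g0 b measurableT mI; rewrite setTI.
move=> y /= yK; have := hat_range tri phi_hat j KM yK.
by rewrite in_itv/= (phib _ yK) dotv1 mxE.
Qed.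

End dimension_one.

(** * Averaged diffusion matrices *)

Section null_sets.
Local Open Scope ereal_scope.
Import HBNNSimple.
Context d0 (T : measurableType d0) (R : realType) (mu : {measure set T -> \bar R}).

Let nnint (F : T -> \bar R) := ereal_sup [set sintegral mu h |
  h in [set h : {nnsfun T >-> R} | forall x, (h x)%:E <= F x]].

Let nnint_le (F G : T -> \bar R) (N : set T) : measurable N -> mu N = 0 ->
  (forall x, 0 <= G x) -> (forall x, ~ N x -> F x <= G x) -> nnint F <= nnint G.
Proof.
move=> mN N0 G0 FG; apply: ge_ereal_sup => _ [h hF <-].
pose h' := proj_nnsfun h (measurableC mN).
have h'E x : h' x = (h x * \1_(~` N) x)%R by [].
have -> : sintegral mu h = sintegral mu h'.
  rewrite -!integralT_nnsfun; apply: ge0_ae_eq_integral => //.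
  - exact/measurable_EFinP.
  - exact/measurable_EFinP.
  - by move=> x _; rewrite lee_fin.
  - by move=> x _; rewrite lee_fin.
  exists N; split => // x /= nE; apply: contrapT => Nx; apply: nE => _.
  by rewrite -[RHS]/(h' x)%:E h'E indicE mem_set// mulr1.
apply: ereal_sup_ubound; exists h' => // x /=.
have [Nx|Nx] := pselect (N x).
  by rewrite -[X in (X <= _)%E]/(h' x)%:E h'E indicE memNset ?mulr0 ?G0.
rewrite -[X in (X <= _)%E]/(h' x)%:E h'E indicE mem_set// mulr1.
exact: le_trans (hF x) (FG x Nx).
Qed.

(* [f] need not be measurable: the library integral is a difference of suprema
   over simple functions, each of which may be cut off on a null set. *)
Lemma integral_null_restrict (A B : set T) (f : T -> \bar R) :
  measurable A -> measurable B -> B `<=` A -> mu (A `\` B) = 0 ->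
  \int[mu]_(x in A) f x = \int[mu]_(x in B) f x.
Proof.
move=> mA mB BA N0; have mN : measurable (A `\` B) by exact: measurableD.
have eqf x : ~ (A `\` B) x -> (f \_ A) x = (f \_ B) x.
  move=> NAB; rewrite !patchE; have [Bx|nBx] := pselect (B x).
    by rewrite !mem_set//; exact: BA.
  rewrite [x \in B]memNset//; case: ifPn => //; rewrite inE => Ax.
  by exfalso; apply: NAB.
rewrite /integral -!/(nnint _); congr (_ - _); apply/eqP; rewrite eq_le;
  apply/andP; split; apply: (nnint_le mN N0) => x; rewrite ?funepos_ge0 ?funeneg_ge0//;
  by move=> /eqf; rewrite !(funeposE, funenegE) => ->.
Qed.

End null_sets.

Lemma Rintegral_sum d0 (T : measurableType d0) (R : realType)
    (mu : {measure set T -> \bar R}) (A : set T) (I : finType) (f : I -> T -> R) :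
  measurable A -> (forall i, mu.-integrable A (EFin \o f i)) ->
  (\int[mu]_(x in A) (\sum_i f i x))%R = \sum_i (\int[mu]_(x in A) f i x)%R.
Proof.
move=> mA If; have IfE i : mu.-integrable A (fun x => (f i x)%:E) by exact: If.
rewrite /Rintegral; under eq_integral do rewrite -sumEFin.
have Ifin i : (\int[mu]_(x in A) (f i x)%:E)%E \is a fin_num.
  exact: integrable_fin_num.
rewrite integral_sum//; under eq_bigr do rewrite -(fineK (Ifin _)).
by rewrite sumEFin.
Qed.

Section diffusion.
Variables (R : realType) (d : nat) (Omega : set 'cV[R]_d) (M : mesh R d).
Local Notation pt := 'cV[R]_d.
Local Notation p := (@vtx R d M).
Local Notation mu := (lebesgue_tuple R d).
Hypothesis poly : polyhedral_domain Omega.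
Hypothesis tri : triangulation Omega M.
Variables (D : pt -> 'M[R]_d) (dmin dmax : R).
Hypothesis diffD : diffusion_matrix Omega D dmin dmax.

Lemma dotv_mulmx (A : 'M[R]_d) (v w : pt) :
  dotv v (A *m w) = \sum_i \sum_j v i ord0 * w j ord0 * A i j.
Proof.
rewrite dotvE; apply: eq_bigr => i _; rewrite mxE mulr_sumr.
by apply: eq_bigr => j _; ring.
Qed.

(** Unit vectors bound the diagonal by [dmax]; the vectors [e i + e j] and [e i - e j] then give
    [2 |D_ij| <= D_ii + D_jj]. The bound makes the entries integrable. *)
Lemma diffusion_entry_bounded x i j : Omega x -> `|D x i j| <= dmax.
Proof.
have [_ _ _ /(_ x)DP] := diffD => /DP[[DT Dpos] _ [_ Dmax]].
have D_ge0 (v : pt) : 0 <= dotv v (D x *m v).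
  have [->|v0] := eqVneq v 0; last exact/ltW/Dpos.
  by rewrite mulmx0 dotv0.
have Dji : D x j i = D x i j by rewrite -[in LHS]DT mxE.
pose e k : pt := delta_mx k ord0.
have eE (B : 'M[R]_d) k l : dotv (e k) (B *m e l) = B k l.
  rewrite dotvE (bigD1 k)//= big1 ?addr0; last first.
    by move=> k' k'k; rewrite mxE (negPf k'k) mul0r.
  rewrite mxE !eqxx mul1r mxE (bigD1 l)//= big1 ?addr0; last first.
    by move=> l' l'l; rewrite mxE (negPf l'l) mulr0.
  by rewrite mxE !eqxx mulr1.
have diag k : D x k k <= dmax.
  by have := Dmax (e k); rewrite eE !mxE eqxx mulr1n subr_ge0.
have := D_ge0 (e i + e j); have := D_ge0 (e i + (-1) *: e j).
rewrite !mulmxDr -!scalemxAr !(dotvDl, dotvDr, dotvZl, dotvZr) !eE Dji.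
have := diag i; have := diag j.
rewrite ler_norml => *; apply/andP; split; lra.
Qed.

(** The pointwise bound by [dmin] is integrated, but it holds in [Omega] only, and the entries are
    measurable only up to null sets. The integrals are therefore first restricted to [B], the open
    cell without these null sets. *)
Lemma mean_diffusion_lower K (v : pt) : K \in elts M ->
  dmin * dotv v v <= dotv v (mean_diffusion D K *m v).
Proof.
move=> KM; have Knd := elt_nondegenerate tri KM.
have [_ _ Dm DP] := diffD.
have Nex (ij : 'I_d * 'I_d) : exists N : set (d.-tuple (measurableTypeR R)),
    [/\ measurable N, mu N = 0%E &
    measurable_fun (@col_of_tuple R d @^-1` (open_hull p K) `\` N)
      (fun t => D (col_of_tuple t) ij.1 ij.2)].
  have [h mh [N [mN N0 hN]]] := Dm ij.1 ij.2; exists N; split => //.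
  have mO : measurable (@col_of_tuple R d @^-1` Omega).
    exact: open_cmeasurable (polyhedral_open poly).
  apply: (@eq_measurable_fun _ _ _ _ _ h).
    move=> t; rewrite inE => -[/(open_cell_sub poly tri KM) Ot Nt].
    by apply/esym; apply: contrapT => Dh; apply: Nt; apply: hN => /= /(_ Ot).
  apply: measurable_funS mh => //.
  by move=> t [/(open_cell_sub poly tri KM) Ot _].
have [N NP] := choice Nex.
pose A := @col_of_tuple R d @^-1` cell K.
pose B := (@col_of_tuple R d @^-1` (open_hull p K)) `\` \bigcup_ij N ij.
have mO : measurable (@col_of_tuple R d @^-1` (open_hull p K)).
  exact: open_hull_cmeasurable Knd.
have mA : measurable A by exact: hull_cmeasurable Knd.
have mN : measurable (\bigcup_ij N ij).
  apply: fin_bigcup_measurable => [|ij _]; first exact: finite_finset.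
  by have [] := NP ij.
have mB : measurable B by exact: measurableD.
have BA : B `<=` A by move=> t [/open_hull_sub].
have Afin : mu A \is a fin_num by rewrite -[mu A]/(vol (cell K)); exact: (cell_fin tri KM).
have N0 : mu (\bigcup_ij N ij) = 0%E.
  apply/eqP; rewrite eq_le measure_ge0 andbT.
  apply: (@le_trans _ _ (\sum_ij mu (N ij))%E).
    apply: measure_le_sum => // ij; by have [] := NP ij.
  by rewrite big1// => ij _; have [] := NP ij.
have muB : mu B = mu A.
  rewrite [RHS](_ : _ = vol (open_hull p K)); last by rewrite (vol_open_hull Knd).
  rewrite /B measureD//; last first.
    by rewrite [X in (X < _)%E](vol_open_hull Knd) -ge0_fin_numE ?measure_ge0.
  rewrite -[RHS]sube0; congr (_ - _)%E.
  apply/eqP; rewrite eq_le measure_ge0 andbT -N0.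
  by apply: le_measure; rewrite ?inE//; exact: measurableI.
have AB0 : mu (A `\` B) = 0%E.
  transitivity (mu A - mu B)%E; last by rewrite muB subee.
  rewrite measureD//; last by rewrite -ge0_fin_numE ?measure_ge0.
  by rewrite setIC (setIidl BA).
have Boo : (mu B < +oo)%E by rewrite muB -ge0_fin_numE ?measure_ge0.
pose f ij t := D (col_of_tuple (t : d.-tuple (measurableTypeR R))) ij.1 ij.2.
have BO t : B t -> Omega (col_of_tuple t).
  by move=> [/(open_cell_sub poly tri KM)].
have fi ij : mu.-integrable B (EFin \o f ij).
  apply: measurable_bounded_integrable => //.
  - have [_ _] := NP ij; apply: measurable_funS.
      by apply: measurableD => //; have [] := NP ij.
    by move=> t [Ot Nt]; split => // Nij; apply: Nt; exists ij.
  exists dmax; split; first exact: num_real.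
  move=> c dc t Bt /=; apply: (le_trans _ (ltW dc)).
  by apply: diffusion_entry_bounded; exact: BO.
have intE i j : space_integral (cell K) (fun x => D x i j) =
    (\int[mu]_(t in B) f (i, j) t)%R.
  by rewrite /space_integral /Rintegral; congr fine; exact: integral_null_restrict.
have vol0 := cell_volume_gt0 tri KM.
have cfi ij : mu.-integrable B (EFin \o (fun t => v ij.1 ord0 * v ij.2 ord0 * f ij t)).
  have := integrableZl mB (v ij.1 ord0 * v ij.2 ord0) (fi ij).
  by apply: eq_integrable => // t _ /=; rewrite EFinM.
have -> : dotv v (mean_diffusion D K *m v) = (volume (cell K))^-1 *
    (\int[mu]_(t in B) (\sum_ij (v ij.1 ord0 * v ij.2 ord0 * f ij t)))%R.
  rewrite Rintegral_sum// dotv_mulmx pair_big /= mulr_sumr.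
  apply: eq_bigr => ij _; rewrite mxE intE RintegralZl//.
  by rewrite mulrCA.
rewrite ler_pdivlMl//.
have -> : volume (cell K) * (dmin * dotv v v) =
    (\int[mu]_(t in B) (dmin * dotv v v))%R.
  by rewrite Rintegral_cst// mulrC volumeE; congr (_ * fine _); rewrite -[LHS]/(mu A) -muB.
apply: le_Rintegral => //.
- apply: measurable_bounded_integrable => //.
  exact: bounded_cst.
- have -> : EFin \o (fun t => \sum_ij (v ij.1 ord0 * v ij.2 ord0 * f ij t)) =
      (fun t => \sum_ij (v ij.1 ord0 * v ij.2 ord0 * f ij t)%:E)%E.
    by apply/funext => t /=; rewrite sumEFin.
  by apply: (integrable_sum mB) => ij _; exact: cfi.
move=> t Bt; have [_ [_ Dmin] _] := DP _ (BO t Bt).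
have := Dmin v; rewrite mulmxBl mul_scalar_mx -scaleN1r dotvDr !dotvZr dotv_mulmx.
by rewrite mulN1r subr_ge0 pair_big /=.
Qed.

End diffusion.

(** * Condition numbers *)

Section finite_extrema.
Variables (R : realType) (I : finType) (P : {set I}) (f : I -> R).

Lemma le_max_over i : i \in P -> f i <= max_over P f.
Proof.
move=> iP; apply: ub_le_sup; last by exists i.
exists (\sum_j `|f j|) => _ [j _ <-]; apply: le_trans (ler_norm _) _.
by rewrite [leRHS](bigD1 j)//= lerDl sumr_ge0.
Qed.

Lemma min_over_attained i0 : i0 \in P ->
  exists2 i, i \in P & min_over P f = f i.
Proof.
move=> i0P; have [i iP imin] := arg_minP f i0P.
exists i => //; apply/le_anti/andP; split.
  apply: ge_inf; last by exists i.
  by exists (f i) => _ [j jP <-]; exact: imin.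
by apply: lb_le_inf; [exists (f i), i|move=> _ [j jP <-]; exact: imin].
Qed.

Lemma min_over_le i : i \in P -> min_over P f <= f i.
Proof.
move=> iP; apply: ge_inf; last by exists i.
exists (- \sum_j `|f j|) => _ [j _ <-]; rewrite lerNl.
apply: le_trans (ler_norm _) _; rewrite normrN.
by rewrite [leRHS](bigD1 j)//= lerDl sumr_ge0.
Qed.

End finite_extrema.

Section spectral.
Variables (R : realType) (n : nat).
Local Notation vec := 'cV[R]_n.
Implicit Types (A B : 'M[R]_n) (x y : vec).

Lemma norm2_ge0 x : 0 <= norm2 x. Proof. exact: sqrtr_ge0. Qed.

Lemma norm2_sqr x : norm2 x ^+ 2 = dotv x x.
Proof. by rewrite sqr_sqrtr// dotvv_ge0. Qed.

Let norm_set A := [set norm2 (A *m x) | x in [set x : vec | norm2 x = 1]].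

Let norm_set_ub A : has_ubound (norm_set A).
Proof.
(* The Frobenius norm, by Cauchy-Schwarz in each row. *)
exists (Num.sqrt (\sum_i \sum_j A i j ^+ 2)) => _ [x x1 <-].
rewrite /norm2 ler_wsqrtr// dotvE; apply: ler_sum => i _; rewrite -expr2.
pose a : vec := \col_j A i j.
have -> : (A *m x) i ord0 = dotv a x.
  by rewrite dotvE mxE; apply: eq_bigr => j _; rewrite mxE.
apply: le_trans (dotv_cs _ _) _; rewrite -(norm2_sqr x) x1 expr1n mulr1 dotvE.
by apply: ler_sum => j _; rewrite mxE.
Qed.

Lemma norm2_mulmx_le A x : norm2 x = 1 -> norm2 (A *m x) <= spectral_norm A.
Proof. by move=> x1; apply: ub_le_sup; [exact: norm_set_ub|exists x]. Qed.

Lemma spectral_norm_ge0 A : 0 <= spectral_norm A.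
Proof.
have [[y]|noset] := pselect (norm_set A !=set0).
  move=> /[dup] -[x x1 <-] yA; apply: le_trans (norm2_ge0 (A *m x)) _.
  exact: norm2_mulmx_le.
rewrite /spectral_norm (_ : [set _ | _ in _] = set0) ?sup0//.
by apply/seteqP; split => // y yA; exfalso; apply: noset; exists y.
Qed.

Lemma quadratic_spectral_norm A x : dotv x (A *m x) <= spectral_norm A * dotv x x.
Proof.
have [->|x0] := eqVneq x 0; first by rewrite mulmx0 !dotv0 mulr0.
have xx_neq0 : dotv x x != 0 by apply: contra_neq x0; exact: dotvv_eq0.
have nx0 : 0 < norm2 x by rewrite sqrtr_gt0 lt_neqAle eq_sym xx_neq0 dotvv_ge0.
pose y := (norm2 x)^-1 *: x.
have xy : x = norm2 x *: y by rewrite scalerA mulfV ?scale1r// gt_eqF.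
have yy : dotv y y = 1.
  by rewrite dotvZl dotvZr -norm2_sqr; field; rewrite gt_eqF.
have y1 : norm2 y = 1 by rewrite /norm2 yy sqrtr1.
have h : dotv y (A *m y) <= spectral_norm A.
  apply: le_trans (norm2_mulmx_le A y1).
  apply: le_trans (ler_norm _) _; rewrite -[leRHS]ger0_norm ?norm2_ge0//.
  rewrite -ler_sqr ?nnegrE// !real_normK ?num_real// norm2_sqr.
  by apply: le_trans (dotv_cs _ _) _; rewrite yy mul1r.
have -> : dotv x (A *m x) = norm2 x ^+ 2 * dotv y (A *m y).
  by rewrite {1 2}xy -scalemxAr dotvZl dotvZr mulrA expr2.
by rewrite -norm2_sqr mulrC ler_wpM2r// sqr_ge0.
Qed.

(* A matrix without eigenvalues has [kappa A = sup set0 / inf set0 = 0], so that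
   the spectral theorem is not needed. *)
Lemma kappa_le_eigenvalue A (lo hi : R) : 0 < lo -> 0 <= hi ->
  (forall a, eigenvalue A a -> lo <= a <= hi) -> kappa A <= hi / lo.
Proof.
move=> lo0 hi0 ev; rewrite /kappa /lambda_max /lambda_min.
have [->|/set0P ev0] := eqVneq [set a | eigenvalue A a] set0.
  by rewrite sup0 mul0r divr_ge0// ltW.
have lomin : lo <= inf [set a | eigenvalue A a].
  by apply: lb_le_inf => // a /ev/andP[].
have maxhi : sup [set a | eigenvalue A a] <= hi.
  by apply: ge_sup => // a /ev/andP[].
apply: (@le_trans _ _ (hi / inf [set a | eigenvalue A a])).
  by rewrite ler_wpM2r// invr_ge0 (le_trans (ltW lo0)).
by rewrite ler_wpM2l// lef_pV2// posrE (lt_le_trans lo0).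
Qed.

Lemma kappa_le A (lo hi : R) : 0 < lo -> 0 <= hi ->
  (forall x, lo * dotv x x <= dotv x (A *m x) <= hi * dotv x x) ->
  kappa A <= hi / lo.
Proof.
move=> lo0 hi0 Ax; apply: kappa_le_eigenvalue => // a /eigenvalueP[v vA v0].
have vv : 0 < dotv v^T v^T.
  rewrite lt_neqAle dotvv_ge0 andbT eq_sym; apply: contra_neq v0 => /dotvv_eq0.
  by move=> /(congr1 trmx); rewrite trmxK trmx0.
have E : dotv v^T (A *m v^T) = a * dotv v^T v^T.
  by rewrite /dotv trmxK mulmxA vA -scalemxAl mxE.
by have := Ax v^T; rewrite E !ler_pM2r.
Qed.

(** For an eigenvector [v] of [jacobi A], the substitution [v^T = S *m y] turns its Rayleigh
    quotient into that of the form of [A] relative to the diagonal of [A]. *)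
Lemma kappa_jacobi_le A (lo hi : R) : 0 < lo -> 0 <= hi ->
  (forall j, 0 < A j j) ->
  (forall x, lo * \sum_j A j j * x j ord0 ^+ 2 <= dotv x (A *m x) <=
             hi * \sum_j A j j * x j ord0 ^+ 2) ->
  kappa (jacobi A) <= hi / lo.
Proof.
move=> lo0 hi0 Ajj Ax; apply: kappa_le_eigenvalue => // a /eigenvalueP[v vA v0].
pose S := diag_mx (\row_j Num.sqrt (A j j)).
have SE j : S j j = Num.sqrt (A j j) by rewrite !mxE eqxx mulr1n.
have uS : S \in unitmx.
  rewrite unitmxE det_diag unitfE prodf_seq_neq0; apply/allP => j _ /=.
  by rewrite mxE gt_eqF// sqrtr_gt0.
have [y vE] : exists y, v^T = S *m y.
  by exists (invmx S *m v^T); rewrite mulmxA mulmxV// mul1mx.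
have vE' : v = y^T *m S by rewrite -[v]trmxK vE trmx_mul tr_diag_mx.
have E : v *m jacobi A *m v^T = y^T *m (A *m y).
  by rewrite /jacobi -/S {1}vE' vE !mulmxA mulmxK// mulmxKV.
have yA : dotv y (A *m y) = a * dotv v^T v^T.
  by rewrite /dotv trmxK -E vA -scalemxAl mxE.
have vv : dotv v^T v^T = \sum_j A j j * y j ord0 ^+ 2.
  rewrite dotvE vE; apply: eq_bigr => j _.
  rewrite mul_diag_mx !mxE -expr2 exprMn sqr_sqrtr ?ltW//.
have vv0 : 0 < dotv v^T v^T.
  rewrite lt_neqAle dotvv_ge0 andbT eq_sym; apply: contra_neq v0 => /dotvv_eq0.
  by move=> /(congr1 trmx); rewrite trmxK trmx0.
by have := Ax y; rewrite -vv yA !ler_pM2r.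
Qed.

(** The sum of the forms of [x j - y] is nonnegative; the choice of [y] as the mean of the [x j]
    gives the claim. *)
Lemma psd_quadratic_sum B (I : finType) (J : {set I}) (x : I -> vec) :
  (forall v, 0 <= dotv v (B *m v)) ->
  dotv (\sum_(j in J) x j) (B *m (\sum_(j in J) x j)) <=
  #|J|%:R * \sum_(j in J) dotv (x j) (B *m x j).
Proof.
move=> B0; set s := \sum_(j in J) x j.
have [J0|J_gt0] := posnP #|J|.
  rewrite /s big_pred0 ?mulmx0 ?dotv0 ?J0 ?mul0r// => j.
  by apply/negbTE/negP => jJ; have := card0_eq J0 j; rewrite inE jJ.
have m0 : 0 < (#|J|%:R : R) by rewrite ltr0n.
have var (y : vec) : 0 <= \sum_(j in J) dotv (x j) (B *m x j) - dotv y (B *m s) -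
    dotv s (B *m y) + #|J|%:R * dotv y (B *m y).
  have -> : dotv y (B *m s) = \sum_(j in J) dotv y (B *m x j).
    by rewrite mulmx_sumr dotv_sumr.
  have -> : dotv s (B *m y) = \sum_(j in J) dotv (x j) (B *m y).
    by rewrite dotvC dotv_sumr; apply: eq_bigr => j _; rewrite dotvC.
  rewrite mulr_natl -sumr_const -!sumrB -big_split /=; apply: sumr_ge0 => j _.
  have := B0 (x j + (-1) *: y).
  rewrite mulmxDr -scalemxAr !(dotvDl, dotvDr, dotvZl, dotvZr).
  by congr (0 <= _); ring.
have := var (#|J|%:R^-1 *: s).
rewrite -!scalemxAr !(dotvZl, dotvZr) => h.
rewrite -ler_pdivrMl// -subr_ge0; apply: le_trans h _.
by rewrite le_eqVlt; apply/orP; left; apply/eqP; field; rewrite gt_eqF.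
Qed.

End spectral.

(** The simplex contains a box of half-width [e] around an interior point [z]. A step of [e / 2]
    from [z] along coordinate [i], in the direction of increase, changes the function by
    [e / 2 * |g_i|], which is at most 1. *)
Lemma simplex_slope_bound (R : realType) (d : nat) (khat : 'I_d.+1 -> 'cV[R]_d) :
  nondegenerate_simplex khat [set: 'I_d.+1]%SET ->
  exists2 C : R, 0 < C & forall (g : 'cV[R]_d) (b : R),
    (forall x, simplex khat x -> 0 <= dotv g x + b <= 1) -> dotv g g <= C.
Proof.
move=> knd; have [z zk] := open_hull_neq0 knd.
have [e e0 ze] := nbhs_boxP (open_nbhs_nbhs (conj (open_open_hull knd) zk)).
have zE : hull khat [set: 'I_d.+1]%SET z by exact: open_hull_sub.
exists (d%:R * (2 / e) ^+ 2 + 1).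
  by rewrite ltr_wpDl// mulr_ge0// sqr_ge0.
move=> g b gb; apply: (@le_trans _ _ (\sum_(i < d) (2 / e) ^+ 2)); last first.
  by rewrite sumr_const card_ord -[leLHS]mulr_natl lerDl.
rewrite dotvE; apply: ler_sum => i _; rewrite -expr2.
pose y := z + (e / 2 * Num.sg (g i ord0)) *: delta_mx i ord0.
have e20 : 0 < e / 2 by rewrite divr_gt0.
have yk : simplex khat y.
  apply: open_hull_sub; apply: ze => k; rewrite !mxE addrAC subrr add0r.
  rewrite normrM normrM (gtr0_norm e20) normr_sg.
  apply: (@le_lt_trans _ _ (e / 2)); last by lra.
  by rewrite -mulrA ler_piMr ?(ltW e20)// normr_nat mulr_ile1 ?ler0n ?lern1 ?leq_b1.
have /andP[z0 _] := gb z zE; have /andP[_ y1] := gb y yk.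
have gy : dotv g y = dotv g z + e / 2 * `|g i ord0|.
  rewrite dotvDr dotvZr; congr (_ + _); rewrite -mulrA; congr (_ * _).
  rewrite dotvE (bigD1 i)//= mxE !eqxx mulr1 big1 ?addr0.
    by rewrite -normrEsg.
  by move=> k /negPf ki; rewrite mxE ki mulr0.
have ge : `|g i ord0| <= 2 / e.
  rewrite ler_pdivlMr// mulrC; move: y1; rewrite gy; lra.
by rewrite -real_normK ?num_real// ler_sqr ?nnegrE// divr_ge0// ltW.
Qed.

(** * Element contributions to the stiffness matrix *)

Section assembly.
Variables (R : realType) (d : nat) (Omega : set 'cV[R]_d) (M : mesh R d).
Local Notation pt := 'cV[R]_d.
Local Notation element := {set 'I_(nvert M)}.
Local Notation p := (@vtx R d M).
Hypothesis poly : polyhedral_domain Omega.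
Hypothesis tri : triangulation Omega M.
Variable phi : 'I_(nvi Omega M) -> pt -> R.
Hypothesis phi_hat : forall j, hat_function j (phi j).
Variables (D : pt -> 'M[R]_d) (dmin dmax : R).
Hypothesis diffD : diffusion_matrix Omega D dmin dmax.
Local Notation A := (stiffness D phi).

Let dmin_gt0 : 0 < dmin. Proof. by have [] := diffD. Qed.

Let DK_ge0 (K : element) v : K \in elts M -> 0 <= dotv v (mean_diffusion D K *m v).
Proof.
move=> KM; apply: le_trans (mean_diffusion_lower poly tri diffD v KM).
by rewrite mulr_ge0 ?dotvv_ge0// ltW.
Qed.

Definition local_diag (K : element) j : R := volume (cell K) *
  dotv (grad_on (cell K) (phi j)) (mean_diffusion D K *m grad_on (cell K) (phi j)).

Lemma local_diag_ge0 K j : K \in elts M -> 0 <= local_diag K j.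
Proof.
by move=> KM; rewrite mulr_ge0 ?DK_ge0// ltW// (cell_volume_gt0 tri).
Qed.

Lemma local_diag_notin K j : K \in elts M -> ivertex j \notin K -> local_diag K j = 0.
Proof.
by move=> KM jK; rewrite /local_diag (hat_notin tri phi_hat KM jK) mulmx0 dotv0 mulr0.
Qed.

Lemma stiffness_diagE j : A j j = \sum_(K in elts M) local_diag K j.
Proof. by rewrite mxE. Qed.

Lemma stiffness_quadratic (x : 'cV[R]_(nvi Omega M)) : dotv x (A *m x) =
  \sum_(K in elts M) volume (cell K) *
    dotv (fe_grad phi (fun j => x j ord0) K)
      (mean_diffusion D K *m fe_grad phi (fun j => x j ord0) K).
Proof.
transitivity (\sum_(K in elts M) \sum_i \sum_j x i ord0 * x j ord0 *
  (volume (cell K) * dotv (grad_on (cell K) (phi i))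
     (mean_diffusion D K *m grad_on (cell K) (phi j)))).
  rewrite dotv_mulmx [RHS]exchange_big /=; apply: eq_bigr => i _.
  rewrite [RHS]exchange_big /=; apply: eq_bigr => j _.
  by rewrite mxE mulr_sumr.
apply: eq_bigr => K _; rewrite /fe_grad dotv_suml mulr_sumr; apply: eq_bigr => i _.
rewrite mulmx_sumr dotv_sumr mulr_sumr; apply: eq_bigr => j _.
by rewrite -scalemxAr dotvZl dotvZr; ring.
Qed.

Lemma stiffness_lower (x : 'cV[R]_(nvi Omega M)) :
  dmin * fe_energy phi (fun j => x j ord0) <= dotv x (A *m x).
Proof.
rewrite stiffness_quadratic /fe_energy mulr_sumr; apply: ler_sum => K KM.
rewrite mulrCA ler_wpM2l//; first by rewrite ltW// (cell_volume_gt0 tri).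
exact: (mean_diffusion_lower poly tri diffD _ KM).
Qed.

Lemma card_patch (K : element) : K \in elts M ->
  (#|[set j : 'I_(nvi Omega M) | ivertex j \in K]%SET|%:R : R) <= d.+1%:R.
Proof.
move=> KM; rewrite ler_nat; have [<- _] := elt_nondegenerate tri KM.
rewrite -(card_imset _ (@enum_val_inj _ (mem (interior_vertices Omega M)))).
apply: subset_leq_card; apply/fintype.subsetP => v /imsetP[j + ->].
by rewrite inE.
Qed.

Lemma stiffness_upper (x : 'cV[R]_(nvi Omega M)) :
  dotv x (A *m x) <= d.+1%:R * \sum_j A j j * x j ord0 ^+ 2.
Proof.
have -> : \sum_j A j j * x j ord0 ^+ 2 =
    \sum_(K in elts M) \sum_j local_diag K j * x j ord0 ^+ 2.
  rewrite exchange_big /=; apply: eq_bigr => j _.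
  by rewrite stiffness_diagE mulr_suml.
rewrite stiffness_quadratic mulr_sumr; apply: ler_sum => K KM.
pose J := [set j : 'I_(nvi Omega M) | ivertex j \in K]%SET.
have sumJ (V : nmodType) (F : _ -> V) : (forall j, ivertex j \notin K -> F j = 0) ->
    \sum_j F j = \sum_(j in J) F j.
  move=> F0; rewrite [RHS]big_mkcond; apply: eq_bigr => j _.
  by rewrite inE; case: ifPn => // /F0.
rewrite (sumJ R); last by move=> j jK; rewrite local_diag_notin ?mul0r.
rewrite /fe_grad (sumJ pt); last by move=> j jK; rewrite (hat_notin tri phi_hat)// scaler0.
have vol0 : 0 <= volume (cell K) by rewrite ltW// (cell_volume_gt0 tri).
apply: le_trans (ler_wpM2l vol0 (psd_quadratic_sum _ _ (fun v => DK_ge0 v KM))) _.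
rewrite mulrCA; apply: ler_pM => //; last 2 first.
- exact: card_patch.
- rewrite mulr_sumr; apply: ler_sum => j _.
  by rewrite -scalemxAr dotvZl dotvZr /local_diag le_eqVlt; apply/orP; left; apply/eqP; ring.
by rewrite mulr_ge0//; apply: sumr_ge0 => j _; exact: DK_ge0.
Qed.

(** Exchanging the sums counts each element once for each of its interior vertices, at most [d.+1]
    times. *)
Lemma sum_patch (c : element -> 'I_(nvi Omega M) -> R) (e : element -> R) :
  (forall K j, K \in elts M -> ivertex j \in K -> c K j <= e K) ->
  (forall K, K \in elts M -> 0 <= e K) ->
  \sum_j \sum_(K in elts M | ivertex j \in K) c K j <=
  d.+1%:R * \sum_(K in elts M) e K.
Proof.
move=> ce e0; under eq_bigr do rewrite big_mkcondr.
rewrite exchange_big /= mulr_sumr; apply: ler_sum => K KM.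
rewrite -big_mkcond /=.
apply: (@le_trans _ _ (\sum_(j : 'I_(nvi Omega M) | ivertex j \in K) e K)).
  by apply: ler_sum => j jK; exact: ce.
rewrite (eq_bigl (mem [set j : 'I_(nvi Omega M) | ivertex j \in K]%SET)); last first.
  by move=> j; rewrite /= inE.
by rewrite sumr_const -[leLHS]mulr_natl ler_wpM2r ?e0//; exact: card_patch.
Qed.

Lemma sqnorm_le_sum_max (x : 'cV[R]_(nvi Omega M)) :
  dotv x x <= d.+1%:R * \sum_(K in elts M) fe_max (fun j => x j ord0) K ^+ 2.
Proof.
apply: le_trans (@sum_patch (fun K j => x j ord0 ^+ 2) _ _ _) => /=; first last.
- by move=> K _; exact: sqr_ge0.
- move=> K j KM jK; rewrite -real_normK ?num_real// ler_sqr ?nnegrE ?fe_max_ge0//.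
  by rewrite -[x j ord0](nodal_ivertex (fun j => x j ord0)) nodal_le_max.
rewrite dotvE; apply: ler_sum => j _; rewrite -expr2.
have [_ _ /(_ (ivertex j))[K KM jK] _ _] := tri.
by rewrite (bigD1 K) ?KM//= lerDl; apply: sumr_ge0 => L _; exact: sqr_ge0.
Qed.

Section weights.
Variable W : element -> R.
Hypothesis W_ge0 : forall K, K \in elts M -> 0 <= W K.
Hypothesis diagW : forall K j, K \in elts M -> local_diag K j <= W K.

Lemma diag_le_patch (j : 'I_(nvi Omega M)) : A j j <= \sum_(K in vertex_patch j) W K.
Proof.
rewrite stiffness_diagE (bigID (fun K : element => ivertex j \in K)) /=.
rewrite [X in _ + X]big1 ?addr0; last first.
  by move=> K /andP[KM jK]; exact: local_diag_notin.
rewrite [leRHS](eq_bigl (fun K => (K \in elts M) && (ivertex j \in K))); last first.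
  by move=> K; rewrite inE.
by apply: ler_sum => K /andP[KM _]; exact: diagW.
Qed.

Lemma diag_weighted_le (x : 'cV[R]_(nvi Omega M)) :
  \sum_j A j j * x j ord0 ^+ 2 <=
  d.+1%:R * \sum_(K in elts M) W K * fe_max (fun j => x j ord0) K ^+ 2.
Proof.
apply: le_trans (@sum_patch (fun K j => local_diag K j * x j ord0 ^+ 2) _ _ _) => /=; first last.
- by move=> K KM; rewrite mulr_ge0 ?W_ge0// sqr_ge0.
- move=> K j KM jK; apply: ler_pM; rewrite ?sqr_ge0 ?local_diag_ge0 ?diagW//.
  rewrite -real_normK ?num_real// ler_sqr ?nnegrE ?fe_max_ge0//.
  by rewrite -[x j ord0](nodal_ivertex (fun j => x j ord0)) nodal_le_max.
apply: ler_sum => j _; rewrite stiffness_diagE mulr_suml.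
rewrite (bigID (fun K : element => ivertex j \in K)) /= [X in _ + X]big1 ?addr0//.
by move=> K /andP[KM jK]; rewrite local_diag_notin ?mul0r.
Qed.

(** One factor [d.+1] stems from [stiffness_upper], the other from counting each element for all its
    vertices in [sqnorm_le_sum_max]. *)
Lemma kappa_stiffness_le (L H : R) : 0 < L ->
  (forall a, \sum_(K in elts M) fe_max a K ^+ 2 <= L * fe_energy phi a) ->
  (forall j : 'I_(nvi Omega M), \sum_(K in vertex_patch j) W K <= H) -> 0 <= H ->
  kappa A <= d.+1%:R ^+ 2 * H * L / dmin.
Proof.
move=> L0 maxL WH H0; have d1 : 0 < (d.+1%:R : R) by rewrite ltr0n.
have lo0 : 0 < dmin / (d.+1%:R * L) by rewrite divr_gt0// mulr_gt0.
have -> : d.+1%:R ^+ 2 * H * L / dmin = d.+1%:R * H / (dmin / (d.+1%:R * L)).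
  by field; rewrite !gt_eqF.
apply: kappa_le => //; first by rewrite mulr_ge0// ltW.
move=> x; apply/andP; split.
  apply: le_trans (stiffness_lower x); rewrite -mulrA ler_pM2l//.
  rewrite ler_pdivrMl ?mulr_gt0//; apply: (le_trans (sqnorm_le_sum_max x)).
  by rewrite -mulrA ler_pM2l.
apply: (le_trans (stiffness_upper x)); rewrite -mulrA ler_pM2l// dotvE mulr_sumr.
apply: ler_sum => j _; rewrite -expr2 ler_wpM2r ?sqr_ge0//.
exact: le_trans (diag_le_patch j) (WH j).
Qed.

(** Positivity comes from the embedding: the [j]th unit vector has norm 1, so its finite element
    function has positive maxima and thereby positive energy. *)
Lemma diag_gt0 (L : R) j : 0 < L ->
  (forall a, \sum_(K in elts M) fe_max a K ^+ 2 <= L * fe_energy phi a) ->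
  0 < A j j.
Proof.
move=> L0 maxL; pose x : 'cV[R]_(nvi Omega M) := delta_mx j ord0.
have d1 : 0 < (d.+1%:R : R) by rewrite ltr0n.
have xx : dotv x x = 1.
  rewrite dotvE (bigD1 j)//= big1 ?addr0; last first.
    by move=> k kj; rewrite mxE (negPf kj) mul0r.
  by rewrite mxE !eqxx mulr1.
have xA : d.+1%:R * \sum_k A k k * x k ord0 ^+ 2 = d.+1%:R * A j j.
  rewrite (bigD1 j)//= big1 ?addr0; last first.
    by move=> k kj; rewrite [x _ _]mxE (negPf kj) expr0n mulr0.
  by rewrite [x _ _]mxE !eqxx expr1n mulr1.
have := stiffness_upper x; rewrite xA => up.
rewrite -(pmulr_rgt0 _ d1); apply: lt_le_trans up; apply: lt_le_trans (stiffness_lower x).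
rewrite mulr_gt0// -(pmulr_rgt0 _ L0); apply: lt_le_trans (maxL _).
by rewrite -(pmulr_rgt0 _ d1); apply: lt_le_trans (sqnorm_le_sum_max x); rewrite xx.
Qed.

Lemma kappa_jacobi_stiffness_le (L : R) : 0 < L -> (forall j, 0 < A j j) ->
  (forall a, \sum_(K in elts M) W K * fe_max a K ^+ 2 <= L * fe_energy phi a) ->
  kappa (jacobi A) <= d.+1%:R ^+ 2 * L / dmin.
Proof.
move=> L0 A0 maxL; have d1 : 0 < (d.+1%:R : R) by rewrite ltr0n.
have lo0 : 0 < dmin / (d.+1%:R * L) by rewrite divr_gt0// mulr_gt0.
have -> : d.+1%:R ^+ 2 * L / dmin = d.+1%:R / (dmin / (d.+1%:R * L)).
  by field; rewrite !gt_eqF.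
apply: kappa_jacobi_le => //.
move=> x; apply/andP; split; last exact: stiffness_upper.
apply: le_trans (stiffness_lower x); rewrite -mulrA ler_pM2l//.
rewrite ler_pdivrMl ?mulr_gt0//; apply: (le_trans (diag_weighted_le x)).
by rewrite -mulrA ler_pM2l.
Qed.

End weights.

(** Pulled back to the reference simplex, [phi j] has gradient [gh] and still values in [[0, 1]], so
    [slope] bounds [gh] independently of the element; the matrix between the gradients becomes
    [reference_diffusion]. *)
Lemma local_diag_reference (khat : 'I_d.+1 -> pt) (C : R)
    (F' : element -> 'M[R]_d) (b : element -> pt) :
  (forall (g : pt) (c : R),
    (forall x, simplex khat x -> 0 <= dotv g x + c <= 1) -> dotv g g <= C) ->
  affine_maps (simplex khat) F' b -> forall K j, K \in elts M ->
  local_diag K j <= C * (volume (cell K) * spectral_norm (reference_diffusion D F' K)).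
Proof.
move=> slope Faff K j KM; have [Fsub _ Fsurj] := Faff K KM.
have Knd := elt_nondegenerate tri KM.
set B := F' K in Fsub Fsurj.
have dotvT (v w : pt) : dotv (B^T *m v) w = dotv v (B *m w).
  by rewrite /dotv trmx_mul trmxK mulmxA.
(* A [w] orthogonal to the range of [B] has constant product with all points of the cell, and a
   nondegenerate cell then forces [w = 0]. *)
have uB : B \in unitmx.
  rewrite -row_free_unit -kermx_eq0; apply/rowV0P => w /sub_kermxP wB.
  have wT : B^T *m w^T = 0 by rewrite -trmx_mul wB trmx0.
  apply: trmx_inj; rewrite trmx0.
  apply: (affine_with_inj Knd (f := fun=> 0)).
    exists (- dotv w^T (b K)) => y /Fsurj[x _ <-].
    by rewrite dotvDr -dotvT wT dotvC dotv0 add0r subrr.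
  by exists 0 => y _; rewrite dotvC dotv0 addr0.
pose g := grad_on (cell K) (phi j); pose gh := B^T *m g.
have [c gc] := hat_grad tri phi_hat j KM.
have ghC : dotv gh gh <= C.
  apply: (slope gh (dotv g (b K) + c)) => x xk.
  have yK : cell K (B *m x + b K) by apply: Fsub.
  rewrite dotvT addrA -dotvDr -(gc _ yK).
  exact: (hat_range tri phi_hat j KM yK).
have -> : local_diag K j = volume (cell K) * dotv gh (reference_diffusion D F' K *m gh).
  rewrite /local_diag -/g; congr (_ * _).
  rewrite dotvT /reference_diffusion -/B /gh; congr (dotv _ _).
  by rewrite !mulmxA mulmxV// mul1mx -!mulmxA (mulmxA (invmx B)^T) -trmx_mul mulmxV// trmx1 mul1mx.
have vol0 : 0 <= volume (cell K) by rewrite ltW// (cell_volume_gt0 tri).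
rewrite mulrCA ler_wpM2l//; apply: le_trans (quadratic_spectral_norm _ _) _.
by rewrite mulrC ler_wpM2r// spectral_norm_ge0.
Qed.

End assembly.

(** * Condition numbers for d at least 2 *)

Section final_bounds.
Variables (R : realType) (d : nat) (Omega : set 'cV[R]_d) (M : mesh R d).
Local Notation pt := 'cV[R]_d.
Local Notation element := {set 'I_(nvert M)}.
Hypothesis poly : polyhedral_domain Omega.
Hypothesis tri : triangulation Omega M.
Hypothesis nvi_gt0 : (0 < nvi Omega M)%N.
Local Notation N := ((nelts M)%:R : R).
Local Notation vol K := (volume (cell K)).
Local Notation avg := (avg_volume Omega M).

Lemma elts_neq0 : exists K, K \in elts M.
Proof.
by have [_ _ /(_ (ivertex (Ordinal nvi_gt0)))[K KM _] _ _] := tri; exists K.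
Qed.

Lemma nelts_gt0 : 0 < N.
Proof.
have [K KM] := elts_neq0; rewrite ltr0n /nelts card_gt0.
by apply/finset.set0Pn; exists K.
Qed.

Lemma avg_gt0 : 0 < avg.
Proof. by rewrite divr_gt0 ?nelts_gt0// (polyhedral_volume_gt0 poly). Qed.

Lemma min_vol_gt0 : 0 < min_over (elts M) (fun K => vol K).
Proof.
have [K0 K0M] := elts_neq0.
have [K KM ->] := min_over_attained (fun K => vol K) K0M.
exact: (cell_volume_gt0 tri KM).
Qed.

Lemma min_vol_le_avg : min_over (elts M) (fun K => vol K) <= avg.
Proof.
rewrite ler_pdivlMr ?nelts_gt0//; apply: le_trans (sum_cell_vol poly tri).
rewrite mulr_natr /nelts -sumr_const big_mkcond /=.
apply: ler_sum => K _; rewrite /cell_vol; case: ifP => // KM.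
exact: min_over_le.
Qed.

Variable phi : 'I_(nvi Omega M) -> pt -> R.
Hypothesis phi_hat : forall j, hat_function j (phi j).
Variables (D : pt -> 'M[R]_d) (dmin dmax : R).
Hypothesis diffD : diffusion_matrix Omega D dmin dmax.
Local Notation A := (stiffness D phi).

Let dmin_gt0 : 0 < dmin. Proof. by have [] := diffD. Qed.

Variables (khat : 'I_d.+1 -> pt) (C : R).
Variables (F' : element -> 'M[R]_d) (b : element -> pt).
Hypothesis C_gt0 : 0 < C.
Hypothesis slope : forall (g : pt) (c : R),
  (forall x, simplex khat x -> 0 <= dotv g x + c <= 1) -> dotv g g <= C.
Hypothesis Faff : affine_maps (simplex khat) F' b.
Local Notation nrm K := (spectral_norm (reference_diffusion D F' K)).

Let W K := C * (vol K * nrm K).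

Let vn_ge0 K : K \in elts M -> 0 <= vol K * nrm K.
Proof.
by move=> KM; rewrite mulr_ge0 ?spectral_norm_ge0// ltW// (cell_volume_gt0 tri).
Qed.

Let W_ge0 K : K \in elts M -> 0 <= W K.
Proof. by move=> KM; rewrite mulr_ge0 ?vn_ge0// ltW. Qed.

Let diagW K j : K \in elts M -> local_diag phi D K j <= W K.
Proof. by move=> KM; apply: (local_diag_reference tri phi_hat D slope Faff). Qed.

Let maxw := max_over [set: 'I_(nvi Omega M)]%SET
  (fun j : 'I_(nvi Omega M) => \sum_(K in vertex_patch j) vol K * nrm K).

Let patch_le (j : 'I_(nvi Omega M)) : \sum_(K in vertex_patch j) W K <= C * maxw.
Proof.
rewrite -mulr_sumr ler_wpM2l ?(ltW C_gt0)//.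
by apply: (le_max_over (fun j : 'I_(nvi Omega M) => \sum_(K in vertex_patch j) vol K * nrm K)); rewrite inE.
Qed.

Let maxw_ge0 : 0 <= maxw.
Proof.
rewrite -(pmulr_rge0 _ C_gt0); apply: le_trans (patch_le (Ordinal nvi_gt0)).
by apply: sumr_ge0 => K; rewrite inE => /andP[KM _]; exact: W_ge0.
Qed.

Let S := \sum_(K in elts M) vol K * nrm K.

(** Up to the factor [C], the sum dominates a positive diagonal entry of [A]. *)
Let S_gt0 (L : R) : 0 < L ->
  (forall a, \sum_(K in elts M) fe_max a K ^+ 2 <= L * fe_energy phi a) -> 0 < S.
Proof.
move=> L0 maxL.
have := diag_gt0 poly tri phi_hat diffD (Ordinal nvi_gt0) L0 maxL.
rewrite stiffness_diagE => A0; rewrite -(pmulr_rgt0 _ C_gt0) mulr_sumr.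
by apply: lt_le_trans A0 _; apply: ler_sum => K KM; exact: diagW.
Qed.

Let kappaA (L : R) : 0 < L ->
  (forall a, \sum_(K in elts M) fe_max a K ^+ 2 <= L * fe_energy phi a) ->
  kappa A <= d.+1%:R ^+ 2 * (C * maxw) * L / dmin.
Proof.
move=> L0 maxL; apply: (kappa_stiffness_le poly tri phi_hat diffD diagW L0 maxL patch_le).
by rewrite mulr_ge0// ltW.
Qed.

Let kappaJ (L L' : R) : 0 < L ->
  (forall a, \sum_(K in elts M) fe_max a K ^+ 2 <= L * fe_energy phi a) ->
  0 < L' ->
  (forall a, \sum_(K in elts M) nrm K * vol K * fe_max a K ^+ 2 <= L' * fe_energy phi a) ->
  kappa (jacobi A) <= d.+1%:R ^+ 2 * (C * L') / dmin.
Proof.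
move=> L0 maxL L'0 maxL'.
apply: (kappa_jacobi_stiffness_le poly tri phi_hat diffD W_ge0 diagW (mulr_gt0 C_gt0 L'0)).
  by move=> j; exact: (diag_gt0 poly tri phi_hat diffD j L0 maxL).
move=> a; rewrite -mulrA; apply: le_trans (ler_wpM2l (ltW C_gt0) (maxL' a)).
rewrite mulr_sumr le_eqVlt; apply/orP; left; apply/eqP; apply: eq_bigr => K _.
by rewrite /W; ring.
Qed.

Section dim2.
Hypothesis d2 : d = 2%N.

Let dR : d%:R = 2 :> R. Proof. by rewrite d2. Qed.
Let d1R : d.+1%:R = 3 :> R. Proof. by rewrite d2. Qed.
Variables k c : R.
Hypothesis k_gt0 : 0 < k.
Hypothesis c_ge1 : 1 <= c.
Hypothesis crit : forall a (w : element -> R) (B : R),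
  (forall K, K \in elts M -> 0 <= w K <= B) ->
  0 < \sum_(K in elts M) w K * vol K ->
  \sum_(K in elts M) w K * vol K * fe_max a K ^+ 2 <=
  k * (\sum_(K in elts M) w K * vol K) *
  (ln (B * volume Omega / \sum_(K in elts M) w K * vol K) + c) * fe_energy phi a.
Let lnr := ln (avg / min_over (elts M) (fun K => vol K)).
Let L := k * N * (lnr + c).

Let lnr_ge0 : 0 <= lnr.
Proof. by rewrite ln_ge0// ler_pdivlMr ?min_vol_gt0// mul1r min_vol_le_avg. Qed.

Let L_gt0 : 0 < L.
Proof.
rewrite !mulr_gt0 ?nelts_gt0//; apply: ltr_wpDl => //; exact: lt_le_trans c_ge1.
Qed.

(** The weights [1 / vol K] are bounded by the inverse of the smallest volume and have total mass
    [N]; the argument of the logarithm becomes the average volume over the smallest one. *)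
Let maxL a : \sum_(K in elts M) fe_max a K ^+ 2 <= L * fe_energy phi a.
Proof.
set B := min_over (elts M) (fun K => vol K).
have B_gt0 : 0 < B := min_vol_gt0.
have sumN : \sum_(K in elts M) (vol K)^-1 * vol K = N.
  rewrite (eq_bigr (fun=> 1)) ?sumr_const// => K KM.
  by rewrite mulVf// gt_eqF// (cell_volume_gt0 tri).
have wB K : K \in elts M -> 0 <= (vol K)^-1 <= B^-1.
  move=> KM; have vK := cell_volume_gt0 tri KM.
  by rewrite invr_ge0 (ltW vK) lef_pV2 ?posrE// min_over_le.
have S0 : 0 < \sum_(K in elts M) (vol K)^-1 * vol K by rewrite sumN nelts_gt0.
have := crit a wB S0.
rewrite sumN (_ : B^-1 * volume Omega / N = avg / B); last first.
  by rewrite /avg_volume; field; rewrite !gt_eqF// nelts_gt0.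
rewrite (eq_bigr (fun K => fe_max a K ^+ 2)) => [//|K KM].
by rewrite mulVf ?mul1r// gt_eqF// (cell_volume_gt0 tri).
Qed.

Lemma kappa_dim2 : kappa A <=
  (9 * C * k * c) * N `^ (2 / d%:R) *
  (N `^ (1 - 2 / d%:R) / dmin * maxw) * (1 + lnr).
Proof.
apply: (le_trans (kappaA L_gt0 maxL)).
rewrite d1R dR divff// subrr powRr0 powRr1 ?(ltW nelts_gt0)//.
have -> : 9 * C * k * c * N * (1 / dmin * maxw) * (1 + lnr) =
    3 ^+ 2 * (C * maxw) * (k * N * (c * (1 + lnr))) / dmin by field; rewrite gt_eqF.
rewrite ler_pM2r ?invr_gt0// ler_wpM2l//; last first.
  rewrite ler_pM2l ?mulr_gt0 ?nelts_gt0// mulrDr mulr1 addrC lerD2l.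
  by rewrite ler_peMl.
by rewrite !mulr_ge0// ltW.
Qed.

(** With the weights [nrm K] the logarithm is that of [B / S * volume Omega]; its domain part moves
    into the constant. The absolute value keeps the factor at least 1, whatever the size of
    [B / S]. *)
Lemma kappa_jacobi_dim2 : kappa (jacobi A) <=
  (9 * C * k * (c + 1 + `|ln (volume Omega)|)) * N `^ (2 / d%:R) *
  ((N * dmin `^ (d%:R / 2))^-1 *
     \sum_(K in elts M) vol K * nrm K `^ (d%:R / 2)) `^ (2 / d%:R) *
  (1 + `| ln (max_over (elts M) (fun K => nrm K) / S) |).
Proof.
have S0 := S_gt0 L_gt0 maxL.
set B := max_over (elts M) (fun K => nrm K).
have SE : \sum_(K in elts M) nrm K * vol K = S.
  by apply: eq_bigr => K _; rewrite mulrC.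
have wB K : K \in elts M -> 0 <= nrm K <= B.
  by move=> KM; rewrite spectral_norm_ge0 (le_max_over (fun K => nrm K)).
have V0 := polyhedral_volume_gt0 poly.
have B_gt0 : 0 < B.
  rewrite ltNge; apply/negP => B0; move: S0; rewrite -SE big1 ?ltxx// => K KM.
  have /andP[n0 nB] := wB K KM.
  by rewrite (_ : nrm K = 0) ?mul0r//; apply/le_anti; rewrite n0 (le_trans nB).
set T := 1 + `|ln (B / S)|.
have T1 : 1 <= T by rewrite lerDl.
pose L' := k * S * ((c + 1 + `|ln (volume Omega)|) * T).
have v0 := normr_ge0 (ln (volume Omega)).
have L'0 : 0 < L'.
  by rewrite !mulr_gt0//; [have := c_ge1; lra|exact: lt_le_trans T1].
have maxL' a : \sum_(K in elts M) nrm K * vol K * fe_max a K ^+ 2 <= L' * fe_energy phi a.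
  have := crit a wB; rewrite SE => /(_ S0).
  move=> /le_trans; apply; apply: ler_wpM2r; first exact: fe_energy_ge0 tri _ _.
  rewrite -/k ler_pM2l ?mulr_gt0//.
  rewrite (_ : B * volume Omega / S = B / S * volume Omega); last by ring.
  rewrite lnM ?posrE ?divr_gt0//.
  have := ler_norm (ln (B / S)); have := ler_norm (ln (volume Omega)).
  rewrite /T; have := normr_ge0 (ln (B / S)); have := c_ge1; nra.
apply: (le_trans (kappaJ L_gt0 maxL L'0 maxL')).
have N0 := nelts_gt0; rewrite d1R dR divff//.
rewrite (eq_bigr (fun K => vol K * nrm K)); last first.
  by move=> K _; rewrite powRr1// spectral_norm_ge0.
rewrite -/S (powRr1 (ltW dmin_gt0)) (powRr1 (ltW N0)) powRr1; last first.
  by rewrite mulr_ge0 ?invr_ge0 ?mulr_ge0 ?(ltW S0) ?(ltW N0) ?(ltW dmin_gt0).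
rewrite /L' le_eqVlt; apply/orP; left; apply/eqP; field.
by rewrite !gt_eqF.
Qed.

End dim2.

Section dim3.
Hypothesis d3 : (2 < d)%N.

Let d_gt0 : 0 < (d%:R : R). Proof. by rewrite ltr0n (ltn_trans _ d3). Qed.
Variable k : R.
Hypothesis k_gt0 : 0 < k.
Hypothesis subcrit : forall a (w : element -> R),
  (forall K, K \in elts M -> 0 <= w K) ->
  \sum_(K in elts M) w K * vol K * fe_max a K ^+ 2 <=
  k * (\sum_(K in elts M) vol K * w K `^ (d%:R / 2)) `^ (2 / d%:R) *
  fe_energy phi a.

Let ratio (K : element) := avg / vol K.
Let Rsum := \sum_(K in elts M) ratio K `^ ((d%:R - 2) / 2).
(** The weights [1 / vol K] produce a sum of [1 - d / 2] powers of the volumes. Extracting the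
    powers of [avg = volume Omega / N] leaves [N] times a mean of ratios and a negative power of
    [volume Omega]. *)
Let L := k * (volume Omega `^ (1 - 2 / d%:R))^-1 * N * (N^-1 * Rsum) `^ (2 / d%:R).

Let Rsum_gt0 : 0 < Rsum.
Proof.
have [K KM] := elts_neq0; rewrite /Rsum (bigD1 K)//= ltr_wpDr//.
  by apply: sumr_ge0 => *; exact: powR_ge0.
by rewrite powR_gt0// divr_gt0 ?avg_gt0// (cell_volume_gt0 tri).
Qed.

Let L_gt0 : 0 < L.
Proof.
have V0 := polyhedral_volume_gt0 poly; have N0 := nelts_gt0.
by rewrite !mulr_gt0 ?invr_gt0 ?powR_gt0 ?mulr_gt0 ?invr_gt0.
Qed.

Let maxL a : \sum_(K in elts M) fe_max a K ^+ 2 <= L * fe_energy phi a.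
Proof.
have V0 := polyhedral_volume_gt0 poly; have N0 := nelts_gt0; have a0 := avg_gt0.
have w0 K : K \in elts M -> 0 <= (vol K)^-1.
  by move=> KM; rewrite invr_ge0 ltW// (cell_volume_gt0 tri).
have := subcrit a w0.
rewrite (eq_bigr (fun K => fe_max a K ^+ 2)); last first.
  by move=> K KM; rewrite mulVf ?mul1r// gt_eqF// (cell_volume_gt0 tri).
congr (_ <= _ * _); rewrite /L -!mulrA; congr (_ * _).
have -> : \sum_(K in elts M) vol K * (vol K)^-1 `^ (d%:R / 2) =
    (avg `^ ((d%:R - 2) / 2))^-1 * Rsum.
  rewrite /Rsum mulr_sumr; apply: eq_bigr => K KM.
  have vK := cell_volume_gt0 tri KM.
  rewrite /ratio powRM ?invr_ge0 ?(ltW a0) ?(ltW vK)// mulrA mulVf ?mul1r; last first.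
    by rewrite gt_eqF// powR_gt0.
  rewrite (_ : d%:R / 2 = (d%:R - 2) / 2 + 1); last by field.
  have vi : 0 < (vol K)^-1 by rewrite invr_gt0.
  rewrite powRD; last by rewrite (gt_eqF vi) implybT.
  by rewrite powRr1 ?invr_ge0 ?(ltW vK)// mulrCA mulfV ?mulr1// gt_eqF.
have e1 : (d%:R - 2) / 2 * (2 / d%:R) = 1 - 2 / d%:R :> R by field; rewrite gt_eqF.
rewrite powRM ?invr_ge0 ?powR_ge0 ?(ltW Rsum_gt0)//.
rewrite -[(avg `^ _)^-1]powRN -powRrM mulNr e1 powRN.
have NV q : N^-1 `^ q = (N `^ q)^-1.
  by rewrite -[N^-1]powR_inv1 ?(ltW N0)// -powRrM mulN1r powRN.
have NE : N = N `^ (1 - 2 / d%:R) * N `^ (2 / d%:R).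
  by rewrite -powRD ?(gt_eqF N0) ?implybT// subrK powRr1// ltW.
rewrite [avg `^ _]powRM ?invr_ge0 ?(ltW V0) ?(ltW N0)// [(_ * Rsum) `^ _]powRM ?invr_ge0 ?(ltW N0) ?(ltW Rsum_gt0)//.
rewrite !NV [X in _ * (X * _)]NE; field.
by rewrite !gt_eqF// powR_gt0.
Qed.

Lemma kappa_dim3 : kappa A <=
  (d.+1%:R ^+ 2 * C * (k * (volume Omega `^ (1 - 2 / d%:R))^-1)) * N `^ (2 / d%:R) *
  (N `^ (1 - 2 / d%:R) / dmin * maxw) *
  (N^-1 * Rsum) `^ (2 / d%:R).
Proof.
have N0 := nelts_gt0.
apply: (le_trans (kappaA L_gt0 maxL)).
have NE : N = N `^ (2 / d%:R) * N `^ (1 - 2 / d%:R).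
  by rewrite -powRD ?(gt_eqF N0) ?implybT// subrKC powRr1// ltW.
rewrite /L [X in _ * X * _ `^ _]NE le_eqVlt; apply/orP; left; apply/eqP; ring.
Qed.

Lemma kappa_jacobi_dim3 : kappa (jacobi A) <=
  (d.+1%:R ^+ 2 * C * k) * N `^ (2 / d%:R) *
  ((N * dmin `^ (d%:R / 2))^-1 *
     \sum_(K in elts M) vol K * nrm K `^ (d%:R / 2)) `^ (2 / d%:R).
Proof.
have N0 := nelts_gt0; have S0 := S_gt0 L_gt0 maxL.
set P := \sum_(K in elts M) _.
have P_gt0 : 0 < P.
  have [K KM n0] : exists2 K, K \in elts M & 0 < nrm K.
    apply: contrapT => noK; move: S0; rewrite /S big1 ?ltxx// => K KM.
    rewrite (_ : nrm K = 0) ?mulr0//; apply/le_anti; rewrite spectral_norm_ge0 andbT.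
    by rewrite leNgt; apply/negP => n0; apply: noK; exists K.
  rewrite /P (bigD1 K)//= ltr_wpDr//.
    apply: sumr_ge0 => K' /andP[KM' _].
    by rewrite mulr_ge0 ?powR_ge0// ltW// (cell_volume_gt0 tri).
  by rewrite mulr_gt0 ?powR_gt0// (cell_volume_gt0 tri).
have L'0 : 0 < k * P `^ (2 / d%:R) by rewrite mulr_gt0// powR_gt0.
apply: (le_trans (kappaJ L_gt0 maxL L'0 _)).
  move=> a; apply: subcrit.
  by move=> K _; exact: spectral_norm_ge0.
have e1 : d%:R / 2 * (2 / d%:R) = 1 :> R by field; rewrite gt_eqF.
rewrite powRM ?invr_ge0 ?mulr_ge0 ?powR_ge0 ?(ltW N0) ?(ltW P_gt0)//.
rewrite invfM powRM ?invr_ge0 ?powR_ge0 ?(ltW N0)//.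
rewrite -[(dmin `^ _)^-1]powRN -powRrM mulNr e1 powRN powRr1 ?(ltW dmin_gt0)//.
rewrite -[N^-1]powR_inv1 ?(ltW N0)// -powRrM mulN1r powRN.
rewrite le_eqVlt; apply/orP; left; apply/eqP; field.
by rewrite !gt_eqF// powR_gt0.
Qed.

End dim3.

End final_bounds.

(** * Condition numbers for d = 1 *)

Section dim1.
Variables (R : realType) (Omega : set 'cV[R]_1) (M : mesh R 1).
Local Notation pt := 'cV[R]_1.
Local Notation element := {set 'I_(nvert M)}.
Hypothesis poly : polyhedral_domain Omega.
Hypothesis tri : triangulation Omega M.
Hypothesis nvi_gt0 : (0 < nvi Omega M)%N.
Local Notation N := ((nelts M)%:R : R).
Local Notation vol K := (volume (cell K)).
Local Notation avg := (avg_volume Omega M).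
Variable phi : 'I_(nvi Omega M) -> pt -> R.
Hypothesis phi_hat : forall j, hat_function j (phi j).
Variables (D : pt -> 'M[R]_1) (dmin dmax : R).
Hypothesis diffD : diffusion_matrix Omega D dmin dmax.
Variable r : R.
Hypothesis Or : forall x, Omega x -> forall i, `|x i ord0| <= r.
Variable i0 : 'I_1.
Local Notation A := (stiffness D phi).
Local Notation D1 K := (mean_diffusion D K i0 i0).

Let dmin_gt0 : 0 < dmin. Proof. by have [] := diffD. Qed.
Let N0 : 0 < N. Proof. exact: nelts_gt0 tri nvi_gt0. Qed.
Let V0 : 0 < volume Omega. Proof. exact: polyhedral_volume_gt0. Qed.
Let a0 : 0 < avg. Proof. exact: avg_gt0. Qed.
Let r0 : 0 < 2 * r + 1.
Proof.
have [[y Oy] _ _] := poly; have := le_trans (normr_ge0 _) (Or Oy i0); lra.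
Qed.

Let D1_gt0 (K : element) : K \in elts M -> 0 < D1 K.
Proof.
move=> KM; have := mean_diffusion_lower poly tri diffD (const_mx 1) KM.
rewrite !dotv1 !mxE big_ord1 !mxE !mulr1 !mul1r (ord1 i0).
exact: lt_le_trans.
Qed.

(** Slopes of nodal functions on [K] are at most [1 / vol K], so this dominates the local diagonal
    entries without passing through the reference simplex. *)
Let W (K : element) := D1 K / vol K.

Let W_gt0 (K : element) : K \in elts M -> 0 < W K.
Proof. by move=> KM; rewrite divr_gt0 ?D1_gt0// (cell_volume_gt0 tri KM). Qed.

Let W_ge0 (K : element) : K \in elts M -> 0 <= W K.
Proof. by move=> /W_gt0/ltW. Qed.

Let diagW (K : element) j : K \in elts M -> local_diag phi D K j <= W K.
Proof.
move=> KM; have vK := cell_volume_gt0 tri KM.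
have := cell_slope_le tri phi_hat j KM.
have i00 : i0 = ord0 := ord1 i0.
rewrite /local_diag /W !dotv1 mxE big_ord1 -i00.
set g := grad_on _ _ _ _ => slope.
rewrite ler_pdivlMr// -[leRHS]mulr1.
have -> : vol K * (g * (D1 K * g)) * vol K = D1 K * (vol K * `|g|) ^+ 2.
  by rewrite exprMn real_normK ?num_real//; ring.
rewrite ler_pM2l ?D1_gt0// expr_le1//.
by rewrite mulr_ge0// ltW.
Qed.

Let maxE a K : K \in elts M -> fe_max a K ^+ 2 <= (2 * r + 1) * fe_energy phi a.
Proof.
move=> KM; have [m0|m0] := ltP 0 (fe_max a K).
  have [i iK ->] := fe_max_attained m0; rewrite real_normK ?num_real//.
  exact: (fe_sup poly tri phi_hat).
have -> : fe_max a K = 0 by apply/le_anti; rewrite m0 fe_max_ge0.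
by rewrite expr0n mulr_ge0 ?(fe_energy_ge0 tri)// ltW.
Qed.

Let L := N * (2 * r + 1).
Let L0 : 0 < L. Proof. by rewrite mulr_gt0. Qed.

Let maxL a : \sum_(K in elts M) fe_max a K ^+ 2 <= L * fe_energy phi a.
Proof.
apply: (@le_trans _ _ (\sum_(K in elts M) (2 * r + 1) * fe_energy phi a)).
  by apply: ler_sum => K KM; exact: maxE.
by rewrite sumr_const /L -mulrA -[leLHS]mulr_natl.
Qed.

Let WE (K : element) : W K = avg^-1 * (D1 K * (avg / vol K)).
Proof. by rewrite /W [RHS]mulrCA mulKf// gt_eqF. Qed.

(** The 4 is [d.+1 ^ 2]; one factor [N] counts the elements in [L], the other comes from
    [1 / avg = N / volume Omega]. *)
Lemma kappa_dim1 : kappa A <= (4 * (2 * r + 1) / volume Omega) * N ^+ 2 *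
  (dmin^-1 * max_over [set: 'I_(nvi Omega M)]%SET
     (fun j => \sum_(K in vertex_patch j) D1 K * (avg / vol K))).
Proof.
set mx := max_over _ _.
have patch_le (j : 'I_(nvi Omega M)) : \sum_(K in vertex_patch j) W K <= avg^-1 * mx.
  under eq_bigr do rewrite WE.
  rewrite -mulr_sumr ler_wpM2l ?invr_ge0 ?(ltW a0)//.
  apply: (le_max_over (fun j : 'I_(nvi Omega M) =>
    \sum_(K in vertex_patch j) D1 K * (avg / vol K))).
  by rewrite inE.
have H0 : 0 <= avg^-1 * mx.
  apply: le_trans (patch_le (Ordinal nvi_gt0)).
  by apply: sumr_ge0 => K; rewrite inE => /andP[KM _]; exact: W_ge0.
apply: (le_trans (kappa_stiffness_le poly tri phi_hat diffD diagW L0 maxL patch_le H0)).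
rewrite /L /avg_volume le_eqVlt; apply/orP; left; apply/eqP; field.
by rewrite !gt_eqF.
Qed.

Lemma kappa_jacobi_dim1 : kappa (jacobi A) <=
  (4 * (2 * r + 1) / volume Omega) * N ^+ 2 *
  ((N * dmin)^-1 * \sum_(K in elts M) D1 K * (avg / vol K)).
Proof.
set X := \sum_(K in elts M) D1 K * (avg / vol K).
have WX : \sum_(K in elts M) W K = avg^-1 * X.
  by rewrite mulr_sumr; apply: eq_bigr => K _; exact: WE.
have X0 : 0 < avg^-1 * X.
  have [K KM] := elts_neq0 tri nvi_gt0.
  rewrite -WX (bigD1 K)//= ltr_wpDr ?W_gt0//.
  by apply: sumr_ge0 => K' /andP[KM' _]; exact: W_ge0.
have L'0 : 0 < (2 * r + 1) * (avg^-1 * X) by rewrite mulr_gt0.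
have maxL' a : \sum_(K in elts M) W K * fe_max a K ^+ 2 <=
    (2 * r + 1) * (avg^-1 * X) * fe_energy phi a.
  rewrite -WX mulrAC mulr_sumr; apply: ler_sum => K KM.
  by rewrite mulrC ler_wpM2r ?W_ge0//; exact: maxE.
have A0 j := diag_gt0 poly tri phi_hat diffD j L0 maxL.
apply: (le_trans (kappa_jacobi_stiffness_le poly tri phi_hat diffD W_ge0 diagW L'0 A0 maxL')).
rewrite /avg_volume le_eqVlt; apply/orP; left; apply/eqP; field.
by rewrite !gt_eqF.
Qed.

End dim1.

(** The constants are quantified before the mesh and kept abstract, which shows their uniformity and
    hides the numerals from later computations. *)
Lemma critical_consts (R : realType) (d : nat) (Omega : set 'cV[R]_d) :
  polyhedral_domain Omega -> d = 2%N ->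
  exists k c : R, [/\ 0 < k, 1 <= c &
    forall (M : mesh R d) (phi : 'I_(nvi Omega M) -> 'cV[R]_d -> R),
      triangulation Omega M -> (forall j, hat_function j (phi j)) ->
      forall a (w : {set 'I_(nvert M)} -> R) (B : R),
      (forall K, K \in elts M -> 0 <= w K <= B) ->
      0 < \sum_(K in elts M) w K * volume (cell K) ->
      \sum_(K in elts M) w K * volume (cell K) * fe_max a K ^+ 2 <=
      k * (\sum_(K in elts M) w K * volume (cell K)) *
      (ln (B * volume Omega / \sum_(K in elts M) w K * volume (cell K)) + c) *
      fe_energy phi a].
Proof.
move=> poly d2; exists (256 / ln 2), 1025; split.
- by apply: divr_gt0; [rewrite ltr0n|rewrite ln_gt0// ltr1n].
- by rewrite ler1n.
- move=> M phi tri phi_hat a w B wB S0.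
  exact: (fe_weighted_critical poly tri phi_hat a d2 wB S0).
Qed.

Theorem theorem5p2 (R : realType) (d : nat) (d_gt0 : (0 < d)%N)
    (Omega : set 'cV[R]_d)
    (Omega_polyhedral : polyhedral_domain Omega)
    (Omega_sc : simply_connected Omega)
    (khat : 'I_d.+1 -> 'cV[R]_d)
    (khat_simplex : nondegenerate_simplex khat [set: 'I_d.+1]%SET)
    (khat_volume : volume (simplex khat) = 1) :
  exists2 C : R, 0 < C &
  forall (D : 'cV[R]_d -> 'M[R]_d) (dmin dmax : R)
         (M : mesh R d)
         (F' : {set 'I_(nvert M)} -> 'M[R]_d)
         (b : {set 'I_(nvert M)} -> 'cV[R]_d)
         (phi : 'I_(nvi Omega M) -> 'cV[R]_d -> R),
    diffusion_matrix Omega D dmin dmax ->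
    triangulation Omega M ->
    (0 < nvi Omega M)%N ->
    affine_maps (simplex khat) F' b ->
    (forall j, hat_function j (phi j)) ->
  let A := stiffness D phi in
  let N : R := (nelts M)%:R in
  let vol (K : {set 'I_(nvert M)}) := volume (cell K) in
  let avg := avg_volume Omega M in
  let ratio (K : {set 'I_(nvert M)}) := avg / vol K in
  let D1 (K : {set 'I_(nvert M)}) :=
    mean_diffusion D K (Ordinal d_gt0) (Ordinal d_gt0) in
  let nrm (K : {set 'I_(nvert M)}) :=
    spectral_norm (reference_diffusion D F' K) in
  let dR : R := d%:R in
  [/\ d = 1%N ->
        kappa A <= C * N ^+ 2 *
          (dmin^-1 * max_over [set: 'I_(nvi Omega M)]%SET
                       (fun j => \sum_(K in vertex_patch j) D1 K * ratio K)),
      (2 <= d)%N ->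
        kappa A <= C * N `^ (2 / dR) *
          (N `^ (1 - 2 / dR) / dmin *
             max_over [set: 'I_(nvi Omega M)]%SET
               (fun j => \sum_(K in vertex_patch j) vol K * nrm K)) *
          (if d == 2%N then 1 + ln (avg / min_over (elts M) vol)
           else (N^-1 * \sum_(K in elts M) ratio K `^ ((dR - 2) / 2))
                  `^ (2 / dR)),
      d = 1%N ->
        kappa (jacobi A) <= C * N ^+ 2 *
          ((N * dmin)^-1 * \sum_(K in elts M) D1 K * ratio K) &
      (2 <= d)%N ->
        kappa (jacobi A) <= C * N `^ (2 / dR) *
          ((N * dmin `^ (dR / 2))^-1 *
             \sum_(K in elts M) vol K * nrm K `^ (dR / 2)) `^ (2 / dR) *
          (if d == 2%N then
             1 + `| ln (max_over (elts M) nrm /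
                        \sum_(K in elts M) vol K * nrm K) |
           else 1)].
Proof.
have V0 := polyhedral_volume_gt0 Omega_polyhedral.
have [r Or] := polyhedral_bounded Omega_polyhedral.
have [Ch Ch0 slope] := simplex_slope_bound khat_simplex.
have [d1|d1] := eqVneq d 1%N.
  subst d.
  have r0 : 0 < 2 * r + 1.
    have [[y Oy] _ _] := Omega_polyhedral.
    have := le_trans (normr_ge0 _) (Or y Oy ord0); lra.
  exists (4 * (2 * r + 1) / volume Omega).
    by apply: divr_gt0 => //; apply: mulr_gt0 => //; rewrite ltr0n.
  move=> D dmin dmax M F' b phi diffD tri nv Faff phi_hat; split => // _.
  - exact: (kappa_dim1 Omega_polyhedral tri nv phi_hat diffD Or).
  - exact: (kappa_jacobi_dim1 Omega_polyhedral tri nv phi_hat diffD Or).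
have [d2|d2] := eqVneq d 2%N.
  have [k [c [k0 c1 crit]]] := critical_consts Omega_polyhedral d2.
  have v0 := normr_ge0 (ln (volume Omega)).
  (* One constant has to serve both parts; the Jacobi bound asks for the additional
     [1 + |ln |Omega||]. *)
  pose c' := c + 1 + `|ln (volume Omega)|.
  have cc' : c <= c' by rewrite /c'; lra.
  exists (9 * Ch * k * c').
    by rewrite !mulr_gt0 ?ltr0n//; exact: lt_le_trans (lt_le_trans ltr01 c1) cc'.
  move=> D dmin dmax M F' b phi diffD tri nv Faff phi_hat.
  have crit0 := crit M phi tri phi_hat.
  have crit' a (w : {set 'I_(nvert M)} -> R) (B : R) :
      (forall K, K \in elts M -> 0 <= w K <= B) ->
      0 < \sum_(K in elts M) w K * volume (cell K) ->
      \sum_(K in elts M) w K * volume (cell K) * fe_max a K ^+ 2 <=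
      k * (\sum_(K in elts M) w K * volume (cell K)) *
      (ln (B * volume Omega / \sum_(K in elts M) w K * volume (cell K)) + c') *
      fe_energy phi a.
    move=> wB S0; apply: le_trans (crit0 a w B wB S0) _.
    rewrite ler_wpM2r ?(fe_energy_ge0 tri)//.
    by rewrite ler_wpM2l ?lerD2l// ltW// mulr_gt0.
  split => [/eqP|_|/eqP|_]; rewrite ?(negPf d1)//.
  - exact: (kappa_dim2 Omega_polyhedral tri nv phi_hat diffD Ch0 slope Faff d2
              k0 (le_trans c1 cc') crit').
  - exact: (kappa_jacobi_dim2 Omega_polyhedral tri nv phi_hat diffD Ch0 slope Faff d2
              k0 c1 crit0).
have d3 : (2 < d)%N by rewrite ltn_neqAle eq_sym d2 ltn_neqAle eq_sym d1.
pose k := subcritical_const (volume Omega) d.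
have k0 : 0 < k := subcritical_const_gt0 d (ltW V0).
pose v := volume Omega `^ (1 - 2 / d%:R).
have v0 : 0 < v by rewrite powR_gt0.
(* The factor [1 + v^-1] suits both parts: it equals [(1 + v) / v], matching the bound for [A] with
   [k * (1 + v)], and the Jacobi bound is used with [k * (1 + v^-1)]. *)
exists (d.+1%:R ^+ 2 * Ch * (k * (1 + v^-1))).
  by rewrite !mulr_gt0 ?ltr0n ?exprn_gt0// addr_gt0// invr_gt0.
move=> D dmin dmax M F' b phi diffD tri nv Faff phi_hat.
have subcrit t a (w : {set 'I_(nvert M)} -> R) : 0 <= t ->
    (forall K, K \in elts M -> 0 <= w K) ->
    \sum_(K in elts M) w K * volume (cell K) * fe_max a K ^+ 2 <=
    (k * (1 + t)) *
    (\sum_(K in elts M) volume (cell K) * w K `^ (d%:R / 2)) `^ (2 / d%:R) *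
    fe_energy phi a.
  move=> t0 w0.
  apply: (le_trans (fe_weighted_subcritical Omega_polyhedral tri phi_hat a d3 w0)).
  rewrite ler_wpM2r ?(fe_energy_ge0 tri)// ler_wpM2r ?powR_ge0// ler_peMr ?(ltW k0)//.
  by rewrite lerDl.
split => [/eqP|_|/eqP|_]; rewrite ?(negPf d1) ?mulr1//.
- have -> : k * (1 + v^-1) = k * (1 + v) / v by field; rewrite gt_eqF.
  have kv : 0 < k * (1 + v) by rewrite mulr_gt0// addr_gt0.
  exact: (kappa_dim3 Omega_polyhedral tri nv phi_hat diffD Ch0 slope Faff d3
           kv (fun a w => subcrit v a w (ltW v0))).
- have vi : 0 < v^-1 by rewrite invr_gt0.
  have kv : 0 < k * (1 + v^-1) by rewrite mulr_gt0// addr_gt0.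
  exact: (kappa_jacobi_dim3 Omega_polyhedral tri nv phi_hat diffD Ch0 slope Faff d3
           kv (fun a w => subcrit v^-1 a w (ltW vi))).
Qed.
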